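(* For any constant $a\in\mathbb{N}^+$, any constant $c\in\mathbb{N}$, any $k=\Theta(n/\log^c n)$, any $\epsilon=1/2^{\Theta(\log^a n)}$ and any constant $\gamma\in(0,1)$, there exists an explicit strong $(k,\epsilon)$-extractor $\mathsf{Ext}:\{0,1\}^n\times\{0,1\}^d\to\{0,1\}^m$ computable in $\mathsf{AC}^0$ of depth $\Theta(a+c)$, where $d=(\log n)^{\Theta(a)}$, $m=n^{1/10800}(\log n)^{\Theta(a)}=k^{\Omega(1)}$, and the locality is $(\log n)^{\Theta(a+c)}$.
   Context: An $(n,k)$-source is a distribution on $\{0,1\}^n$ with min-entropy at least $k$. $\mathsf{Ext}$ is a strong $(k,\epsilon)$-extractor if for every $(n,k)$-source $X$ and independent uniform seed $U\in\{0,1\}^d$, $U\circ\mathsf{Ext}(X,U)$ is $\epsilon$-close in statistical distance to uniform on $\{0,1\}^{d+m}$. The locality is $\ell$ if for every fixed seed $r$, each output bit of $x\mapsto\mathsf{Ext}(x,r)$ depends on at most $\ell$ bits of $x$. $\mathsf{AC}^0$: polynomial-size, constant-depth circuits with NOT and unbounded fan-in AND/OR gates. Explicit means polynomial-time computable. Asymptotics are as $n\to\infty$. *)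

(* Defs.v *)
From HB Require Import structures.
From mathcomp Require Import all_boot all_order all_algebra.
From mathcomp Require Import all_classical all_reals all_analysis.

Set Implicit Arguments.
Unset Strict Implicit.
Unset Printing Implicit Defensive.

Import Order.TTheory GRing.Theory Num.Theory.
Local Open Scope classical_set_scope.
Local Open Scope ring_scope.

Section Asymptotics.
Variable R : realType.

Definition log2 (x : R) : R := ln x / ln 2.

(* Landau's Theta for eventually positive functions. The library's [=Theta_]
   compares norms, so it would also allow f to be negative. *)
Definition is_Theta (f g : nat -> R) : Prop :=
  exists c1 c2 : R, [/\ 0 < c1, 0 < c2 &
    \forall n \near \oo, c1 * g n <= f n <= c2 * g n].

(* Theta of a parameter that does not vary with n (such as Theta(a), for a
   constant a): the pair C holds the two absolute constants hidden by Theta,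
   so that v = Theta(t) reads C.1 * t <= v <= C.2 * t. *)
Definition Theta_consts (C : R * R) : Prop := 0 < C.1 /\ 0 < C.2.

Definition Theta_with (C : R * R) (v t : R) : Prop := C.1 * t <= v <= C.2 * t.

(* f n = g n * (log n)^Theta(t) as n tends to infinity, the exponent lying
   between C.1 * t and C.2 * t. *)
Definition polylog_Theta_with (C : R * R) (t : R) (g f : nat -> R) : Prop :=
  \forall n \near \oo,
    g n * log2 n%:R `^ (C.1 * t) <= f n <= g n * log2 n%:R `^ (C.2 * t).

End Asymptotics.

Section Extractors.
Variable R : realType.

Definition is_dist (T : finType) (P : {ffun T -> R}) : Prop :=
  (forall x, 0 <= P x) /\ \sum_x P x = 1.

Definition uniform (T : finType) : {ffun T -> R} := [ffun=> #|T|%:R^-1].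

Definition prod_dist (T U : finType) (P : {ffun T -> R}) (Q : {ffun U -> R}) :
  {ffun T * U -> R} := [ffun z => P z.1 * Q z.2].

Definition image_dist (T U : finType) (f : T -> U) (P : {ffun T -> R}) :
  {ffun U -> R} := [ffun y => \sum_(x | f x == y) P x].

(* For a distribution P the infimum is over a finite nonempty set, hence is the
   minimum over the support of P. *)
Definition min_entropy (T : finType) (P : {ffun T -> R}) : R :=
  inf [set log2 (P x)^-1 | x in [set x | 0 < P x]].

Definition stat_dist (T : finType) (P Q : {ffun T -> R}) : R :=
  2^-1 * \sum_x `|P x - Q x|.

Definition is_source (n : nat) (k : R) (X : {ffun n.-tuple bool -> R}) : Prop :=
  is_dist X /\ k <= min_entropy X.

Definition strong_extractor (n d m : nat) (k eps : R)
    (Ext : n.-tuple bool -> d.-tuple bool -> m.-tuple bool) : Prop :=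
  forall X : {ffun n.-tuple bool -> R}, is_source k X ->
    stat_dist
      (image_dist (fun z : n.-tuple bool * d.-tuple bool =>
                     [tuple of z.2 ++ Ext z.1 z.2])
                  (prod_dist X (uniform (d.-tuple bool))))
      (uniform ((d + m).-tuple bool)) <= eps.

End Extractors.

Definition depends_only_on (n : nat) (f : n.-tuple bool -> bool)
    (S : {set 'I_n}) : Prop :=
  forall x y : n.-tuple bool,
    (forall i, i \in S -> tnth x i = tnth y i) -> f x = f y.

Definition has_locality (n d m l : nat)
    (Ext : n.-tuple bool -> d.-tuple bool -> m.-tuple bool) : Prop :=
  forall (r : d.-tuple bool) (j : 'I_m), exists S : {set 'I_n},
    (#|S| <= l)%N /\ depends_only_on (fun x => tnth (Ext x r) j) S.

Definition ext_family (d m : nat -> nat) : Type :=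
  forall n, n.-tuple bool -> (d n).-tuple bool -> (m n).-tuple bool.

Definition poly_bound (C e N : nat) : nat := (C * N ^ e + C)%N.

(* A circuit on N input bits: wires 0 .. N-1 carry the inputs and the i-th gate
   drives wire N + i, so a circuit is a directed acyclic graph listed in
   topological order. The empty AND and OR give the constants. *)
Inductive gate : Type :=
| NotGate of nat
| AndGate of seq nat
| OrGate of seq nat.

Definition gate_inputs (g : gate) : seq nat :=
  match g with NotGate w => [:: w] | AndGate ws => ws | OrGate ws => ws end.

Record circuit : Type := Circuit {
  circ_gates : seq gate;
  circ_outputs : seq nat }.

Definition circ_wf (N : nat) (c : circuit) : Prop :=
  (forall i, (i < size (circ_gates c))%N ->
     all (fun w => w < N + i)%N
         (gate_inputs (nth (NotGate 0) (circ_gates c) i))) /\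
  all (fun w => w < N + size (circ_gates c))%N (circ_outputs c).

Definition eval_gate (vals : seq bool) (g : gate) : bool :=
  match g with
  | NotGate w => ~~ nth false vals w
  | AndGate ws => all (nth false vals) ws
  | OrGate ws => has (nth false vals) ws
  end.

Definition circ_eval (c : circuit) (inp : seq bool) : seq bool :=
  let vals :=
    foldl (fun vs g => rcons vs (eval_gate vs g)) inp (circ_gates c) in
  [seq nth false vals w | w <- circ_outputs c].

(* Every gate, including NOT, adds one to the depth. *)
Definition circ_depth (N : nat) (c : circuit) : nat :=
  let depths :=
    foldl (fun ds g => rcons ds (\max_(w <- gate_inputs g) nth 0%N ds w).+1)
          (nseq N 0%N) (circ_gates c) in
  \max_(w <- circ_outputs c) nth 0%N depths w.

Definition computable_in_AC0 (D : nat) (d m : nat -> nat)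
    (Ext : ext_family d m) : Prop :=
  exists C e : nat, forall n, exists c : circuit,
    [/\ circ_wf (n + d n) c,
        (size (circ_gates c) <= poly_bound C e (n + d n))%N,
        (circ_depth (n + d n) c <= D)%N &
        forall (x : n.-tuple bool) (r : (d n).-tuple bool),
          circ_eval c (x ++ r) = Ext n x r].

(* Deterministic multitape Turing machines with two-way infinite tapes. Tape 0
   holds the input at the start and the output when the machine halts. *)
Inductive symbol : Type := Blank | Sep | Bit of bool.

Inductive move : Type := MoveL | MoveS | MoveR.

Record TM : Type := MkTM {
  tm_state : finType;
  tm_tapes : nat;
  tm_start : tm_state;
  tm_halted : pred tm_state;
  tm_delta : tm_state -> {ffun 'I_tm_tapes.+1 -> symbol} ->
             tm_state * {ffun 'I_tm_tapes.+1 -> symbol * move} }.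

Record tape : Type := MkTape { tape_cells : int -> symbol; tape_head : int }.

Definition move_offset (mv : move) : int :=
  match mv with MoveL => -1 | MoveS => 0 | MoveR => 1 end.

Definition tape_read (t : tape) : symbol := tape_cells t (tape_head t).

Definition tape_act (t : tape) (a : symbol * move) : tape :=
  MkTape (fun z => if z == tape_head t then a.1 else tape_cells t z)
         (tape_head t + move_offset a.2).

Definition tape_of (s : seq symbol) : tape :=
  MkTape (fun z => if z is Posz j then nth Blank s j else Blank) 0.

Definition tm_config (M : TM) : Type :=
  (tm_state M * ('I_(tm_tapes M).+1 -> tape))%type.

Definition tm_step (M : TM) (c : tm_config M) : tm_config M :=
  if tm_halted c.1 then c else
  let qa := tm_delta c.1 [ffun i => tape_read (c.2 i)] in
  (qa.1, fun i => tape_act (c.2 i) (qa.2 i)).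

Definition tm_init (M : TM) (inp : seq symbol) : tm_config M :=
  (tm_start M, fun i => tape_of (if i == ord0 then inp else [::])).

(* M halts within t steps, with tape 0 holding exactly the bits of out from
   cell 0 on, followed by a blank. *)
Definition tm_computes (M : TM) (inp : seq symbol) (out : seq bool)
    (t : nat) : Prop :=
  let c := iter t (@tm_step M) (tm_init M inp) in
  tm_halted c.1 /\
  forall j : nat, (j <= size out)%N ->
    tape_cells (c.2 ord0) (Posz j) = nth Blank (map Bit out) j.

Definition explicit (d m : nat -> nat) (Ext : ext_family d m) : Prop :=
  exists (M : TM) (C e : nat),
    forall n (x : n.-tuple bool) (r : (d n).-tuple bool),
      tm_computes M (map Bit x ++ Sep :: map Bit r) (Ext n x r)
                  (poly_bound C e (n + d n)).

(* Main.v *)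
(** One output bit is a parity of sampled source bits, linear in the source x.
    A round of sampling reads a random affine map i |-> u + A i over F_2^lambda
    (lambda the bit length of n) and adds up, with independent random coefficients,
    the parities of x over the images of {0,1}^h for h = 0, ..., H. If z has weight
    at least 2^lambda / 2^(H+2), the expected number of hits of its support is
    between 1/4 and 1/2 at some level h, so pairwise independence makes that level
    odd with probability at least 3/16, and the round has bias at most 13/16 on z.
    XORing independent rounds multiplies the biases; the seed length does not depend
    on H, while 2^H = polylog(n) bounds the locality. Two independent samples of a
    source of min-entropy n / log^c n differ in few places with tiny probability, so
    the second moment of the bias of the output bit is small.

    Many bits are obtained as in the Nisan-Wigderson generator. Coordinate u of the
    seed of bit j is stored in cell (u, j mod p_u), p_u the u-th prime: bits i and j
    share coordinate u iff p_u divides i - j, so they share at most log m coordinates.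
    Once the other seed bits are fixed, the bits before bit i are determined by truth
    tables of total size m^2, and conditioning on those tables costs m^2 bits of
    entropy, far below the min-entropy.

    Explicitness: all the arithmetic is expressible by sums with variable bounds,
    truncated subtraction and input lookups; such expressions are evaluated in
    polynomial time by a machine using its heads as counters. In AC0, a lookup is a
    disjunction over positions and a parity of (C log n)^q bits is a tree of q levels
    of parities of C log n bits, each in disjunctive normal form. *)

Require Import Defs.
From mathcomp Require Import all_boot all_order all_algebra.
From mathcomp Require Import all_classical all_reals all_analysis.
From mathcomp Require Import zify ring lra.

Set Implicit Arguments.
Unset Strict Implicit.
Unset Printing Implicit Defensive.

Import Order.TTheory GRing.Theory Num.Theory.

(** * Structured programs on Turing machines *)

(** The constants hidden by each Theta are chosen before a and c are known, so the seed exponent may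
    depend on a alone. Therefore a round stores a full array with bitlen n + 1 rows, of which the
    levels up to H read only the first ones; c enters the locality and the depth, never the seed.
    Constants and lower-order terms are absorbed into exponents, using that a is positive. The
    weight of the difference of two samples is known only up to a polylogarithmic factor, so the
    right sampling rate is unknown. Independent coefficients spare the guess: a single level with an
    odd count balances the sign, whatever the other levels do. The bias gam of far pairs is merely
    2^(-polylog n), while conditioning produces up to 2^(m^2) classes, so a union bound over classes
    would fail. In the moment bound gam comes weighted by the probability of the class and sums to
    gam itself; only the error eta = 2^(-k/4) of near pairs is multiplied by the number of classes,
    which is affordable because m^2 is about the square root of n. *)

Section Structured_programs.
Variable K : nat.
Local Notation T := 'I_K.+2.
Local Notation reads := {ffun T -> symbol}.
Local Notation acts := {ffun T -> symbol * move}.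
Local Notation tapes := (T -> tape).

Inductive cmd : Type :=
| Atom of (reads -> acts)
| Seq of cmd & cmd
| While of (reads -> bool) & cmd.

Definition reads_of (tp : tapes) : reads := [ffun i => tape_read (tp i)].
Definition act_on (tp : tapes) (w : acts) : tapes :=
  fun i => tape_act (tp i) (w i).
Definition stay (r : reads) : acts := [ffun i => (r i, MoveS)].

Inductive exec : cmd -> tapes -> nat -> tapes -> Prop :=
| ExecAtom f tp : exec (Atom f) tp 1 (act_on tp (f (reads_of tp)))
| ExecSeq c1 c2 tp t1 tp1 t2 tp2 : exec c1 tp t1 tp1 -> exec c2 tp1 t2 tp2 ->
    exec (Seq c1 c2) tp (t1 + t2) tp2
| ExecDone (b : reads -> bool) c tp : ~~ b (reads_of tp) -> exec (While b c) tp 1 tp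
| ExecStep (b : reads -> bool) c tp t1 tp1 t2 tp2 : b (reads_of tp) ->
    exec c tp t1 tp1 -> exec (While b c) tp1 t2 tp2 ->
    exec (While b c) tp (t1 + t2).+1 tp2.

Lemma act_on_stay tp : act_on tp (stay (reads_of tp)) = tp.
Proof.
apply/funext => i; rewrite /act_on !ffunE /tape_act /tape_read /=.
case: (tp i) => c h /=; rewrite addr0; congr MkTape.
by apply/funext => z; case: eqP => [->|].
Qed.

(** Control states of a command that is still running; its end is signalled by the [None] that
    [cdelta] returns. A loop adds one state of its own, in which a step is spent on testing the
    guard. *)
Fixpoint cst (c : cmd) : finType :=
  match c with
  | Atom _ => unit
  | Seq c1 c2 => (cst c1 + cst c2)%type
  | While _ c => option (cst c)
  end.

Fixpoint cstart (c : cmd) : cst c :=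
  match c return cst c with
  | Atom _ => tt
  | Seq c1 c2 => inl (cstart c1)
  | While _ c => None
  end.

Fixpoint cdelta (c : cmd) : cst c -> reads -> option (cst c) * acts :=
  match c return cst c -> reads -> option (cst c) * acts with
  | Atom f => fun _ r => (None, f r)
  | Seq c1 c2 => fun s r =>
      match s with
      | inl s1 => let: (o, w) := @cdelta c1 s1 r in
          (Some (if o is Some s1' then inl s1' else inr (cstart c2)), w)
      | inr s2 => let: (o, w) := @cdelta c2 s2 r in (omap inr o, w)
      end
  | While b c => fun s r =>
      match s with
      | None => (if b r then Some (Some (cstart c)) else None, stay r)
      | Some s1 => let: (o, w) := @cdelta c s1 r in (Some o, w)
      end
  end.

Fixpoint run (c : cmd) (t : nat) (s : cst c) (tp tp' : tapes) : Prop :=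
  if t is t'.+1 then
    let: (o, w) := cdelta s (reads_of tp) in
    let tp1 := act_on tp w in
    if o is Some s1 then run t' s1 tp1 tp' else t' = 0 /\ tp' = tp1
  else False.

Lemma run_inr c1 c2 t (s : cst c2) tp tp1 :
  run t s tp tp1 -> run (c := Seq c1 c2) t (inr s) tp tp1.
Proof.
elim: t s tp => [//|t IH] s tp /=.
by case: (cdelta s _) => -[s1|] w /=; first exact: IH.
Qed.

Lemma run_inl c1 c2 t1 (s : cst c1) tp tp1 t2 tp2 :
  run t1 s tp tp1 -> run t2 (cstart c2) tp1 tp2 ->
  run (c := Seq c1 c2) (t1 + t2) (inl s) tp tp2.
Proof.
elim: t1 s tp => [//|t1 IH] s tp /=.
case: (cdelta s _) => -[s1|] w /=; first exact: IH.
by case=> -> -> H; exact: run_inr.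
Qed.

Lemma run_body b c t1 (s : cst c) tp tp1 t2 tp2 :
  run t1 s tp tp1 -> run (c := While b c) t2 None tp1 tp2 ->
  run (c := While b c) (t1 + t2) (Some s) tp tp2.
Proof.
elim: t1 s tp => [//|t1 IH] s tp.
rewrite addSn [X in X -> _]/=.
rewrite [X in _ -> _ -> X]/=.
case: (cdelta s _) => -[s1|] w; first exact: IH.
by case=> -> ->.
Qed.

Lemma exec_run c tp t tp' : exec c tp t tp' -> run t (cstart c) tp tp'.
Proof.
elim=> {c tp t tp'} //=.
- by move=> c1 c2 tp t1 tp1 t2 tp2 _ IH1 _ IH2; apply: run_inl; eauto.
- by move=> b c tp /negbTE ->; rewrite act_on_stay.
- move=> b c tp t1 tp1 t2 tp2 -> _ IH1 _ IH2; rewrite act_on_stay.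
  exact: run_body IH1 IH2.
Qed.

Definition cmd_TM (c : cmd) : TM :=
  @MkTM (option (cst c)) K.+1 (Some (cstart c)) (fun s => ~~ isSome s)
    (fun s r => if s is Some s1 then cdelta s1 r else (None, stay r)).

(** A halted configuration is a fixed point of the step function, so an upper bound on the running
    time serves as well as its exact value. *)
Lemma cmd_TM_computes c inp t tp' :
  exec c (fun i : T => tape_of (if i == ord0 then inp else [::])) t tp' ->
  forall t', t <= t' ->
  iter t' (@tm_step (cmd_TM c)) (tm_init (cmd_TM c) inp) = (None, tp').
Proof.
move/exec_run; set tp := (fun i => _).
have halt n tp0 : iter n (@tm_step (cmd_TM c)) (None, tp0) = (None, tp0).
  by elim: n => //= n ->.
change (tm_init (cmd_TM c) inp) with ((Some (cstart c), tp) : tm_config (cmd_TM c)).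
move: (cstart c) (tp) => s {}tp.
elim: t s tp => [//|t IH] s tp /= H [//|t' le_tt'].
rewrite iterSr.
set cf := tm_step _.
have {cf} -> : cf =
    ((cdelta s (reads_of tp)).1, act_on tp (cdelta s (reads_of tp)).2) by reflexivity.
case: (cdelta s _) H => -[s1|] w /= H; first exact: IH.
by case: H => _ ->; exact: halt.
Qed.

End Structured_programs.
Arguments act_on : simpl never.

(** * Counters held by tape heads *)

Definition is_sep (s : symbol) : bool := if s is Sep then true else false.

Lemma tape_act_read t mv : tape_act t (tape_read t, mv) =
  MkTape (tape_cells t) (tape_head t + move_offset mv)%R.
Proof.
rewrite /tape_act /tape_read /=; congr MkTape.
by apply/funext => z; case: eqP => [->|].
Qed.

Definition upd (f : nat -> nat) (i v : nat) : nat -> nat :=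
  fun j => if j == i then v else f j.

Record cstate : Type := CState { cnt : nat -> nat; ipos : nat; cout : seq bool }.

Section Counters.
Variables (K : nat) (inp : seq symbol).
Local Notation T := 'I_K.+2.
Local Notation reads := {ffun T -> symbol}.
Local Notation acts := {ffun T -> symbol * move}.
Local Notation tapes := (T -> tape).

(* Tape 0 is the output and tape 1 a copy of the input. Counter i is tape i + 2:
   its value is the head position, and a Sep in cell 0 allows the zero test. *)
Definition ct (i : nat) : T := inord i.+2.
Definition in_t : T := inord 1.

Lemma in_t0 : in_t != ord0.
Proof. by rewrite -val_eqE /= inordK. Qed.

Lemma ct0 i : i < K -> ct i != ord0.
Proof. by move=> iK; rewrite -val_eqE /= inordK ?ltnS. Qed.

Lemma ct_in i : i < K -> ct i != in_t.
Proof. by move=> iK; rewrite -val_eqE /= !inordK ?ltnS. Qed.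

Lemma ct_eq i j : i < K -> j < K -> (ct i == ct j) = (i == j).
Proof. by move=> iK jK; rewrite -val_eqE /= !inordK ?ltnS. Qed.

Definition only (j : T) (v : symbol * move) (r : reads) : acts :=
  [ffun i => if i == j then v else (r i, MoveS)].

Lemma act_on_only tp j v i :
  act_on tp (only j v (reads_of tp)) i =
  if i == j then tape_act (tp i) v else tp i.
Proof.
rewrite /act_on !ffunE; case: (i == j) => //.
by rewrite tape_act_read /= addr0; case: (tp i).
Qed.

Definition Inc i : cmd K := Atom (fun r => only (ct i) (r (ct i), MoveR) r).
Definition Dec i : cmd K := Atom (fun r =>
  only (ct i) (r (ct i), if is_sep (r (ct i)) then MoveS else MoveL) r).
Definition IncIf (p : symbol -> bool) i : cmd K := Atom (fun r =>
  only (ct i) (r (ct i), if p (r in_t) then MoveR else MoveS) r).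
Definition InR : cmd K := Atom (fun r => only in_t (r in_t, MoveR) r).
Definition InL : cmd K := Atom (fun r => only in_t (r in_t, MoveL) r).
Definition OutBit i : cmd K := Atom (fun r =>
  only ord0 (Bit (~~ is_sep (r (ct i))), MoveR) r).
Definition cnz i (r : reads) : bool := ~~ is_sep (r (ct i)).

Definition counter_tape (v : nat) : tape :=
  MkTape (fun z => if z == 0%R then Sep else Blank) (Posz v).

(** Tape 0 is constrained only on the output written so far: further to the right it may still carry
    the original input. *)
Definition rep (s : cstate) (tp : tapes) : Prop :=
  [/\ tp in_t = MkTape (tape_cells (tape_of inp)) (Posz (ipos s)),
      (forall i, i < K -> tp (ct i) = counter_tape (cnt s i)),
      tape_head (tp ord0) = Posz (size (cout s)) &
      forall j, j < size (cout s) ->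
        tape_cells (tp ord0) (Posz j) = Bit (nth false (cout s) j)].

Definition cexec (c : cmd K) (s : cstate) (t : nat) (s' : cstate) : Prop :=
  forall tp, rep s tp ->
  exists t' tp', [/\ t' <= t, exec c tp t' tp' & rep s' tp'].

Lemma rep_sep s tp i : rep s tp -> i < K ->
  is_sep (reads_of tp (ct i)) = (cnt s i == 0).
Proof.
by move=> [_ H _ _] iK; rewrite ffunE H //= /tape_read /=; case: (cnt s i).
Qed.

Lemma rep_inp s tp : rep s tp ->
  reads_of tp in_t = nth Blank inp (ipos s).
Proof. by move=> [H _ _ _]; rewrite ffunE H. Qed.

Lemma rep_move_cnt s tp i mv v : rep s tp -> i < K ->
  (Posz (cnt s i) + move_offset mv)%R = Posz v ->
  rep (CState (upd (cnt s) i v) (ipos s) (cout s))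
      (act_on tp (only (ct i) (reads_of tp (ct i), mv) (reads_of tp))).
Proof.
move=> [Hi Hc Ho Ho'] iK Ev; split.
- by rewrite act_on_only eq_sym (negbTE (ct_in iK)).
- move=> j jK; rewrite act_on_only ct_eq // [cnt (CState _ _ _)]/= /upd.
  case: eqP => [->|_]; last exact: Hc.
  by rewrite ffunE tape_act_read Hc //= Ev.
- by rewrite act_on_only eq_sym (negbTE (ct0 iK)).
- by move=> j; rewrite act_on_only eq_sym (negbTE (ct0 iK)); exact: Ho'.
Qed.

Lemma rep_move_inp s tp mv v : rep s tp ->
  (Posz (ipos s) + move_offset mv)%R = Posz v ->
  rep (CState (cnt s) v (cout s))
      (act_on tp (only in_t (reads_of tp in_t, mv) (reads_of tp))).
Proof.
move=> [Hi Hc Ho Ho'] Ev; split.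
- by rewrite act_on_only eqxx ffunE tape_act_read Hi /= Ev.
- by move=> j jK; rewrite act_on_only (negbTE (ct_in jK)); exact: Hc.
- by rewrite act_on_only eq_sym (negbTE in_t0).
- by move=> j; rewrite act_on_only eq_sym (negbTE in_t0); exact: Ho'.
Qed.

Lemma cexec_atom f s s' :
  (forall tp, rep s tp -> rep s' (act_on tp (f (reads_of tp)))) ->
  cexec (Atom f) s 1 s'.
Proof.
move=> H tp rs; exists 1, (act_on tp (f (reads_of tp))).
by split=> //; [exact: ExecAtom | exact: H].
Qed.

Lemma cexec_Inc i c p o : i < K ->
  cexec (Inc i) (CState c p o) 1 (CState (upd c i (c i).+1) p o).
Proof.
move=> iK; apply: cexec_atom => tp rs.
by apply: (rep_move_cnt rs iK) => /=; rewrite -PoszD addn1.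
Qed.

Lemma cexec_Dec i c p o : i < K ->
  cexec (Dec i) (CState c p o) 1 (CState (upd c i (c i).-1) p o).
Proof.
move=> iK; apply: cexec_atom => tp rs.
apply: (rep_move_cnt rs iK); rewrite (rep_sep rs iK) /=.
by case: (c i) => [|v] //=; rewrite -addn1 PoszD addrK.
Qed.

Lemma cexec_IncIf q i c p o : i < K ->
  cexec (IncIf q i) (CState c p o) 1
    (CState (upd c i (c i + q (nth Blank inp p))) p o).
Proof.
move=> iK; apply: cexec_atom => tp rs.
apply: (rep_move_cnt rs iK); rewrite (rep_inp rs) /= PoszD.
by case: (q _).
Qed.

Lemma cexec_InR c p o : cexec InR (CState c p o) 1 (CState c p.+1 o).
Proof.
apply: cexec_atom => tp rs; apply: (rep_move_inp rs) => /=.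
by rewrite -PoszD addn1.
Qed.

Lemma cexec_InL c p o : cexec InL (CState c p.+1 o) 1 (CState c p o).
Proof.
apply: cexec_atom => tp rs; apply: (rep_move_inp rs) => /=.
by rewrite -addn1 PoszD addrK.
Qed.

Lemma cexec_OutBit i c p o : i < K ->
  cexec (OutBit i) (CState c p o) 1 (CState c p (rcons o (c i != 0))).
Proof.
move=> iK; apply: cexec_atom => tp rs; rewrite (rep_sep rs iK) /=.
case: rs => Hi Hc Ho Ho'; split.
- by rewrite act_on_only (negbTE in_t0).
- by move=> j jK; rewrite act_on_only (negbTE (ct0 jK)); exact: Hc.
- by rewrite act_on_only eqxx /= Ho size_rcons -PoszD addn1.
- move=> j; rewrite act_on_only eqxx /= size_rcons ltnS nth_rcons Ho eqz_nat.
  by case: ltngtP => //= jo _; exact: Ho'.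
Qed.

Lemma cexec_Seq c1 c2 s t1 s1 t2 s2 :
  cexec c1 s t1 s1 -> cexec c2 s1 t2 s2 -> cexec (Seq c1 c2) s (t1 + t2) s2.
Proof.
move=> H1 H2 tp /H1 [u1 [tp1 [le1 e1 /H2 [u2 [tp2 [le2 e2 r2]]]]]].
exists (u1 + u2), tp2; split=> //; first exact: leq_add.
exact: ExecSeq e1 e2.
Qed.

Lemma cexec_leq c s t t' s' : t <= t' -> cexec c s t s' -> cexec c s t' s'.
Proof.
move=> le H tp /H [u [tp' [leu e r]]]; exists u, tp'; split=> //.
exact: leq_trans leu le.
Qed.

(** The invariant is the sequence [S] of the states after each round. Every round pays one extra
    step for its test, and the failing test pays the last one. *)
Lemma cexec_loop i body (S : nat -> cstate) n t : i < K ->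
  (forall j, j < n -> cnt (S j) i != 0) -> cnt (S n) i = 0 ->
  (forall j, j < n -> cexec body (S j) t (S j.+1)) ->
  cexec (While (cnz i) body) (S 0) (n * t.+1).+1 (S n).
Proof.
move=> iK; elim: n S => [|n IH] S Hn H0 Hb tp rs.
  exists 1, tp; split=> //; apply: ExecDone.
  by rewrite /cnz (rep_sep rs iK) H0 eqxx.
have [u [tp1 [leu e1 /(IH (S \o succn))]]] := Hb 0 isT _ rs.
case=> //= [j jn|j jn|v [tp2 [lev e2 r2]]]; [exact: (Hn j.+1)|exact: Hb|].
exists (u + v).+1, tp2; split=> //; last first.
  by apply: (ExecStep _ e1 e2); rewrite /cnz (rep_sep rs iK) Hn.
by rewrite mulSn; move: (n * _) lev => w; lia.
Qed.

End Counters.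

(** * Compiling arithmetic expressions with bounded sums *)

Inductive expr : Type :=
| EVar of nat
| EOne
| EAdd of expr & expr
| ESub of expr & expr
| EInp of (symbol -> bool) & expr
| ESum of expr & expr.

Definition scons (i : nat) (env : nat -> nat) : nat -> nat :=
  fun v => if v is v'.+1 then env v' else i.

Fixpoint eeval (inp : seq symbol) (e : expr) (env : nat -> nat) : nat :=
  match e with
  | EVar v => env v
  | EOne => 1
  | EAdd e1 e2 => eeval inp e1 env + eeval inp e2 env
  | ESub e1 e2 => eeval inp e1 env - eeval inp e2 env
  | EInp p e1 => p (nth Blank inp (eeval inp e1 env))
  | ESum e1 e2 => \sum_(i < eeval inp e1 env) eeval inp e2 (scons i env)
  end.

(** Number of scratch counters in simultaneous use; sibling subexpressions share theirs, hence the
    maximum. *)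
Fixpoint width (e : expr) : nat :=
  match e with
  | EVar _ => 1
  | EOne => 0
  | EAdd e1 e2 => maxn (width e1) (width e2)
  | ESub e1 e2 => (maxn (width e1) (width e2)).+2
  | EInp _ e1 => (width e1).+2
  | ESum e1 e2 => (maxn (width e1) (width e2)).+2
  end.

Lemma expn_leqD X a b p q : 1 < X -> a <= X ^ p -> b <= X ^ q ->
  a + b <= X ^ (p + q).+1.
Proof.
move=> X1 ap bq; have [p0 q0] : 0 < X ^ p /\ 0 < X ^ q by rewrite !expn_gt0; lia.
rewrite expnS expnD; move: (X ^ p) (X ^ q) ap bq p0 q0 => P Q aP bQ P0 Q0.
apply: leq_trans (_ : 2 * (P * Q) <= _); first by nia.
by rewrite leq_mul2r X1 orbT.
Qed.

(** A sum has as many terms as the value of its range, so every value is polynomial in the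
    variables. The base [M.+2] is at least 2, which lets a higher power absorb sums and
    constants. *)
Lemma eeval_bound e : exists p, forall inp M env, (forall v, env v <= M) ->
  eeval inp e env <= M.+2 ^ p.
Proof.
elim: e => [v||e1 [p1 H1] e2 [p2 H2]|e1 [p1 H1] e2 [p2 H2]|q e1 [p1 H1]|
            e1 [p1 H1] e2 [p2 H2]].
- by exists 1 => inp M env /(_ v) /=; lia.
- by exists 0.
- exists (p1 + p2).+1 => inp M env Me /=.
  by apply: expn_leqD; [|exact: H1|exact: H2].
- exists p1 => inp M env Me /=; exact: leq_trans (leq_subr _ _) (H1 _ _ _ Me).
- by exists 0 => inp M env Me /=; case: (q _).
- exists (p1 + p1.+2 * p2) => inp M env Me /=.
  (* With X = M + 2, the summation index is below X^p1. The extended environment is thus bounded by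
     M + X^p1, and M + X^p1 + 2 <= X^(p1 + 2). *)
  have H1e := H1 inp _ _ Me; rewrite expnD expnM.
  have Xp : 0 < M.+2 ^ p1 by rewrite expn_gt0.
  have le2 : (M + M.+2 ^ p1).+2 <= M.+2 ^ p1.+2 by rewrite !expnS; nia.
  apply: leq_trans (_ : \sum_(i < eeval inp e1 env) (M.+2 ^ p1.+2) ^ p2 <= _).
    apply: leq_sum => i _; apply: (leq_trans (H2 inp (M + M.+2 ^ p1) _ _)).
      case=> [|v] /=; first by have := ltn_ord i; lia.
      by have := Me v; lia.
    by case: (p2) => [//|p]; rewrite leq_exp2r.
  by rewrite sum_nat_const card_ord leq_mul2r H1e orbT.
Qed.

Section Compile.
Variable K : nat.
Local Notation Inc := (@Inc K).
Local Notation Dec := (@Dec K).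

(* The program adds the value of e to counter dest. Variable v lives in counter vt v;
   the counters from k on are scratch, zero before and after. *)
Fixpoint compile (e : expr) (vt : nat -> nat) (k dest : nat) : cmd K :=
  match e with
  | EVar v => Seq (While (cnz (vt v)) (Seq (Dec (vt v)) (Inc k)))
                 (While (cnz k) (Seq (Dec k) (Seq (Inc (vt v)) (Inc dest))))
  | EOne => Inc dest
  | EAdd e1 e2 => Seq (compile e1 vt k dest) (compile e2 vt k dest)
  | ESub e1 e2 =>
      Seq (compile e1 vt k.+2 k) (Seq (compile e2 vt k.+2 k.+1)
        (Seq (While (cnz k.+1) (Seq (Dec k.+1) (Dec k)))
             (While (cnz k) (Seq (Dec k) (Inc dest)))))
  | EInp p e1 =>
      Seq (compile e1 vt k.+2 k)
        (Seq (While (cnz k) (Seq (Dec k) (Seq (Inc k.+1) (@InR K))))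
          (Seq (IncIf K p dest)
               (While (cnz k.+1) (Seq (Dec k.+1) (@InL K)))))
  | ESum e1 e2 =>
      Seq (compile e1 vt k.+2 k)
        (Seq (While (cnz k) (Seq (Dec k)
                (Seq (compile e2 (scons k.+1 vt) k.+2 dest) (Inc k.+1))))
             (While (cnz k.+1) (Dec k.+1)))
  end.

Lemma cexec_to inp (c : cmd K) s t s1 t' s2 :
  cexec inp c s t s1 -> s1 = s2 -> t <= t' -> cexec inp c s t' s2.
Proof. by move=> H <- le; exact: cexec_leq le H. Qed.

Ltac fun_eq := apply/funext => ?; rewrite /upd /=;
  repeat (case: eqP => ? ; subst => //); try lia; try congruence.
Ltac upd_simp := rewrite /= /upd; do !case: eqP => //; try lia.

Lemma loop_spec inp i (body : cmd K) (c : nat -> nat -> nat) (p : nat -> nat) o n t s s' :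
  i < K -> (forall j, j <= n -> c j i = n - j) ->
  (forall j, j < n -> c j i = n - j ->
    cexec inp body (CState (c j) (p j) o) t (CState (c j.+1) (p j.+1) o)) ->
  s = CState (c 0) (p 0) o -> CState (c n) (p n) o = s' ->
  cexec inp (While (cnz i) body) s (n * t.+1).+1 s'.
Proof.
move=> iK Hi Hb -> <-.
apply: (@cexec_loop K inp i body (fun j => CState (c j) (p j) o)) => //=.
- by move=> j jn; rewrite Hi; lia.
- by rewrite Hi // subnn.
- by move=> j jn; apply: Hb => //; apply: Hi; lia.
Qed.

(** The exponent depends on [e] alone: each loop runs as often as some value bounded by
    [eeval_bound]. The pieces compose because the input head returns to cell 0, the variables are
    restored and the scratch counters end at zero. *)
Lemma compile_spec e : exists q, forall inp M vt k dest c o,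
  (forall v, vt v < k) -> (forall v, vt v <> dest) -> dest < k ->
  (forall j, k <= j -> c j = 0) -> k + width e <= K ->
  (forall v, c (vt v) <= M) ->
  cexec inp (compile e vt k dest) (CState c 0 o) (M.+2 ^ q)
    (CState (upd c dest (c dest + eeval inp e (c \o vt))) 0 o).
Proof.
elim: e => [v||e1 [q1 H1] e2 [q2 H2]|e1 [q1 H1] e2 [q2 H2]|p e1 [q1 H1]|
            e1 [q1 H1] e2 [q2 H2]].
- exists 5 => inp M vt k dest c o vk vd dk c0 /= kK Me.
  have := Me v; set x := c (vt v) => xM.
  have [vkv vdv] := (vk v, vd v).
  have ck : c k = 0 by exact: c0.
  apply: cexec_to.
  + apply: cexec_Seq.
    * apply: (loop_spec (c := fun j => upd (upd c (vt v) (x - j)) k j)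
                (p := fun=> 0) (n := x) (t := 2)); [lia| | |by congr CState; fun_eq|by []].
        by move=> j jx; upd_simp.
      move=> j jx _; apply: cexec_to; [apply: cexec_Seq| |].
        - by apply: cexec_Dec; lia.
        - by apply: cexec_Inc; lia.
        - by congr CState; fun_eq.
        - by [].
    * apply: (loop_spec (c := fun j =>
          upd (upd (upd c (vt v) j) k (x - j)) dest (c dest + j))
                (p := fun=> 0) (n := x) (t := 3)); [lia| | |by congr CState; fun_eq|by []].
        by move=> j jx; upd_simp.
      move=> j jx _; apply: cexec_to; [apply: cexec_Seq;[|apply: cexec_Seq]| |].
        - by apply: cexec_Dec; lia.
        - by apply: cexec_Inc; lia.
        - by apply: cexec_Inc; lia.
        - by congr CState; fun_eq.
        - by [].
  + by congr CState; fun_eq.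
  + have : (M.+2) ^ 2 * 8 <= M.+2 ^ 5.
      by rewrite -[8]/(2 ^ 3) (expnD _ 2 3) leq_mul2l leq_exp2r // orbT.
    by rewrite [M.+2 ^ 2]expnS expn1; nia.
- exists 1 => inp M vt k dest c o vk vd dk c0 /= kK Me.
  by apply: cexec_to; [apply: cexec_Inc; lia|congr CState; fun_eq|].
- exists (q1 + q2).+1 => inp M vt k dest c o vk vd dk c0 /= kK Me.
  have ve : upd c dest (c dest + eeval inp e1 (c \o vt)) \o vt = c \o vt.
    by apply/funext => v; rewrite /upd /=; case: eqP => // /vd.
  apply: cexec_to; first apply: cexec_Seq.
  + by apply: (H1 inp M) => //; lia.
  + apply: (H2 inp M) => //; [|lia|].
    * by move=> j kj; rewrite /upd; case: eqP => [|_]; [lia|exact: c0].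
    * by move=> v; rewrite -[upd _ _ _ _]/((upd _ _ _ \o vt) v) ve; exact: Me.
  + by rewrite ve; congr CState; fun_eq.
  + exact: expn_leqD.
- have [p1 B1] := eeval_bound e1; have [p2 B2] := eeval_bound e2.
  exists (q1 + (q2 + ((p2 + 2).+1 + (p1 + 2).+1).+1).+1).+1 => inp M vt k dest c o vk vd dk c0 /= kK Me.
  have [ck ck1] : c k = 0 /\ c k.+1 = 0 by rewrite !c0.
  have Bx := B1 inp M (c \o vt) Me; have By := B2 inp M (c \o vt) Me.
  set x := eeval inp e1 _ in Bx *; set y := eeval inp e2 _ in By *.
  have ve : upd c k x \o vt = c \o vt.
    by apply/funext => v; rewrite /upd /=; case: eqP => // E; have := vk v; lia.
  apply: cexec_to; first (apply: cexec_Seq;[|apply: cexec_Seq;[|apply: cexec_Seq]]).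
  + apply: (H1 inp M) => //; try (by move=> ?; have := vk _; lia); try lia.
    * by move=> v; have := vk v; lia.
    * by move=> v; have := vk v; lia.
    * by move=> j ?; apply: c0; lia.
  + rewrite ck add0n; apply: (H2 inp M) => //; try lia.
    * by move=> v; have := vk v; lia.
    * by move=> v; have := vk v; lia.
    * by move=> j kj; rewrite /upd; case: eqP => [|_]; [lia|apply: c0; lia].
    * by move=> v; rewrite -[upd _ _ _ _]/((upd _ _ _ \o vt) v) ve; exact: Me.
  + rewrite ve.
    apply: (loop_spec (c := fun j => upd (upd c k (x - j)) k.+1 (y - j))
              (p := fun=> 0) (n := y) (t := 2)); [lia| | | |by []].
    * by move=> j jx; upd_simp.
    * move=> j jx _; apply: cexec_to; [apply: cexec_Seq| |].
      - by apply: cexec_Dec; lia.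
      - by apply: cexec_Dec; lia.
      - by congr CState; fun_eq.
      - by [].
    * by congr CState; fun_eq.
  + apply: (loop_spec (c := fun j => upd (upd c k (x - y - j)) dest (c dest + j))
              (p := fun=> 0) (n := x - y) (t := 2)); [lia| | | |by []].
    * by move=> j jx; upd_simp.
    * move=> j jx _; apply: cexec_to; [apply: cexec_Seq| |].
      - by apply: cexec_Dec; lia.
      - by apply: cexec_Inc; lia.
      - by congr CState; fun_eq.
      - by [].
    * by congr CState; fun_eq.
  + by congr CState; fun_eq.
  + apply: expn_leqD => //; apply: expn_leqD => //.
    have E p q z : z <= M.+2 ^ p -> q = p.+3 -> (z * 3).+1 <= M.+2 ^ q.
      move=> zp ->; have p0 : 0 < M.+2 ^ p by rewrite expn_gt0.
      rewrite -[p.+3]addn3 expnD; have : 2 ^ 3 <= M.+2 ^ 3 by rewrite leq_exp2r.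
      by move: (M.+2 ^ 3) (M.+2 ^ p) zp p0 => P Q; rewrite (_ : 2 ^ 3 = 8) //; nia.
    apply: expn_leqD => //; first by apply: E By _; lia.
    by apply: (E p1); lia.
- have [p1 B1] := eeval_bound e1.
  exists (q1 + (p1.+4 + (0 + p1.+4).+1).+1).+1 => inp M vt k dest c o vk vd dk c0 /= kK Me.
  have [ck ck1] : c k = 0 /\ c k.+1 = 0 by rewrite !c0.
  have Bx := B1 inp M (c \o vt) Me.
  set x := eeval inp e1 _ in Bx *.
  apply: cexec_to; first (apply: cexec_Seq;[|apply: cexec_Seq;[|apply: cexec_Seq]]).
  + apply: (H1 inp M) => //; try lia.
    * by move=> v; have := vk v; lia.
    * by move=> v; have := vk v; lia.
    * by move=> j ?; apply: c0; lia.
  + rewrite ck add0n.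
    apply: (loop_spec (c := fun j => upd (upd c k (x - j)) k.+1 j)
              (p := fun j => j) (n := x) (t := 3)); [lia| | | |by []].
    * by move=> j jx; upd_simp.
    * move=> j jx _; apply: cexec_to; [apply: cexec_Seq; [|apply: cexec_Seq]| |].
      - by apply: cexec_Dec; lia.
      - by apply: cexec_Inc; lia.
      - exact: cexec_InR.
      - by congr CState; fun_eq.
      - by [].
    * by congr CState; fun_eq.
  + by apply: cexec_IncIf; lia.
  + apply: (loop_spec
        (c := fun j => upd (upd c k.+1 (x - j)) dest (c dest + p (nth Blank inp x)))
        (p := fun j => x - j) (n := x) (t := 2)); [lia| | | |by []].
    * by move=> j jx; upd_simp.
    * move=> j jx _; rewrite (_ : x - j = (x - j.+1).+1); last by lia.
      apply: cexec_to; [apply: cexec_Seq| |].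
      - by apply: cexec_Dec; lia.
      - exact: cexec_InL.
      - by congr CState; fun_eq.
      - by [].
    * by rewrite subn0; congr CState; fun_eq.
  + by rewrite subnn; congr CState; fun_eq.
  + have E z q : z <= M.+2 ^ p1 -> q <= 4 -> (z * q).+1 <= M.+2 ^ p1.+4.
      move=> zp q4; have p0 : 0 < M.+2 ^ p1 by rewrite expn_gt0.
      rewrite -[p1.+4]addn4 expnD; have : 2 ^ 4 <= M.+2 ^ 4 by rewrite leq_exp2r.
      by move: (M.+2 ^ 4) (M.+2 ^ p1) zp p0 => P Q; rewrite (_ : 2 ^ 4 = 16) //; nia.
    by apply: expn_leqD => //; apply: expn_leqD => //;
      [exact: E|apply: expn_leqD => //; exact: E].
- have [p1 B1] := eeval_bound e1.
  exists (q1 + ((p1 + (p1.+2 * q2 + 2) + 2) + (p1 + 2)).+1).+1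
    => inp M vt k dest c o vk vd dk c0 /= kK Me.
  have [ck ck1] : c k = 0 /\ c k.+1 = 0 by rewrite !c0.
  have Bx := B1 inp M (c \o vt) Me.
  set x := eeval inp e1 _ in Bx *.
  have Xp : 0 < M.+2 ^ p1 by rewrite expn_gt0.
  have le2 : (M + M.+2 ^ p1).+2 <= M.+2 ^ p1.+2 by rewrite !expnS; nia.
  set F := fun j => c dest + \sum_(i < j) eeval inp e2 (scons i (c \o vt)).
  set T2 := (M + M.+2 ^ p1).+2 ^ q2.
  have leT2 : T2 <= M.+2 ^ (p1.+2 * q2).
    by rewrite expnM /T2; case: (q2) => // q; rewrite leq_exp2r.
  apply: cexec_to; first (apply: cexec_Seq;[|apply: cexec_Seq]).
  + apply: (H1 inp M) => //; try lia.
    * by move=> v; have := vk v; lia.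
    * by move=> v; have := vk v; lia.
    * by move=> j ?; apply: c0; lia.
  + rewrite ck add0n.
    apply: (loop_spec
        (c := fun j => upd (upd (upd c k (x - j)) k.+1 j) dest (F j))
        (p := fun=> 0) (n := x) (t := 1 + (T2 + 1))); [lia| | | |by []].
    * by move=> j jx; upd_simp.
    * move=> j jx _; set cj := upd (upd (upd _ _ _) _ _) _ _.
      set cj' := upd cj k (cj k).-1.
      (* Counter k + 1 holds the summation index, so binding a variable to it extends the
         environment by j. *)
      have ve : cj' \o scons k.+1 vt = scons j (c \o vt).
        apply/funext => -[|v]; rewrite /cj' /cj /upd /=.
          by do !case: eqP => //; lia.
        by have := vk v; have := vd v; do !case: eqP => //; lia.
      apply: cexec_to; [apply: cexec_Seq; [|apply: cexec_Seq]| |].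
      - by apply: cexec_Dec; lia.
      - rewrite -/cj'; apply: (H2 inp (M + M.+2 ^ p1)) => //.
        + by case=> [|v] /=; [|have := vk v]; lia.
        + by case=> [|v] /=; [lia|exact: vd].
        + lia.
        + by move=> i ik; rewrite /cj' /cj /upd; do !case: eqP => [|_]; try lia;
            apply: c0; lia.
        + lia.
        + move=> v; rewrite -[cj' _]/((cj' \o _) v) ve.
          by case: v => [|v] /=; [lia|have := Me v; lia].
      - by apply: cexec_Inc; lia.
      - rewrite ve /cj' /cj /F; congr CState.
        apply/funext => i; rewrite /upd /= big_ord_recr /=.
        by do !case: eqP => ?; subst => //; try lia.
      - by [].
    * by rewrite /F big_ord0; congr CState; fun_eq.
  + apply: (loop_spec (c := fun j => upd (upd c k.+1 (x - j)) dest (F x))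
        (p := fun=> 0) (n := x) (t := 1)); [lia| | | |by []].
    * by move=> j jx; upd_simp.
    * move=> j jx _; apply: cexec_to; [by apply: cexec_Dec; lia| |by []].
      by congr CState; fun_eq.
    * by congr CState; fun_eq.
  + by congr CState; rewrite /F; fun_eq.
  + have E z p w q : z <= M.+2 ^ p -> w <= M.+2 ^ q -> (z * w).+1 <= M.+2 ^ (p + q + 2).
      move=> zp wq; have p0 : 0 < M.+2 ^ (p + q) by rewrite expn_gt0.
      have zw : z * w <= M.+2 ^ (p + q) by rewrite expnD leq_mul.
      by rewrite expnD [M.+2 ^ 2]expnS expn1; move: (M.+2 ^ (p + q)) (z * w) zw p0 => P Q; nia.
    have E2 w q : w <= M.+2 ^ q -> (1 + (w + 1)).+1 <= M.+2 ^ (q + 2).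
      move=> wq; have p0 : 0 < M.+2 ^ q by rewrite expn_gt0.
      by rewrite expnD [M.+2 ^ 2]expnS expn1; nia.
    apply: expn_leqD => //; apply: expn_leqD => //.
      by apply: E => //; exact: E2.
    have : 4 * M.+2 ^ p1 <= M.+2 ^ (p1 + 2).
      by rewrite expnD mulnC leq_mul2l [M.+2 ^ 2]expnS expn1; nia.
    by move: (M.+2 ^ p1) (M.+2 ^ _) Bx Xp; lia.
Qed.

End Compile.

(** * Reading the input, writing the output, polynomial running time *)

Definition is_blank (s : symbol) : bool := if s is Blank then true else false.

Section Setup.
Variable K : nat.
Local Notation T := 'I_K.+2.
Local Notation reads := {ffun T -> symbol}.
Local Notation acts := {ffun T -> symbol * move}.
Local Notation tapes := (T -> tape).
Local Notation in_t := (in_t K).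
Local Notation ct := (ct K).
Hypothesis K0 : 0 < K.

Definition Mark : cmd K := Atom (fun r => [ffun i =>
  if (i == ord0) || (i == in_t) then (r i, MoveS) else (Sep, MoveS)]).
Definition Copy : cmd K := Atom (fun r => [ffun i =>
  if i == ord0 then (r i, MoveR) else if i == in_t then (r ord0, MoveR)
  else (r i, if i == ct 0 then MoveR else MoveS)]).
Definition Shift (mv : move) : cmd K := Atom (fun r => [ffun i =>
  (r i, if (i == ord0) || (i == in_t) then mv else MoveS)]).
Definition more (r : reads) : bool := ~~ is_blank (r ord0).

(** Copying ends with heads 0 and 1 on the blank after the word. One step left re-enters the word,
    the loop leaves it through cell -1, and the last step returns to cell 0. Counter 0, moved once
    per copied symbol, then holds the input length. *)
Definition Setup : cmd K :=
  Seq Mark (Seq (While more Copy)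
    (Seq (Shift MoveL) (Seq (While more (Shift MoveL)) (Shift MoveR)))).

Section Run.
Variable inp : seq symbol.
Hypothesis inpN : all (fun s => ~~ is_blank s) inp.

Definition copied (j : nat) (h : int) : tapes := fun i =>
  if i == ord0 then MkTape (tape_cells (tape_of inp)) h
  else if i == in_t then MkTape (fun z => if z is Posz a then
    (if a < j then nth Blank inp a else Blank) else Blank) h
  else if i == ct 0 then counter_tape j else counter_tape 0.

Lemma blank_nth j : is_blank (nth Blank inp j) = (size inp <= j).
Proof.
case: leqP => [le|lt]; first by rewrite nth_default.
by apply/negbTE; exact: (all_nthP Blank inpN).
Qed.

Lemma exec_Mark :
  exec Mark (fun i : T => tape_of (if i == ord0 then inp else [::])) 1
    (copied 0 0%R).
Proof.
have -> : copied 0 0%R = act_on (fun i : T => tape_of (if i == ord0 then inp else [::]))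
   ([ffun i => if (i == ord0) || (i == in_t) then
        (reads_of (fun i : T => tape_of (if i == ord0 then inp else [::])) i, MoveS)
        else (Sep, MoveS)]).
  apply/funext => i; rewrite /act_on !ffunE /copied.
  case: eqP => [_|_] /=; first by rewrite tape_act_read.
  case: eqP => [_|_] /=.
    rewrite tape_act_read /tape_of /=; congr MkTape.
    by apply/funext => -[a|a] //; rewrite nth_nil.
  have -> : (if i == ct 0 then counter_tape 0 else counter_tape 0) = counter_tape 0.
    by case: ifP.
  rewrite /tape_act /counter_tape /=; congr MkTape.
  by apply/funext => -[[|a]|a] //=; rewrite nth_nil.
exact: ExecAtom.
Qed.

Lemma more_copied j h : more (reads_of (copied j h)) =
  if h is Posz a then a < size inp else false.
Proof.
rewrite /more ffunE /copied eqxx /tape_read /=; case: h => // a.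
by rewrite blank_nth -ltnNge.
Qed.

Lemma exec_Copy j : j < size inp -> exec Copy (copied j (Posz j)) 1 (copied j.+1 (Posz j.+1)).
Proof.
move=> js.
suff -> : copied j.+1 (Posz j.+1) = act_on (copied j (Posz j))
   ([ffun i => if i == ord0 then (reads_of (copied j (Posz j)) i, MoveR)
      else if i == in_t then (reads_of (copied j (Posz j)) ord0, MoveR)
      else (reads_of (copied j (Posz j)) i, if i == ct 0 then MoveR else MoveS)]).
  exact: ExecAtom.
have E : (Posz j + 1)%R = Posz j.+1 by rewrite -PoszD addn1.
apply/funext => i; rewrite /act_on !ffunE.
case: eqP => [->|/eqP i0]; first by rewrite tape_act_read /copied eqxx /= E.
case: eqP => [->|/eqP i1].
  rewrite /copied eqxx (negbTE (in_t0 K)) /tape_act /= /tape_read /= E; congr MkTape.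
  apply/funext => -[a|a] //=; rewrite eqz_nat ltnS leq_eqVlt.
  by case: eqP => [->|].
rewrite tape_act_read /copied (negbTE i0) (negbTE i1); case: eqP => _ /=.
  by rewrite /counter_tape E.
by [].
Qed.

Lemma exec_Shift mv j h : exec (Shift mv) (copied j h) 1 (copied j (h + move_offset mv)%R).
Proof.
suff -> : copied j (h + move_offset mv)%R = act_on (copied j h)
   ([ffun i => (reads_of (copied j h) i, if (i == ord0) || (i == in_t) then mv else MoveS)]).
  exact: ExecAtom.
apply/funext => i; rewrite /act_on !ffunE tape_act_read /copied.
case: eqP => [//|_]; case: eqP => [//|_] /=.
by case: eqP => _; rewrite addr0.
Qed.

Lemma exec_copy_loop : exists2 t, t <= (size inp * 2).+1 &
  exec (While more Copy) (copied 0 0%R) t (copied (size inp) (Posz (size inp))).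
Proof.
suff H k j : j + k = size inp -> exists2 t, t <= (k * 2).+1 &
    exec (While more Copy) (copied j (Posz j)) t (copied (size inp) (Posz (size inp))).
  exact: (H (size inp) 0).
elim: k j => [|k IH] j.
  rewrite addn0 => ->; exists 1 => //; apply: ExecDone.
  by rewrite more_copied ltnn.
move=> E; have [|t le et] := IH j.+1; first by rewrite addSn -addnS.
exists (1 + t).+1; first by lia.
apply: (ExecStep _ (exec_Copy _) et); last by lia.
by rewrite more_copied; lia.
Qed.

Lemma exec_rewind_loop : exists2 t, t <= (size inp * 2).+1 &
  exec (While more (Shift MoveL)) (copied (size inp) (Posz (size inp) - 1)%R) t
    (copied (size inp) (- 1)%R).
Proof.
suff H k : k <= size inp -> exists2 t, t <= (k * 2).+1 &
    exec (While more (Shift MoveL)) (copied (size inp) (Posz k - 1)%R) t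
    (copied (size inp) (- 1)%R).
  exact: H.
elim: k => [|k IH] ks.
  by exists 1 => //; rewrite sub0r; apply: ExecDone; rewrite more_copied.
have [|t le et] := IH; first exact: ltnW.
have E : (Posz k.+1 - 1)%R = Posz k by rewrite -addn1 PoszD addrK.
rewrite E; exists (1 + t).+1; first by lia.
apply: (ExecStep _ (exec_Shift _ _ _) et).
by rewrite more_copied.
Qed.

Lemma exec_Setup : exists t tp,
  [/\ t <= size inp * 4 + 5,
      exec Setup (fun i : T => tape_of (if i == ord0 then inp else [::])) t tp &
      rep inp (CState (upd (fun=> 0) 0 (size inp)) 0 [::]) tp].
Proof.
have [t1 le1 e1] := exec_copy_loop; have [t2 le2 e2] := exec_rewind_loop.
have e3 := exec_Shift MoveR (size inp) (- 1)%R.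
have e0 := exec_Shift MoveL (size inp) (Posz (size inp)).
exists (1 + (t1 + (1 + (t2 + 1)))), (copied (size inp) 0%R); split.
- by lia.
- apply: ExecSeq exec_Mark _; apply: ExecSeq e1 _; apply: ExecSeq e0 _.
  by apply: ExecSeq e2 _; rewrite addNr in e3.
- split.
  + rewrite /copied (negbTE (in_t0 K)) eqxx; congr MkTape.
    apply/funext => -[a|a] //=; case: ltnP => // le.
    by rewrite nth_default.
  + move=> i iK; rewrite /copied (negbTE (ct0 iK)) (negbTE (ct_in iK)) ct_eq //.
    by rewrite /upd /=; case: eqP.
  + by rewrite /copied eqxx.
  + by [].
Qed.

End Run.
End Setup.

Section Main.
Variables (eM eB : expr).
Let K := 4 + maxn (width eM) (width eB).
Local Notation Inc := (@Inc K).
Local Notation Dec := (@Dec K).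

(** The blank after the output has to be written, since a remaining input symbol may stand there. *)
Definition EndOutput : cmd K := Atom (fun r => only ord0 (Blank, MoveS) r).

(** Counter 0 holds the input length, 1 the index of the current output bit, 2 the number of bits
    still to come, 3 the value whose nonzeroness is the bit; scratch starts at 4. *)
Definition main_body : cmd K :=
  Seq (Dec 2) (Seq (compile K eB (scons 1 (fun=> 0)) 4 3)
    (Seq (OutBit K 3) (Seq (While (cnz 3) (Dec 3)) (Inc 1)))).

Definition main_cmd : cmd K :=
  Seq (Setup K) (Seq (compile K eM (fun=> 0) 4 2)
    (Seq (While (cnz 2) main_body) EndOutput)).

Definition out_bit inp j := eeval inp eB (scons j (fun=> size inp)) != 0.

Definition main_out inp := mkseq (out_bit inp) (eeval inp eM (fun=> size inp)).

Ltac fun_eq := apply/funext => ?; rewrite /upd /=;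
  repeat (case: eqP => ? ; subst => //); try lia; try congruence.

Lemma main_loop_spec : exists q, forall inp,
  cexec (K := K) inp (Seq (compile K eM (fun=> 0) 4 2) (While (cnz 2) main_body))
    (CState (upd (fun=> 0) 0 (size inp)) 0 [::]) ((size inp).+2 ^ q)
    (CState (upd (upd (fun=> 0) 0 (size inp)) 1 (eeval inp eM (fun=> size inp))) 0 (main_out inp)).
Proof.
have [p1 B1] := eeval_bound eM; have [p2 B2] := eeval_bound eB.
have [q1 S1] := compile_spec K eM; have [q2 S2] := compile_spec K eB.
exists (q1 + (p1 + p1.+2 * (p2 + q2 + 5) + 3)).+1 => inp; set M := size inp.
have BM := B1 inp M (fun=> M) (fun=> leqnn _).
set m := eeval inp eM _ in BM *.
have Xp : 0 < M.+2 ^ p1 by rewrite expn_gt0.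
have le2 : (M + M.+2 ^ p1).+2 <= M.+2 ^ p1.+2 by rewrite !expnS; nia.
set N := (M + M.+2 ^ p1).+2 in le2.
set c := fun j => upd (upd (upd (fun=> 0) 0 M) 1 j) 2 (m - j).
apply: cexec_to; first apply: cexec_Seq.
- by apply: (S1 inp M) => //; [case=> [|[|[|[|j]]]]|rewrite leq_add2l leq_maxl].
- have -> : upd (upd (fun=> 0) 0 M) 2 (upd (fun=> 0) 0 M 2 + eeval inp eM (upd (fun=> 0) 0 M \o (fun=> 0)))
      = c 0.
    rewrite -[_ \o _]/(fun=> M) -/m /c; fun_eq.
  rewrite -[[::]]/(mkseq (out_bit inp) 0).
  apply: (@cexec_loop K inp 2 main_body
    (fun j => CState (c j) 0 (mkseq (out_bit inp) j)) m (N ^ (p2 + q2 + 4))) => //.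
  + by move=> j jm /=; rewrite /c /upd /=; lia.
  + by rewrite /= /c /upd /= subnn.
  + move=> j jm; rewrite /main_body.
    set cj := upd (c j) 2 (c j 2).-1.
    have ve : cj \o scons 1 (fun=> 0) = scons j (fun=> M).
      by apply/funext => -[|v].
    have Bv : forall v, (cj \o scons 1 (fun=> 0)) v <= M + M.+2 ^ p1.
      by rewrite ve; case=> [|v] /=; lia.
    have := B2 inp (M + M.+2 ^ p1) _ Bv; rewrite -/N ve; set x := eeval inp eB _ => Bx.
    apply: cexec_to.
    * apply: cexec_Seq; first exact: cexec_Dec.
      apply: cexec_Seq.
        apply: (S2 inp (M + M.+2 ^ p1)) => //.
        - by case=> [|v].
        - by case=> [|v].
        - by case=> [|[|[|[|i]]]].
        - by rewrite leq_add2l leq_maxr.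
      rewrite -/cj ve -/x; apply: cexec_Seq; first exact: cexec_OutBit.
      apply: cexec_Seq.
        apply: (loop_spec (c := fun i => upd cj 3 (x - i)) (p := fun=> 0) (n := x) (t := 1)) => //.
        - move=> i ix _; apply: cexec_to; [exact: cexec_Dec| |by []].
          by congr CState; fun_eq.
        - by rewrite /cj /c; congr CState; fun_eq.
      exact: cexec_Inc.
    * rewrite /cj /c; congr CState; first by fun_eq.
      by rewrite -[upd _ 3 _ 3]/x /mkseq -[in RHS]addn1 iotaD map_cat cats1.
    * rewrite -/N; have n0 : 0 < N ^ (p2 + q2) by rewrite expn_gt0.
      have -> : 1 + (N ^ q2 + (1 + ((x * 2).+1 + 1))) = N ^ q2 + (x * 2 + 4) by lia.
      have h1 : N ^ q2 <= N ^ (p2 + q2) by rewrite leq_pexp2l // leq_addl.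
      have h2 : x <= N ^ (p2 + q2).
        by apply: leq_trans Bx _; rewrite leq_pexp2l // leq_addr.
      have h3 : 2 ^ 4 <= N ^ 4 by rewrite leq_exp2r.
      rewrite expnD; move: (N ^ q2) (N ^ (p2 + q2)) (N ^ 4) h1 h2 h3 n0 => P Q R.
      by rewrite (_ : 2 ^ 4 = 16) //; nia.
- by rewrite /main_out -/m; congr CState; rewrite /c; fun_eq.
- apply: expn_leqD => //; rewrite [M.+2 ^ (_ + 3)]expnD [M.+2 ^ (p1 + _)]expnD expnM.
  have h0 : 0 < N ^ (p2 + q2 + 4) by rewrite expn_gt0.
  have h : (N ^ (p2 + q2 + 4)).+1 <= (M.+2 ^ p1.+2) ^ (p2 + q2 + 5).
    apply: leq_trans (_ : N ^ (p2 + q2 + 5) <= _); last by rewrite leq_exp2r // addnS.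
    by rewrite [p2 + q2 + 5]addnS expnS; have : 1 < N by []; nia.
  have h3 : 2 ^ 3 <= M.+2 ^ 3 by rewrite leq_exp2r.
  have h4 : m * (N ^ (p2 + q2 + 4)).+1 <= M.+2 ^ p1 * (M.+2 ^ p1.+2) ^ (p2 + q2 + 5).
    exact: leq_mul.
  have h5 : 0 < M.+2 ^ p1 * (M.+2 ^ p1.+2) ^ (p2 + q2 + 5) by rewrite muln_gt0 !expn_gt0.
  move: (_ * _) (_ * _) (M.+2 ^ 3) h3 h4 h5 => P Q R; rewrite (_ : 2 ^ 3 = 8) //; nia.
Qed.

Lemma main_cmd_computes : exists q, forall inp,
  all (fun s => ~~ is_blank s) inp -> forall t, (size inp).+2 ^ q <= t ->
  tm_computes (cmd_TM main_cmd) inp (main_out inp) t.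
Proof.
have [q Hq] := main_loop_spec; exists (4 + (q + 1).+1).+1 => inp inpN t let_.
have [t0 [tp0 [le0 e0 r0]]] := exec_Setup (K := K) isT inpN.
have [t1 [tp1 [le1 e1 r1]]] := Hq inp _ r0.
inversion e1 as [|c1 c2 tpa ta tpb tb tpc ea eb E1 E2 E3 E4| |]; subst.
have e2 := ExecAtom (fun r => only ord0 (Blank, MoveS) r) tp1.
have e := ExecSeq e0 (ExecSeq ea (ExecSeq eb e2)).
have H := cmd_TM_computes e.
rewrite /tm_computes H.
  split=> // j js; rewrite [_.2]/= act_on_only eqxx /tape_act [tape_cells _]/=.
  case: r1 => _ _ /= -> Hc; rewrite eqz_nat.
  case: eqP => [->|jn]; first by rewrite nth_default // size_map.
  have jlt : j < size (main_out inp) by lia.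
  by rewrite Hc // (nth_map false).
apply: leq_trans let_; have S2 : 1 < (size inp).+2 by [].
rewrite addnA [_ + 1]addnC addnA; apply: leq_trans (_ : t0 + (ta + tb + 1) <= _); first by lia.
apply: expn_leqD => //; last by apply: expn_leqD.
apply: leq_trans le0 _.
have : 2 ^ 3 <= (size inp).+2 ^ 3 by rewrite leq_exp2r.
by rewrite (expnSr _ 3) (_ : 2 ^ 3 = 8) //; nia.
Qed.

End Main.

Theorem explicit_of_expr (d m : nat -> nat) (Ext : ext_family d m) (eM eB : expr) :
  (forall n (x : n.-tuple bool) (r : (d n).-tuple bool),
    let inp := map Bit x ++ Sep :: map Bit r in
    eeval inp eM (fun=> size inp) = m n /\
    forall j : 'I_(m n), (eeval inp eB (scons j (fun=> size inp)) != 0)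
       = tnth (Ext n x r) j) ->
  explicit Ext.
Proof.
move=> H; have [q Hq] := main_cmd_computes eM eB.
(* With the separator, [(size inp).+2] is n + d n + 3, at most 4 (n + d n) unless n + d n = 0; there
   the additive constant of [poly_bound] takes over. *)
exists (cmd_TM (main_cmd eM eB)), (4 ^ q), q => n x r.
have [HM HB] := H n x r; set inp := map _ _ ++ _ in HM HB *.
have -> : tval (Ext n x r) = main_out eM eB inp.
  rewrite /main_out HM; apply: (@eq_from_nth _ false); rewrite size_tuple ?size_mkseq //.
  by move=> i im; rewrite nth_mkseq // /out_bit (HB (Ordinal im)) (tnth_nth false).
apply: Hq.
  by rewrite all_cat /= !all_map; apply/andP; split; apply/allP.
rewrite /inp size_cat /= !size_map !size_tuple /poly_bound addnS [X in _ <= X]addnC -mulnS.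
have [->|N0] := posnP (n + d n).
  apply: leq_trans (_ : 4 ^ q <= _); last by rewrite leq_pmulr.
  by case: (q) => // q'; rewrite leq_exp2r.
apply: leq_trans (_ : 4 ^ q * (n + d n) ^ q <= _); last by rewrite leq_mul2l leqnSn orbT.
by rewrite -expnMn; case: (q) => // q'; rewrite leq_exp2r //; lia.
Qed.

(** * Primes below a polynomial bound *)

Definition bitlen (v : nat) : nat := up_log 2 v.+1.

Lemma bitlen_gt v : v < 2 ^ bitlen v.
Proof. exact: up_logP. Qed.

Lemma bitlen_le v : 2 ^ bitlen v <= 2 * v + 1.
Proof.
case: v => [|v]; first by rewrite /bitlen up_log1.
have [] := andP (up_log_bounds (isT : 1 < 2) (isT : 1 < v.+2)).
rewrite -/(bitlen v.+1) => lt _.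
have : 0 < bitlen v.+1 by rewrite up_log_gt0.
by move: lt; case: (bitlen v.+1) => // h /=; rewrite expnS; lia.
Qed.

Definition prime_count (v : nat) : nat := \sum_(0 <= i < v) prime i.

Lemma prime_countE v : prime_count v = count prime (iota 0 v).
Proof.
rewrite /prime_count /index_iota subn0; elim: (iota 0 v) => [|x s IH] /=.
  by rewrite big_nil.
by rewrite big_cons IH.
Qed.

(** By Legendre's formula the exponent is the sum over k of floor(2N / p^k) - 2 floor(N / p^k). Each
    term is at most 1, and it vanishes once p^k > 2N. *)
Lemma leq_pow_logn_central N p : 0 < N -> prime p ->
  p ^ logn p 'C(2 * N, N) <= 2 * N.
Proof.
move=> N0 pp; have p1 := prime_gt1 pp.
have E : logn p 'C(2 * N, N) + logn p (N`! * N`!) = logn p (2 * N)`!.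
  rewrite -lognM ?muln_gt0 ?fact_gt0 ?bin_gt0 //; last by lia.
  by rewrite -(@bin_fact (2 * N) N) //; [rewrite (_ : 2 * N - N = N) //; lia | lia].
rewrite lognM ?fact_gt0 // !logn_fact // in E.
have wide : \sum_(1 <= k < N.+1) N %/ p ^ k = \sum_(1 <= k < (2 * N).+1) N %/ p ^ k.
  rewrite [RHS](@big_cat_nat _ _ _ N.+1) /=; [|lia|lia].
  rewrite [X in _ = _ + X]big_nat_cond [X in _ = _ + X]big1 ?addn0 // => k.
  rewrite andbT => /andP [kN _]; rewrite divn_small //.
  by apply: leq_trans kN _; apply/ltnW; exact: ltn_expl.
rewrite wide -big_split /= in E.
have le : logn p 'C(2 * N, N) <= trunc_log p (2 * N).
  rewrite -(leq_add2r (\sum_(1 <= k < (2 * N).+1) (N %/ p ^ k + N %/ p ^ k))) E.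
  have t2 : (trunc_log p (2 * N)).+1 <= (2 * N).+1.
    rewrite ltnS -(@leq_exp2l p) //; apply: leq_trans (trunc_logP p1 _) _; first lia.
    by apply/ltnW; exact: ltn_expl.
  have -> : trunc_log p (2 * N) = \sum_(1 <= k < (2 * N).+1) (k <= trunc_log p (2 * N)).
    rewrite (@big_cat_nat _ _ _ (trunc_log p (2 * N)).+1) //=.
    rewrite [X in _ = _ + X]big_nat_cond [X in _ = _ + X]big1 => [|k]; last first.
      by rewrite andbT => /andP [h _]; rewrite leqNgt h.
    rewrite addn0 -[LHS]mul1n big_nat_cond.
    rewrite (eq_bigr (fun=> 1)) => [|k]; last by rewrite andbT => /andP [_ h]; rewrite -ltnS h.
    by rewrite -big_nat_cond sum_nat_const_nat subn1 mulnC.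
  rewrite -big_split /=; apply: leq_sum => k _.
  have pk : 0 < p ^ k by rewrite expn_gt0 ltnW.
  have [kt|kt] := leqP k (trunc_log p (2 * N)).
    have := divn_eq N (p ^ k); have := ltn_pmod N pk.
    move: (N %/ _) (N %% _) => q r rl Nq.
    rewrite -ltnS ltn_divLR //; lia.
  rewrite add0n divn_small //; apply: leq_trans (trunc_log_ltn _ p1) _.
  by rewrite leq_exp2l.
apply: leq_trans (trunc_logP p1 _); last by lia.
by rewrite leq_exp2l.
Qed.

Lemma leq_exp2_central N : 2 ^ N <= 'C(2 * N, N).
Proof.
elim: N => // N IH.
rewrite expnS (_ : 2 * N.+1 = (2 * N).+2); last by lia.
rewrite binS binS; have := @leq_bin2l (2 * N) (2 * N).+1 N (leqnSn _); lia.
Qed.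

(** Every prime factor divides (2N)!, hence is at most 2N, and contributes a prime power of at most
    2N. *)
Lemma central_leq_prime_count N : 0 < N ->
  'C(2 * N, N) <= (2 * N) ^ prime_count (2 * N).+1.
Proof.
move=> N0; have C0 : 0 < 'C(2 * N, N) by rewrite bin_gt0; lia.
rewrite {1}(prod_prime_decomp C0) prime_decompE big_map /=.
apply: leq_trans (_ : \prod_(p <- primes 'C(2 * N, N)) (2 * N) <= _).
  rewrite big_seq [X in _ <= X]big_seq; apply: leq_prod => p.
  by rewrite mem_primes => /and3P [pp _ _]; exact: leq_pow_logn_central.
rewrite big_const_seq count_predT iter_muln_1; apply: leq_pexp2l; first by lia.
rewrite prime_countE -size_filter; apply: uniq_leq_size; first exact: primes_uniq.
move=> p; rewrite mem_primes mem_filter mem_iota add0n /= => /and3P [pp _ pC].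
rewrite pp /= ltnS; have : p %| (2 * N)`!.
  rewrite -(@bin_fact (2 * N) N); last by lia.
  exact: dvdn_mulr.
by rewrite fact_prod Euclid_dvd_prod // big_has => /hasP [i];
  rewrite mem_index_iota => /andP [i0 i2] /dvdn_leq H; apply: leq_trans (H i0) _.
Qed.

(* With N = 2^(w-1) and w = 2 * bitlen l + 4, the bounds 2^N <= C(2N, N) and
   C(2N, N) <= (2N)^prime_count(2N + 1) give 2^(w-1) <= w * prime_count(2^w + 1). *)
Definition prime_range (l : nat) : nat := (16 * (2 ^ bitlen l) ^ 2).+1.

Lemma prime_range_count l : l <= prime_count (prime_range l).
Proof.
set s := bitlen l; have -> : prime_range l = (2 * 2 ^ (2 * s + 3)).+1.
  by rewrite /prime_range -/s -expnM -[16]/(2 ^ 4) -expnD -expnS; congr (_ ^ _).+1; lia.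
set P := prime_count _.
have := leq_trans (leq_exp2_central _) (@central_leq_prime_count (2 ^ (2 * s + 3)) _).
rewrite expn_gt0 /= -/P => /(_ isT); rewrite -expnS -expnM leq_exp2l // => H.
have l2 : l < 2 ^ s by exact: bitlen_gt.
have s2 : s < 2 ^ s by exact: ltn_expl.
rewrite leqNgt; apply/negP => Pl; move: H.
rewrite expnD mul2n -addnn expnD (_ : 2 ^ 3 = 8) //.
move: (2 ^ s) l2 s2 => S l2 s2; nia.
Qed.

(** A bounded sum with at most one nonzero term, at the prime below Q with exactly u smaller primes;
    this form makes it definable by an expression. *)
Definition nth_prime (Q u : nat) : nat :=
  \sum_(0 <= v < Q) v * (prime v && (prime_count v == u)).

Lemma prime_countS v : prime_count v.+1 = prime_count v + prime v.
Proof. by rewrite /prime_count big_nat_recr. Qed.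

Lemma leq_prime_count u v : u <= v -> prime_count u <= prime_count v.
Proof.
by move=> uv; rewrite /prime_count [X in _ <= X](@big_cat_nat _ _ _ u) // leq_addr.
Qed.

Lemma nth_primeP Q u : u < prime_count Q ->
  [/\ prime (nth_prime Q u), nth_prime Q u < Q & prime_count (nth_prime Q u) = u].
Proof.
elim: Q => [|Q IH]; first by rewrite /prime_count big_geq.
rewrite prime_countS /nth_prime big_nat_recr //= -/(nth_prime Q u) => lt.
have [lt'|ge] := ltnP u (prime_count Q).
  have [pp ltQ E] := IH lt'.
  by rewrite [_ == u]gtn_eqF // andbF muln0 addn0; split=> //; exact: leqW.
have pQ : prime Q by case: (prime Q) lt => //; rewrite addn0 ltnNge ge.
have Eu : prime_count Q = u by apply/eqP; rewrite eqn_leq ge; move: lt; rewrite pQ addn1 ltnS.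
have -> : nth_prime Q u = 0.
  rewrite /nth_prime big_nat_cond big1 // => v; rewrite andbT => /andP [_ vQ].
  have [pv|] := boolP (prime v); last by rewrite muln0.
  rewrite (_ : _ == u = false) ?muln0 //; apply/negP => /eqP Ev.
  have := leq_prime_count vQ; rewrite prime_countS pv Ev -Eu; lia.
by rewrite pQ Eu eqxx muln1 add0n.
Qed.

(** * Functions definable by bounded sums *)

Definition nat_bit (v b : nat) : bool := odd (v %/ 2 ^ b).

Section Definability.
Local Notation fn := (seq symbol -> (nat -> nat) -> nat).
Implicit Types F G : fn.

Definition definable F : Prop :=
  exists e, forall inp env, eeval inp e env = F inp env.

Lemma def_ext F G : definable F -> (forall inp env, F inp env = G inp env) ->
  definable G.
Proof. by move=> [e He] FG; exists e => inp env; rewrite He. Qed.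

Lemma def_var v : definable (fun _ env => env v).
Proof. by exists (EVar v). Qed.

Lemma def_add F G : definable F -> definable G ->
  definable (fun inp env => F inp env + G inp env).
Proof. by move=> [e He] [f Hf]; exists (EAdd e f) => inp env /=; rewrite He Hf. Qed.

Lemma def_sub F G : definable F -> definable G ->
  definable (fun inp env => F inp env - G inp env).
Proof. by move=> [e He] [f Hf]; exists (ESub e f) => inp env /=; rewrite He Hf. Qed.

Lemma def_const k : definable (fun _ _ => k).
Proof.
elim: k => [|k IH]; first by exists (ESub EOne EOne).
have [e He] : definable (fun _ _ => 1) by exists EOne.
apply: def_ext (def_add IH (ex_intro _ e He)) _ => inp env.
by rewrite addn1.
Qed.

Lemma def_inp (p : symbol -> bool) F : definable F ->
  definable (fun inp env => p (nth Blank inp (F inp env))).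
Proof. by move=> [e He]; exists (EInp p e) => inp env /=; rewrite He. Qed.

Lemma def_sum F (G : seq symbol -> (nat -> nat) -> nat -> nat) :
  definable F -> definable (fun inp env => G inp (fun v => env v.+1) (env 0)) ->
  definable (fun inp env => \sum_(0 <= i < F inp env) G inp env i).
Proof.
move=> [e He] [f Hf]; exists (ESum e f) => inp env /=.
by rewrite He big_mkord; apply: eq_bigr => i _; rewrite Hf.
Qed.

Definition up_ren (rho : nat -> nat) : nat -> nat :=
  fun v => if v is v'.+1 then (rho v').+1 else 0.

Fixpoint rename (rho : nat -> nat) (e : expr) : expr :=
  match e with
  | EVar v => EVar (rho v)
  | EOne => EOne
  | EAdd e1 e2 => EAdd (rename rho e1) (rename rho e2)
  | ESub e1 e2 => ESub (rename rho e1) (rename rho e2)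
  | EInp p e1 => EInp p (rename rho e1)
  | ESum e1 e2 => ESum (rename rho e1) (rename (up_ren rho) e2)
  end.

Lemma eeval_rename inp e rho env :
  eeval inp (rename rho e) env = eeval inp e (env \o rho).
Proof.
elim: e rho env => //= [e1 IH1 e2 IH2|e1 IH1 e2 IH2|p e1 IH1|e1 IH1 e2 IH2] rho env;
  rewrite ?IH1 ?IH2 //.
apply: eq_bigr => i _; rewrite IH2; congr eeval.
by apply/funext => -[|v].
Qed.

Lemma def_weak F : definable F ->
  definable (fun inp env => F inp (fun v => env v.+1)).
Proof.
by move=> [e He]; exists (rename succn e) => inp env; rewrite eeval_rename He.
Qed.

Lemma def_mul F G : definable F -> definable G ->
  definable (fun inp env => F inp env * G inp env).
Proof.
move=> dF dG; apply: def_ext (def_sum dF (G := fun inp env _ => G inp env) _) _.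
  exact: def_weak.
by move=> inp env; rewrite sum_nat_const_nat subn0.
Qed.

Lemma def_exp F k : definable F -> definable (fun inp env => F inp env ^ k).
Proof.
move=> dF; elim: k => [|k IH]; first exact: def_const.
by apply: def_ext (def_mul dF IH) _ => inp env; rewrite expnS.
Qed.

Lemma def_leq F G : definable F -> definable G ->
  definable (fun inp env => F inp env <= G inp env).
Proof.
move=> dF dG; apply: def_ext (def_sub (def_const 1) (def_sub dF dG)) _.
by move=> inp env; case: leqP; lia.
Qed.

Lemma def_andb (P Q : seq symbol -> (nat -> nat) -> bool) :
  definable P -> definable Q -> definable (fun inp env => P inp env && Q inp env).
Proof.
move=> dP dQ; apply: def_ext (def_mul dP dQ) _.
by move=> inp env; rewrite mulnb.
Qed.

Lemma def_eq F G : definable F -> definable G ->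
  definable (fun inp env => F inp env == G inp env).
Proof.
move=> dF dG; apply: def_ext (def_andb (def_leq dF dG) (def_leq dG dF)) _.
by move=> inp env; rewrite eqn_leq.
Qed.

Lemma def_min F G : definable F -> definable G ->
  definable (fun inp env => minn (F inp env) (G inp env)).
Proof.
move=> dF dG; apply: def_ext (def_sub dF (def_sub dF dG)) _.
by move=> inp env; lia.
Qed.

Lemma def_div F G : definable F -> definable G ->
  definable (fun inp env => F inp env %/ G inp env).
Proof.
move=> dF dG.
(* The quotient counts the i < F with (i + 1) * G <= F; the first factor yields the conventional
   value 0 of a division by 0. *)
apply: def_ext (def_mul (def_leq (def_const 1) dG)
  (def_sum dF (G := fun inp env i => i.+1 * G inp env <= F inp env) _)) _.
  apply: def_leq (def_weak dF); apply: def_mul (def_weak dG).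
  apply: def_ext (def_add (def_var 0) (def_const 1)) _ => inp env.
  by rewrite addn1.
move=> inp env /=; case: (posnP (G inp env)) => [->|G0]; first by rewrite divn0.
rewrite ?G0 ?mul1n; set q := _ %/ _; have qF : q <= F inp env by exact: leq_div.
rewrite (@big_cat_nat _ _ _ q) //= [X in _ + X]big_nat_cond [X in _ + X]big1 => [|i].
  rewrite big_nat_cond (eq_bigr (fun=> 1)) => [|i]; last first.
    by rewrite andbT => /andP [_ iq]; rewrite -leq_divRL // iq.
  by rewrite -big_nat_cond sum_nat_const_nat; lia.
by rewrite andbT => /andP [qi _]; rewrite -leq_divRL // ltnNge qi.
Qed.

Lemma def_mod F G : definable F -> definable G ->
  definable (fun inp env => F inp env %% G inp env).
Proof.
move=> dF dG; apply: def_ext (def_sub dF (def_mul (def_div dF dG) dG)) _.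
by move=> inp env; rewrite {1}(divn_eq (F inp env) (G inp env)) addKn.
Qed.

Lemma def_odd F : definable F -> definable (fun inp env => odd (F inp env)).
Proof.
move=> dF; apply: def_ext (def_mod dF (def_const 2)) _ => inp env.
by rewrite modn2.
Qed.

Lemma def_dvd F G : definable F -> definable G ->
  definable (fun inp env => F inp env %| G inp env).
Proof. by move=> dF dG; apply: def_eq (def_mod dG dF) (def_const 0). Qed.

Lemma def_prime F : definable F -> definable (fun inp env => prime (F inp env)).
Proof.
move=> dF.
apply: def_ext (def_andb (def_leq (def_const 2) dF) (def_eq (def_sum dF
  (G := fun inp env k => (1 < k) && (k %| F inp env)) _) (def_const 0))) _.
  apply: def_andb; first exact: def_leq (def_const 2) (def_var 0).
  exact: def_dvd (def_var 0) (def_weak dF).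
move=> inp env; congr nat_of_bool; set v := F inp env; apply/andP/idP.
  move=> [v1 /eqP s0]; apply/primeP; split=> // k kv.
  have kle := dvdn_leq (ltnW v1) kv.
  have [->|k1] := eqVneq k 1; first by [].
  rewrite orFb; move: kle; rewrite leq_eqVlt => /orP [//|klt].
  have k0 : k != 0 by apply: contraTneq kv => ->; rewrite dvd0n; lia.
  move/eqP: s0; rewrite sum_nat_seq_eq0 => /allP /(_ k).
  by rewrite mem_index_iota klt /= kv andbT => /(_ isT); lia.
move=> pv; have v1 := prime_gt1 pv; split=> //.
rewrite big_nat_cond big1 // => k; rewrite andbT => /andP [_ kv].
apply/eqP; rewrite eqb0; apply/negP => /andP [k1] /(prime_nt_dvdP pv) H.
by have := H (negbT (gtn_eqF k1)); lia.
Qed.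

Lemma def_prime_count F : definable F ->
  definable (fun inp env => prime_count (F inp env)).
Proof.
move=> dF; apply: (def_sum dF (G := fun _ _ i => prime i)).
exact: def_prime (def_var 0).
Qed.

Lemma def_nth_prime F G : definable F -> definable G ->
  definable (fun inp env => nth_prime (F inp env) (G inp env)).
Proof.
move=> dF dG; apply: (def_sum dF
  (G := fun inp env v => v * (prime v && (prime_count v == G inp env)))).
apply: def_mul (def_var 0) _; apply: def_andb (def_prime (def_var 0)) _.
exact: def_eq (def_prime_count (def_var 0)) (def_weak dG).
Qed.

(** The numbers 2k + 3 are the odd numbers from 3 on, and a positive number is a power of two iff
    none of them divides it. No exponential occurs in this test. *)
Definition is_pow2 (v : nat) : bool :=
  (0 < v) && (\sum_(0 <= k < v) (2 * k + 3 %| v) == 0).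

Lemma is_pow2E v : is_pow2 v = (0 < v) && (v == 2 ^ logn 2 v).
Proof.
rewrite /is_pow2; case: (posnP v) => //= v0.
have E : v = 2 ^ logn 2 v * v`_(2^') by rewrite -p_part partnC.
apply/idP/idP.
  rewrite sum_nat_seq_eq0 => /allP H.
  have od : odd v`_(2^').
    by rewrite odd_2'nat part_pnat.
  have [w1|w1] := ltnP 1 v`_(2^'); last first.
    have w0 : 0 < v`_(2^') by rewrite part_gt0.
    by rewrite {1}E (_ : v`_(2^') = 1) ?muln1 //; lia.
  have wv := dvdn_part (2^') v; have wle := dvdn_leq v0 wv.
  have := H ((v`_(2^') - 3)./2).
  have -> : 2 * ((v`_(2^') - 3)./2) + 3 = v`_(2^').
    by move: od w1; move: (v`_(2^')) => w; lia.
  rewrite wv mem_index_iota /= => H'; have := H' _; case: ltnP => h H2.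
    by have := H2 isT.
  by move: h w1 wle; move: (v`_(2^')) => w; lia.
move=> /eqP Ev; rewrite big1_seq // => k _; apply/eqP; rewrite eqb0.
apply/negP; rewrite Ev => /dvdn_pfactor [] // j _ Ej.
have : odd (2 * k + 3) by lia.
by rewrite Ej oddX orbF => /eqP j0; move: Ej; rewrite j0; lia.
Qed.

Lemma is_pow2P v : reflect (exists h, v = 2 ^ h) (is_pow2 v).
Proof.
rewrite is_pow2E; apply: (iffP andP) => [[_ /eqP ->]|[h ->]].
  by exists (logn 2 v).
by rewrite expn_gt0 pfactorK.
Qed.

Lemma bitlenE v : bitlen v = \sum_(0 <= i < v) is_pow2 i.+1.
Proof.
elim: v => [|v IH]; first by rewrite big_geq // /bitlen up_log1.
rewrite big_nat_recr //= -IH; apply/eqP; rewrite eqn_leq.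
have lt := bitlen_gt v; apply/andP; split.
  apply: up_log_min => //; case: is_pow2P => [[h E]|H].
    by rewrite addn1 expnS; lia.
  rewrite addn0 ltn_neqAle lt andbT; apply/eqP => Ev; apply: H.
  by exists (bitlen v).
case: is_pow2P => [[h E]|_]; last by rewrite addn0; exact: leq_up_log.
have -> : bitlen v = h by rewrite /bitlen E up_expnK.
rewrite addn1; have := bitlen_gt v.+1; rewrite {1}E; by rewrite ltn_exp2l.
Qed.

Lemma def_is_pow2 F : definable F -> definable (fun inp env => is_pow2 (F inp env)).
Proof.
move=> dF; apply: def_andb (def_leq (def_const 1) dF) _.
apply: def_eq (def_const 0).
apply: (def_sum dF (G := fun inp env k => 2 * k + 3 %| F inp env)).
apply: def_dvd (def_weak dF); apply: def_add (def_const 3).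
exact: def_mul (def_const 2) (def_var 0).
Qed.

Lemma def_bitlen F : definable F -> definable (fun inp env => bitlen (F inp env)).
Proof.
move=> dF; apply: def_ext (def_sum dF (G := fun _ _ i => is_pow2 (i + 1)) _) _.
  exact: def_is_pow2 (def_add (def_var 0) (def_const 1)).
by move=> inp env; rewrite bitlenE; apply: eq_bigr => i _; rewrite addn1.
Qed.

(** Values of expressions grow polynomially, so 2^G is reachable only below a definable bound. It is
    found by search, as the power of two of bit length G + 1. *)
Lemma def_pow2_lt F G : definable F -> definable G ->
  definable (fun inp env =>
    if 2 ^ G inp env < F inp env then 2 ^ G inp env else 0).
Proof.
move=> dF dG; apply: def_ext (def_sum dF (G := fun inp env v =>
    v * (is_pow2 v && (bitlen v == G inp env + 1))) _) _.
  apply: def_mul (def_var 0) _; apply: def_andb (def_is_pow2 (def_var 0)) _.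
  apply: def_eq (def_bitlen (def_var 0)) (def_add (def_weak dG) (def_const 1)).
move=> inp env; set h := G inp env; set B := F inp env.
have H v : v != 2 ^ h -> v * (is_pow2 v && (bitlen v == h + 1)) = 0.
  move=> vh; case: is_pow2P => [[h' E]|]; last by rewrite muln0.
  have bl : bitlen v = h'.+1.
    apply: up_log_eq => //; rewrite E ltnS leqnn /=.
    by rewrite expnS mul2n -addnn -[X in X < _]addn0 ltn_add2l expn_gt0.
  rewrite bl addn1 eqSS; case: eqP => [hh|]; last by rewrite muln0.
  by rewrite E hh eqxx in vh.
case: ifP => hB; last first.
  rewrite big_nat_cond big1 // => v; rewrite andbT => /andP [_ vB]; apply: H.
  by apply: contraFneq hB => <-.
rewrite (bigD1_seq (2 ^ h)) ?iota_uniq ?mem_index_iota //= big1 => [|v vh]; last exact: H.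
rewrite addn0 (introT (is_pow2P _)); last by exists h.
rewrite (_ : bitlen _ = h.+1) ?addn1 ?eqxx ?muln1 //.
apply: up_log_eq => //; rewrite ltnS leqnn /=.
by rewrite expnS mul2n -addnn -[X in X < _]addn0 ltn_add2l expn_gt0.
Qed.

Lemma def_pow2_bitlen F G : definable F -> definable G ->
  definable (fun inp env => 2 ^ minn (F inp env) (bitlen (G inp env))).
Proof.
move=> dF dG; apply: def_ext (def_pow2_lt
  (def_add (def_mul (def_const 2) dG) (def_const 2))
  (def_min dF (def_bitlen dG))) _.
move=> inp env; rewrite ifT //.
apply: leq_ltn_trans (_ : 2 ^ bitlen (G inp env) < _).
  by rewrite leq_exp2l // geq_minr.
by apply: leq_ltn_trans (bitlen_le _) _; lia.
Qed.

(** No bound on 2^G is required: when it exceeds F, the default 0 of [def_pow2_lt] turns the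
    quotient into a division by 0, whose value 0 is the right one. *)
Lemma def_div_pow2 F G : definable F -> definable G ->
  definable (fun inp env => F inp env %/ 2 ^ G inp env).
Proof.
move=> dF dG; apply: def_ext (def_div dF (def_pow2_lt (def_add dF (def_const 1)) dG)) _.
move=> inp env; rewrite addn1 ltnS; case: leqP => // lt.
by rewrite divn0 divn_small.
Qed.

Lemma def_nat_bit F G : definable F -> definable G ->
  definable (fun inp env => nat_bit (F inp env) (G inp env)).
Proof. by move=> dF dG; apply: def_odd; apply: def_div_pow2. Qed.

Lemma def_prime_range F : definable F ->
  definable (fun inp env => prime_range (F inp env)).
Proof.
move=> dF; apply: def_ext (def_add (def_mul (def_const 16)
  (def_exp 2 (def_pow2_bitlen (def_bitlen dF) dF))) (def_const 1)) _.
by move=> inp env; rewrite minnn addn1.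
Qed.

End Definability.

(** * The extractor and its explicitness *)

Section One_bit.
Variables (lm H : nat).
Implicit Types (y : nat -> nat -> bool).

(* Row 0 of the round seed y is the offset u, row h + 1 is column h of A; bit lm of
   row h is the coefficient of level h. The position of w is u + A w. *)
Definition pos_sum y (w b : nat) : nat :=
  y 0 b + \sum_(0 <= h < H) nat_bit w h * y h.+1 b.

Definition hits y (w v : nat) : bool :=
  \sum_(0 <= b < lm) odd (nat_bit v b + pos_sum y w b) == 0.

(** The cubes are nested, level h being the points w < 2^h. All levels thus share one pass over the
    points, each point weighted by the coefficients of the levels containing it; only parities
    matter in the end. *)
Definition coef y (w : nat) : nat := \sum_(0 <= h < H.+1) (w %/ 2 ^ h == 0) * y h lm.

Definition round_sum n (x : nat -> bool) y : nat :=
  \sum_(0 <= w < 2 ^ H) coef y w * \sum_(0 <= v < n) x v * hits y w v.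

Definition one_bit L n (x : nat -> bool) (y : nat -> nat -> nat -> bool) : bool :=
  odd (\sum_(0 <= i < L) round_sum n x (y i)).

End One_bit.

Section Construction.
Variables (a c A B k0 : nat).

(** The square root in the moment method keeps half of the rounds, and (13/16)^4 < 1/2; with l the
    bit length this leaves a bias of at most 2^(-B l^a). *)
Definition rounds n := 8 * B * bitlen n ^ a.
(** For large n, 2^H exceeds A l^(c+1) with l the bit length. Near pairs then differ in at most n /
    (A l^(c+1)) places, which l times as many bits describe, at most n / (A l^c). The cap [bitlen n]
    keeps all rows inside the stored array and 2^H definable. *)
Definition log_window n := minn (bitlen (A * bitlen n ^ c.+1)) (bitlen n).
Definition bit_seed_len n := rounds n * (bitlen n).+1 ^ 2.
Definition seed_width n := prime_range (bit_seed_len n).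
Definition seed_len n := bit_seed_len n * seed_width n.
Definition out_len n := 2 ^ (bitlen n %/ k0) * bitlen n ^ a.

Definition bit_seed_idx n i h b := (i * (bitlen n).+1 + h) * (bitlen n).+1 + b.
(* Cell (u, j mod p_u) of an array of [bit_seed_len n] rows. *)
Definition design_idx n j u :=
  u * seed_width n + j %% nth_prime (seed_width n) u.

Definition out_bit_of n (x : nat -> bool) (r : nat -> bool) j : bool :=
  one_bit (bitlen n) (log_window n) (rounds n) n x
    (fun i h b => r (design_idx n j (bit_seed_idx n i h b))).

Definition local_ext : ext_family seed_len out_len := fun n x r =>
  [tuple out_bit_of n (nth false x) (nth false r) j | j < out_len n].

Lemma tnth_the_ext n x r j :
  tnth (local_ext (n := n) x r) j = out_bit_of n (nth false x) (nth false r) j.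
Proof. by rewrite tnth_mktuple. Qed.

Definition is_one (s : symbol) : bool := if s is Bit b then b else false.

Section Def_parts.
Local Notation fn := (seq symbol -> (nat -> nat) -> nat).

Lemma def_bitlen_exp (N : fn) e : definable N ->
  definable (fun inp env => bitlen (N inp env) ^ e).
Proof. by move=> dN; apply: def_exp; apply: def_bitlen. Qed.

Lemma def_rounds (N : fn) : definable N -> definable (fun inp env => rounds (N inp env)).
Proof. by move=> dN; apply: def_mul (def_const _) (def_bitlen_exp _ dN). Qed.

Lemma def_log_window (N : fn) : definable N ->
  definable (fun inp env => log_window (N inp env)).
Proof.
move=> dN; apply: def_min (def_bitlen dN); apply: def_bitlen.
exact: def_mul (def_const _) (def_bitlen_exp _ dN).
Qed.

Lemma def_succ (N : fn) : definable N -> definable (fun inp env => (N inp env).+1).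
Proof.
move=> dN; apply: def_ext (def_add dN (def_const 1)) _ => inp env.
by rewrite addn1.
Qed.

Lemma def_bit_seed_len (N : fn) : definable N ->
  definable (fun inp env => bit_seed_len (N inp env)).
Proof.
move=> dN; apply: def_mul (def_rounds dN) (def_exp _ _).
exact: def_succ (def_bitlen dN).
Qed.

Lemma def_seed_width (N : fn) : definable N ->
  definable (fun inp env => seed_width (N inp env)).
Proof. by move=> dN; exact: def_prime_range (def_bit_seed_len dN). Qed.

Lemma def_out_len (N : fn) : definable N ->
  definable (fun inp env => out_len (N inp env)).
Proof.
move=> dN; apply: def_mul (def_bitlen_exp _ dN).
apply: def_ext (def_pow2_bitlen (def_div (def_bitlen dN) (def_const k0)) dN) _.
by move=> inp env; rewrite (minn_idPl (leq_div _ _)).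
Qed.

Definition seed_cell (inp : seq symbol) n j i h b : bool :=
  is_one (nth Blank inp (n + 1 + design_idx n j (bit_seed_idx n i h b))).

Lemma def_seed_cell (N J I H' B' : fn) :
  definable N -> definable J -> definable I -> definable H' -> definable B' ->
  definable (fun inp env => seed_cell inp (N inp env) (J inp env) (I inp env)
                              (H' inp env) (B' inp env)).
Proof.
move=> dN dJ dI dH dB; apply: def_inp; apply: def_add.
  exact: def_add dN (def_const 1).
have du : definable (fun inp env =>
    bit_seed_idx (N inp env) (I inp env) (H' inp env) (B' inp env)).
  have dl := def_succ (def_bitlen dN).
  exact: def_add (def_mul (def_add (def_mul dI dl) dH) dl) dB.
apply: def_add; first exact: def_mul du (def_seed_width dN).
exact: def_mod dJ (def_nth_prime (def_seed_width dN) du).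
Qed.

Lemma def_hits (N J I W V : fn) :
  definable N -> definable J -> definable I -> definable W -> definable V ->
  definable (fun inp env => hits (bitlen (N inp env)) (log_window (N inp env))
    (seed_cell inp (N inp env) (J inp env) (I inp env)) (W inp env) (V inp env)).
Proof.
move=> dN dJ dI dW dV; apply: def_eq (def_const 0).
apply: (def_sum (def_bitlen dN) (G := fun inp env b =>
  odd (nat_bit (V inp env) b + pos_sum (log_window (N inp env))
    (seed_cell inp (N inp env) (J inp env) (I inp env)) (W inp env) b))).
apply: def_odd; apply: def_add; first exact: def_nat_bit (def_weak dV) (def_var 0).
apply: def_add.
  by apply: def_seed_cell; [exact: def_weak ..|exact: def_const|exact: def_var].
apply: (def_sum (def_weak (def_log_window dN)) (G := fun inp env h =>
  nat_bit (W inp (fun v => env v.+1)) h * seed_cell inp (N inp (fun v => env v.+1))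
    (J inp (fun v => env v.+1)) (I inp (fun v => env v.+1)) h.+1 (env 0))).
apply: def_mul; first exact: def_nat_bit (def_weak (def_weak dW)) (def_var 0).
apply: def_seed_cell; try exact: def_weak (def_weak _).
  exact: def_succ (def_var 0).
exact: (def_var 1).
Qed.

Lemma def_coef (N J I W : fn) :
  definable N -> definable J -> definable I -> definable W ->
  definable (fun inp env => coef (bitlen (N inp env)) (log_window (N inp env))
    (seed_cell inp (N inp env) (J inp env) (I inp env)) (W inp env)).
Proof.
move=> dN dJ dI dW.
apply: (def_sum (def_succ (def_log_window dN)) (G := fun inp env h =>
  (W inp env %/ 2 ^ h == 0) *
  seed_cell inp (N inp env) (J inp env) (I inp env) h (bitlen (N inp env)))).
apply: def_mul.
  exact: def_eq (def_div_pow2 (def_weak dW) (def_var 0)) (def_const 0).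
apply: def_seed_cell; try exact: def_weak; first exact: def_var.
exact: def_bitlen (def_weak dN).
Qed.

Lemma def_out_bit (N J : fn) : definable N -> definable J ->
  definable (fun inp env => out_bit_of (N inp env)
     (fun v => is_one (nth Blank inp v))
     (fun t => is_one (nth Blank inp (N inp env + 1 + t))) (J inp env)).
Proof.
move=> dN dJ; apply: def_odd.
apply: (def_sum (def_rounds dN) (G := fun inp env i =>
  round_sum (bitlen (N inp env)) (log_window (N inp env)) (N inp env)
    (fun v => is_one (nth Blank inp v))
    (seed_cell inp (N inp env) (J inp env) i))).
have dN1 := def_weak dN; have dJ1 := def_weak dJ.
have dpow : definable (fun inp env => 2 ^ log_window (N inp (fun v => env v.+1))).
  apply: def_ext (def_pow2_bitlen (def_log_window dN1) dN1) _ => inp env.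
  by rewrite (minn_idPl _) // geq_minr.
apply: (def_sum dpow (G := fun inp env w =>
  coef (bitlen (N inp (fun v => env v.+1))) (log_window (N inp (fun v => env v.+1)))
    (seed_cell inp (N inp (fun v => env v.+1)) (J inp (fun v => env v.+1)) (env 0)) w *
  \sum_(0 <= v < N inp (fun v => env v.+1)) is_one (nth Blank inp v) *
    hits (bitlen (N inp (fun v => env v.+1))) (log_window (N inp (fun v => env v.+1)))
     (seed_cell inp (N inp (fun v => env v.+1)) (J inp (fun v => env v.+1)) (env 0)) w v)).
have dN2 := def_weak dN1; have dJ2 := def_weak dJ1.
have dN3 := def_weak dN2; have dJ3 := def_weak dJ2.
apply: def_mul.
  exact: (def_coef dN2 dJ2 (def_var 1) (def_var 0)).
apply: (def_sum dN2 (G := fun inp env v => is_one (nth Blank inp v) *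
    hits (bitlen (N inp (fun v => env v.+2))) (log_window (N inp (fun v => env v.+2)))
     (seed_cell inp (N inp (fun v => env v.+2)) (J inp (fun v => env v.+2)) (env 1)) (env 0) v)).
apply: def_mul; first exact: def_inp (def_var 0).
exact: (def_hits dN3 dJ3 (def_var 2) (def_var 1) (def_var 0)).
Qed.

End Def_parts.

Lemma eq_one_bit lm H L n x x' y : (forall v, v < n -> x v = x' v) ->
  one_bit lm H L n x y = one_bit lm H L n x' y.
Proof.
move=> xx'; rewrite /one_bit; congr odd; apply: eq_bigr => i _.
apply: eq_bigr => w _; congr (_ * _); apply: eq_big_nat => v /andP [_ vn].
by rewrite xx'.
Qed.

Theorem local_ext_explicit : explicit local_ext.
Proof.
(* n is recovered as the position of the only separator. Variable 1 is the input length in both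
   expressions, while variable 0 of the second one is the index of the output bit. *)
have dn : definable (fun inp env => \sum_(0 <= i < env 1) i * is_sep (nth Blank inp i)).
  apply: (def_sum (def_var 1) (G := fun inp _ i => i * is_sep (nth Blank inp i))).
  exact: def_mul (def_var 0) (def_inp _ (def_var 0)).
have [eM HM] := def_out_len dn; have [eB HB] := def_out_bit dn (def_var 0).
apply: (@explicit_of_expr _ _ _ eM eB) => n x r inp.
have Sn : \sum_(0 <= i < size inp) i * is_sep (nth Blank inp i) = n.
  have szi : size inp = n + (seed_len n).+1.
    by rewrite /inp size_cat /= !size_map !size_tuple.
  rewrite szi (bigD1_seq n) ?iota_uniq ?mem_index_iota //=; last by lia.
  rewrite {1}/inp nth_cat size_map size_tuple ltnn subnn /= muln1.
  rewrite big1_seq ?addn0 // => i /andP [i_n]; rewrite mem_index_iota => ilt.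
  rewrite /inp nth_cat size_map size_tuple; case: ltnP => le.
    by rewrite (nth_map false) ?size_tuple // muln0.
  have -> : i - n = (i - n.+1).+1 by lia.
  by rewrite /= (nth_map false) ?muln0 // size_tuple; lia.
rewrite HM Sn; split=> // j; rewrite HB /scons Sn tnth_the_ext.
have -> (b : bool) : ((b : nat) != 0) = b by case: b.
rewrite /out_bit_of (@eq_one_bit _ _ _ _ _ (nth false x)); last first.
  by move=> v vn; rewrite /inp nth_cat size_map size_tuple vn (nth_map false) ?size_tuple.
congr one_bit; apply/funext => i; apply/funext => h; apply/funext => b.
move: (design_idx _ _ _) => t.
rewrite /inp nth_cat size_map size_tuple addn1 ltnNge.
rewrite (_ : n <= n.+1 + t) ?addSn ?leqW ?leq_addr //= -addSn (_ : n.+1 + t - n = t.+1) /=; last by lia.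
have [tr|rt] := ltnP t (size r); first by rewrite (nth_map false).
by rewrite !nth_default ?size_map.
Qed.

End Construction.

(** * Sampled positions and the cells of the design *)

Lemma nat_bit_inj lm v v' : v < 2 ^ lm -> v' < 2 ^ lm ->
  (forall b, b < lm -> nat_bit v b = nat_bit v' b) -> v = v'.
Proof.
elim: lm v v' => [|lm IH] v v'; first by case: v v' => [|?] [|?].
rewrite expnS => vl vl' Hb.
have o0 : odd v = odd v' by have := Hb 0 isT; rewrite /nat_bit expn0 !divn1.
have hh : v./2 = v'./2.
  apply: IH; [by lia|by lia|move=> b bl].
  by have := Hb b.+1 bl; rewrite /nat_bit expnS !divnMA !divn2.
by rewrite -(odd_double_half v) -(odd_double_half v') o0 hh.
Qed.

Lemma hitsP lm H y w v :
  reflect (forall b, b < lm -> nat_bit v b = odd (pos_sum H y w b)) (hits lm H y w v).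
Proof.
rewrite /hits sum_nat_seq_eq0; apply: (iffP allP) => Hb b.
  move=> bl; have := Hb b; rewrite mem_index_iota bl => /(_ isT).
  by rewrite implyTb eqb0 oddD oddb; case: (nat_bit v b); case: (odd _).
rewrite mem_index_iota => /andP [_ /Hb E]; rewrite implyTb eqb0 oddD oddb E.
by case: (odd _).
Qed.

Lemma hits_inj lm H y w v v' : v < 2 ^ lm -> v' < 2 ^ lm ->
  hits lm H y w v -> hits lm H y w v' -> v = v'.
Proof.
move=> vl vl' /hitsP h /hitsP h'; apply: nat_bit_inj vl vl' _ => b bl.
by rewrite h // h'.
Qed.

(** A point has a single position, so at most one summand is nonzero; a sum that would be expensive
    in AC0 becomes a disjunction. *)
Lemma sum_hitsE lm H n (x : nat -> bool) y w : n <= 2 ^ lm ->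
  \sum_(0 <= v < n) x v * hits lm H y w v =
  has (fun v => x v && hits lm H y w v) (iota 0 n).
Proof.
move=> nl; case: hasP => [[v0]|no].
  rewrite mem_iota add0n /= => v0n /andP [xv0 hv0].
  rewrite (bigD1_seq v0) ?iota_uniq ?mem_index_iota //= xv0 hv0 big1_seq // => v.
  rewrite mem_index_iota => /andP [vv0 /andP [_ vn]].
  case: (boolP (hits _ _ _ _ v)) => [hv|]; last by rewrite muln0.
  case/eqP: vv0; apply: hits_inj hv hv0; exact: leq_trans nl.
rewrite big1_seq // => v; rewrite mem_index_iota => /andP [_ /andP [_ vn]].
rewrite mulnb; apply/eqP; rewrite eqb0; apply/negP => h; apply: no.
by exists v; rewrite ?mem_iota.
Qed.

Section Design.
Variables (a B : nat).
Local Notation bit_seed_len := (bit_seed_len a B).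
Local Notation seed_width := (seed_width a B).
Local Notation seed_len := (seed_len a B).
Local Notation rounds := (rounds a B).

Lemma bit_seed_idx_lt n i h b : i < rounds n -> h <= bitlen n -> b <= bitlen n ->
  bit_seed_idx n i h b < bit_seed_len n.
Proof.
rewrite /bit_seed_idx /bit_seed_len => iL hl bl.
by rewrite expnS expn1; move: (bitlen n) (rounds n) iL hl bl => l L; nia.
Qed.

Lemma design_prime n u : u < bit_seed_len n ->
  [/\ prime (nth_prime (seed_width n) u), nth_prime (seed_width n) u < seed_width n
    & prime_count (nth_prime (seed_width n) u) = u].
Proof.
move=> ul; apply: nth_primeP; apply: leq_trans ul _; exact: prime_range_count.
Qed.

Lemma design_idx_lt n j u : u < bit_seed_len n ->
  design_idx a B n j u < seed_len n.
Proof.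
move=> ul; have [pp lt _] := design_prime ul; rewrite /design_idx /seed_len.
have := ltn_pmod j (prime_gt0 pp); move: (_ %% _) => t tp.
apply: leq_trans (_ : u.+1 * seed_width n <= _); last by rewrite leq_mul2r ul orbT.
by rewrite mulSn addnC ltn_add2r (ltn_trans tp).
Qed.

End Design.

(** * Formulas, circuits and parity *)

Section Circuits.
Variable N : nat.
Implicit Types (gs : seq gate) (f : seq bool -> bool).

(* [formula_for D S f]: a formula of depth at most D with at most S gates computes f;
   every subformula of an AND or OR is charged the same S. *)
Inductive formula_for : nat -> nat -> (seq bool -> bool) -> Prop :=
| formula_var D S w : w < N -> formula_for D S (fun inp => nth false inp w)
| formula_not D S f : formula_for D S f -> formula_for D.+1 S.+1 (fun inp => ~~ f inp)
| formula_and (I : Type) (s : seq I) (F : I -> seq bool -> bool) D S S' :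
    size s * S < S' -> (forall i, formula_for D S (F i)) ->
    formula_for D.+1 S' (fun inp => all (F^~ inp) s)
| formula_or (I : Type) (s : seq I) (F : I -> seq bool -> bool) D S S' :
    size s * S < S' -> (forall i, formula_for D S (F i)) ->
    formula_for D.+1 S' (fun inp => has (F^~ inp) s).

Definition wire_vals gs (inp : seq bool) : seq bool :=
  foldl (fun vs g => rcons vs (eval_gate vs g)) inp gs.

Definition wire_depths gs : seq nat :=
  foldl (fun ds g => rcons ds (\max_(w <- gate_inputs g) nth 0 ds w).+1)
        (nseq N 0) gs.

Definition gates_wf gs : Prop := forall i, i < size gs ->
  all (fun w => w < N + i) (gate_inputs (nth (NotGate 0) gs i)).

Definition computes_at gs w f D : Prop :=
  [/\ w < N + size gs, nth 0 (wire_depths gs) w <= D &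
      forall inp, size inp = N -> nth false (wire_vals gs inp) w = f inp].

Lemma size_wire_vals gs inp : size (wire_vals gs inp) = size inp + size gs.
Proof.
elim/last_ind: gs => [|gs g IH]; first by rewrite addn0.
by rewrite /wire_vals foldl_rcons size_rcons -/(wire_vals gs inp) IH size_rcons addnS.
Qed.

Lemma size_wire_depths gs : size (wire_depths gs) = N + size gs.
Proof.
elim/last_ind: gs => [|gs g IH]; first by rewrite addn0 size_nseq.
by rewrite /wire_depths foldl_rcons size_rcons -/(wire_depths gs) IH size_rcons addnS.
Qed.

Lemma computes_at_rcons gs g w f D :
  computes_at gs w f D -> computes_at (rcons gs g) w f D.
Proof.
move=> [lt dw vw]; split; first by rewrite size_rcons; lia.
  by rewrite /wire_depths foldl_rcons nth_rcons -/(wire_depths gs) size_wire_depths lt.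
move=> inp szi; rewrite /wire_vals foldl_rcons nth_rcons -/(wire_vals gs inp).
by rewrite size_wire_vals szi lt vw.
Qed.

Lemma computes_at_cat gs gs' w f D :
  computes_at gs w f D -> computes_at (gs ++ gs') w f D.
Proof.
move=> H; elim/last_ind: gs' => [|gs' g IH]; first by rewrite cats0.
by rewrite -rcons_cat; exact: computes_at_rcons.
Qed.

Lemma computes_at_last gs g f D :
  (forall w, w \in gate_inputs g -> nth 0 (wire_depths gs) w <= D) ->
  (forall inp, size inp = N -> eval_gate (wire_vals gs inp) g = f inp) ->
  computes_at (rcons gs g) (N + size gs) f D.+1.
Proof.
move=> Hd Hv; split; first by rewrite size_rcons; lia.
  rewrite /wire_depths foldl_rcons nth_rcons -/(wire_depths gs) size_wire_depths.
  by rewrite ltnn eqxx ltnS; apply/bigmax_leqP_seq => w wi _; exact: Hd.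
move=> inp szi; rewrite /wire_vals foldl_rcons nth_rcons -/(wire_vals gs inp).
by rewrite size_wire_vals szi ltnn eqxx Hv.
Qed.

Lemma gates_wf_rcons gs g : gates_wf gs ->
  all (fun w => w < N + size gs) (gate_inputs g) -> gates_wf (rcons gs g).
Proof.
move=> H Hg i; rewrite size_rcons ltnS leq_eqVlt nth_rcons => /orP [/eqP ->|lt].
  by rewrite ltnn eqxx.
by rewrite lt; exact: H.
Qed.

(** Quantified over the gates already present, so that the circuits of several subformulas can be
    appended one after another. *)
Definition realizable S f D : Prop := forall gs, gates_wf gs ->
  exists gs' w, [/\ gates_wf (gs ++ gs'), size gs' <= S & computes_at (gs ++ gs') w f D].

Lemma realizable_seq (I : Type) (s : seq I) (F : I -> seq bool -> bool) D S :
  (forall i, realizable S (F i) D) -> forall gs, gates_wf gs ->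
  exists gs' ws, [/\ gates_wf (gs ++ gs'), size gs' <= size s * S,
    size ws = size s, (forall w, w \in ws -> w < N + size (gs ++ gs') /\
      nth 0 (wire_depths (gs ++ gs')) w <= D) &
    forall inp, size inp = N ->
      [seq nth false (wire_vals (gs ++ gs') inp) w | w <- ws] = [seq F i inp | i <- s]].
Proof.
move=> HF; elim: s => [|i s IH] gs wf.
  by exists [::], [::]; rewrite cats0; split.
have [gs1 [w [wf1 sz1 c1]]] := HF i gs wf.
have [gs2 [ws [wf2 sz2 szw dw vw]]] := IH _ wf1.
exists (gs1 ++ gs2), (w :: ws); rewrite catA; split=> //.
- by rewrite size_cat mulSn leq_add.
- by rewrite /= szw.
- move=> w'; rewrite inE => /orP [/eqP ->|/dw //].
  by have [] := computes_at_cat gs2 c1.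
- move=> inp szi /=; rewrite vw //; congr cons.
  by have [_ _ ->] := computes_at_cat gs2 c1.
Qed.

Lemma formula_realizable D S f : formula_for D S f -> realizable S f D.
Proof.
elim=> {D S f}.
- move=> D S w wN gs wf; exists [::], w; rewrite cats0; split=> //.
  have H : computes_at [::] w (nth false ^~ w) D.
    by split; [rewrite addn0 | rewrite nth_nseq; case: ifP | ].
  exact: (computes_at_cat gs H).
- move=> D S f _ IH gs wf; have [gs' [w [wf' sz [lt dw vw]]]] := IH gs wf.
  exists (rcons gs' (NotGate w)), (N + size (gs ++ gs')); rewrite -rcons_cat.
  split; [by apply: gates_wf_rcons => //=; rewrite lt | by rewrite size_rcons | ].
  apply: computes_at_last => [w'|inp szi /=]; first by rewrite inE => /eqP ->.
  by rewrite vw.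
- move=> I s F D S S' sk _ IH gs wf.
  have [gs' [ws [wf' sz szw dw vw]]] := realizable_seq s IH wf.
  exists (rcons gs' (AndGate ws)), (N + size (gs ++ gs')); rewrite -rcons_cat; split.
  + by apply: gates_wf_rcons => //=; apply/allP => w /dw [].
  + by rewrite size_rcons (leq_ltn_trans sz).
  + apply: computes_at_last => [w /dw [] //|inp szi /=].
    by have := congr1 (all id) (vw inp szi); rewrite !all_map.
- move=> I s F D S S' sk _ IH gs wf.
  have [gs' [ws [wf' sz szw dw vw]]] := realizable_seq s IH wf.
  exists (rcons gs' (OrGate ws)), (N + size (gs ++ gs')); rewrite -rcons_cat; split.
  + by apply: gates_wf_rcons => //=; apply/allP => w /dw [].
  + by rewrite size_rcons (leq_ltn_trans sz).
  + apply: computes_at_last => [w /dw [] //|inp szi /=].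
    by have := congr1 (has id) (vw inp szi); rewrite !has_map.
Qed.

Lemma formula_circuit m (F : 'I_m -> seq bool -> bool) D S : (forall j, formula_for D S (F j)) ->
  exists c : circuit, [/\ circ_wf N c, size (circ_gates c) <= m * S,
    circ_depth N c <= D &
    forall inp, size inp = N -> circ_eval c inp = [seq F j inp | j <- enum 'I_m]].
Proof.
move=> HF.
have wf0 : gates_wf [::] by move=> i; rewrite ltn0.
have [gs [ws [wf sz szw dw vw]]] :=
  realizable_seq (enum 'I_m) (fun j => formula_realizable (HF j)) wf0.
rewrite size_enum_ord in sz.
exists (Circuit gs ws); split=> //.
- by split=> //=; apply/allP => w /dw [].
- by rewrite /circ_depth; apply/bigmax_leqP_seq => w /dw [].
Qed.

Lemma formula_weak D S f D' S' : formula_for D S f -> D <= D' -> S <= S' -> formula_for D' S' f.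
Proof.
move=> H; elim: H D' S' => {D S f}.
- by move=> D S w wN D' S' _ _; exact: formula_var.
- by move=> D S f _ IH [|D'] [|S'] // DD SS; apply: formula_not; exact: IH.
- move=> I s F D S S1 sk _ IH [|D'] // S' DD SS.
  by apply: (@formula_and _ _ _ _ S); [exact: leq_trans sk SS|move=> i; exact: IH].
- move=> I s F D S S1 sk _ IH [|D'] // S' DD SS.
  by apply: (@formula_or _ _ _ _ S); [exact: leq_trans sk SS|move=> i; exact: IH].
Qed.

Lemma formula_ext D S f g : formula_for D S f -> f =1 g -> formula_for D S g.
Proof. by move=> H /funext <-. Qed.

Lemma formula_false D S : 0 < S -> formula_for D.+1 S (fun=> false).
Proof. by move=> S0; apply: (@formula_or void [::] (fun v => match v with end) D 0). Qed.

Lemma all_zip_eq (I : Type) (f : I -> bool) (t : seq bool) (s : seq I) :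
  size t = size s -> all (fun p => p.1 == f p.2) (zip t s) = (t == map f s).
Proof.
elim: s t => [|i s IH] [|b t] //= [sz].
by rewrite IH // eqseq_cons.
Qed.

Definition parity_size g S := (2 ^ g * (g * S.+1).+1).+1.

(** One term for each assignment of odd weight, true exactly when the inputs form that assignment.
    The three layers are negated literals, conjunctions and a disjunction. *)
Lemma formula_parity_dnf (I : Type) (s : seq I) (F : I -> seq bool -> bool) D S g :
  size s <= g -> (forall i, formula_for D S (F i)) ->
  formula_for D.+3 (parity_size g S) (fun inp => odd (count (F^~ inp) s)).
Proof.
move=> sg HF.
pose ts := [seq t : (size s).-tuple bool <- enum {: (size s).-tuple bool} | odd (count id t)].
pose lit (p : bool * I) inp := p.1 == F p.2 inp.
have Hlit p : formula_for D.+1 S.+1 (lit p).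
  case: p => -[] i; rewrite /lit /=.
    by apply: formula_ext (formula_weak (HF i) (leqnSn _) (leqnSn _)) _ => inp; rewrite eq_sym eqb_id.
  by apply: formula_ext (formula_not (HF i)) _ => inp; case: (F i inp).
have Hterm (t : (size s).-tuple bool) :
    formula_for D.+2 (g * S.+1).+1 (fun inp => all (lit^~ inp) (zip t s)).
  apply: formula_and Hlit; rewrite ltnS leq_mul2r size_zip size_tuple minnn sg orbT //.
apply: formula_ext (@formula_or _ ts _ _ _ _ _ Hterm) _.
  rewrite /parity_size ltnS leq_mul2r /=; apply: leq_trans (_ : #|{: (size s).-tuple bool}| <= _).
    by rewrite cardE size_filter count_size.
  by rewrite card_tuple card_bool leq_exp2l.
move=> inp.
have Hz (t : (size s).-tuple bool) :
    all (lit^~ inp) (zip t s) = (tval t == map (F^~ inp) s).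
  by apply: (all_zip_eq (F^~ inp)); rewrite size_tuple.
apply/hasP/idP => [[t]|od].
  rewrite mem_filter => /andP [od _].
  by rewrite Hz => /eqP Et; move: od; rewrite Et count_map.
exists (map_tuple (F^~ inp) (in_tuple s)).
  by rewrite mem_filter mem_enum /= count_map andbT.
by rewrite Hz.
Qed.

Lemma odd_count_flatten (I : Type) (p : pred I) (ss : seq (seq I)) :
  odd (count p (flatten ss)) = odd (count (fun t => odd (count p t)) ss).
Proof. by elim: ss => //= t ss IH; rewrite count_cat !oddD IH oddb. Qed.

Lemma formula_parity (I : Type) (s : seq I) (F : I -> seq bool -> bool) D S g q :
  size s <= g ^ q -> (forall i, formula_for D S (F i)) ->
  formula_for (D.+1 + 3 * q) (iter q (parity_size g) S.+1) (fun inp => odd (count (F^~ inp) s)).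
Proof.
move=> + HF; elim: q s => [|q IH] s sg.
  rewrite muln0 addn0 /=; case: s sg => [|i [|//]] _ /=.
    exact: formula_false.
  by apply: formula_ext (formula_weak (HF i) (leqnSn _) (leqnSn _)) _ => inp /=; rewrite addn0 oddb.
(* A family of subformulas must be supplied for every index, here for every list; [take] makes the
   short-list hypothesis hold for all and changes none of the blocks in [ss]. *)
pose G t inp := odd (count (F^~ inp) (take (g ^ q) t)).
have HG t : formula_for (D.+1 + 3 * q) (iter q (parity_size g) S.+1) (G t).
  by apply: IH; rewrite size_take; case: ltnP.
pose ss := reshape (nseq g (g ^ q)) s.
have Hss : size ss <= g by rewrite size_reshape size_nseq.
have := formula_parity_dnf Hss HG; rewrite mulnS [3 + _]addnC addnA addn3 iterS => H.
apply: formula_ext H _ => inp.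
rewrite -[in RHS](@reshapeKr _ (nseq g (g ^ q)) s); last by rewrite sumn_nseq mulnC -expnS.
rewrite odd_count_flatten -/ss; congr odd.
have: all (fun t => size t <= g ^ q) ss.
  rewrite /ss; move: (g ^ q) => k; elim: (g) (s) => //= g' IHg s'.
  by rewrite IHg andbT size_take; case: ltnP.
by elim: ss {Hss} => //= t ss IHs /andP [szt /IHs ->]; rewrite /G take_oversize.
Qed.

(** The exponent is linear in g, so fan-in O(log n) and a fixed number of levels give polynomial
    size. *)
Lemma parity_size_iter_le g q S :
  (iter q (parity_size g) S.+1).+1 <= 2 ^ ((2 * g + 2) * q) * S.+2.
Proof.
elim: q => [|q IH]; first by rewrite muln0 mul1n.
rewrite iterS [_ * q.+1]mulnS expnD -mulnA.
set s := iter _ _ _ in IH *; apply: leq_trans (_ : 2 ^ (2 * g + 2) * s.+1 <= _); last first.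
  by rewrite leq_mul2l IH orbT.
have gl : g < 2 ^ g by exact: ltn_expl.
rewrite /parity_size expnD mul2n -addnn expnD (_ : 2 ^ 2 = 4) //.
move: (2 ^ g) gl => G gl.
have h : (g * s.+1).+1 <= G * s.+1 by nia.
have h2 : G * (g * s.+1).+1 <= G * (G * s.+1) by rewrite leq_mul2l h orbT.
have h3 : 0 < G * (G * s.+1) by rewrite !muln_gt0; lia.
rewrite -(mulnA _ 4) [4 * _]mulnC mulnA -(mulnA G G); lia.
Qed.

End Circuits.

(** * The extractor in AC0 *)

Section AC0.
Variables (a c A B k0 : nat).
Local Notation rounds := (rounds a B).
Local Notation log_window := (log_window c A).
Local Notation seed_len := (seed_len a B).
Local Notation out_len := (out_len a k0).
Local Notation local_ext := (@local_ext a c A B k0).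

Section Fixed_n.
Variables (n j : nat).
Let lm := bitlen n.
Let H := log_window n.
Let L := rounds n.
Let N := n + seed_len n.

Definition seed_wire i h b := n + design_idx a B n j (bit_seed_idx n i h b).

Lemma formula_seed_wire D S i h b : i < L -> h <= lm -> b <= lm ->
  formula_for N D S (fun inp => nth false inp (seed_wire i h b)).
Proof.
move=> iL hl bl; apply: formula_var; rewrite ltn_add2l.
by apply: design_idx_lt; exact: bit_seed_idx_lt.
Qed.

Definition seed_of (inp : seq bool) i h b := nth false inp (seed_wire i h b).

Definition pos_rows (w : nat) := 0 :: [seq h.+1 | h <- iota 0 H & nat_bit w h].

Lemma odd_pos_sum y w b : odd (pos_sum H y w b) = odd (count (fun h => y h b) (pos_rows w)).
Proof.
rewrite /pos_sum /pos_rows /= count_map count_filter; congr (odd (_ + _)).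
rewrite /index_iota subn0; elim: (iota 0 H) => [|h s IH]; first by rewrite big_nil.
by rewrite big_cons IH /= mulnb andbC.
Qed.

Lemma H_lm : H <= lm. Proof. exact: geq_minr. Qed.

Let S1 := parity_size lm.+1 0.
Let S2 := (lm.+1 * S1.+1).+1.
Let S3 := (n * S2).+1.
Let S4 := (2 * S3).+1.

Lemma formula_hit i w v : i < L -> v < n ->
  formula_for N 5 S2 (fun inp => nth false inp v && hits lm H (seed_of inp i) w v).
Proof.
move=> iL vn.
(* Index lm stands for the source bit, the indices below it for the bit comparisons. The minima keep
   the wires in range for every index and are harmless on those used. *)
pose F (b : nat) inp :=
  if b == lm then nth false inp v else
  nat_bit v b == odd (count (fun h => nth false inp (seed_wire i (minn h lm) (minn b lm)))
     (pos_rows w)).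
have HF b : formula_for N 4 S1.+1 (F b).
  rewrite /F; case: eqP => _; first by apply: formula_var; rewrite /N; lia.
  have P : formula_for N 3 S1 (fun inp => odd (count
      (fun h => nth false inp (seed_wire i (minn h lm) (minn b lm))) (pos_rows w))).
    apply: (@formula_parity_dnf N nat (pos_rows w)
      (fun h inp => nth false inp (seed_wire i (minn h lm) (minn b lm))) 0 0).
      rewrite /= size_map size_filter ltnS; apply: leq_trans (count_size _ _) _.
      by rewrite size_iota H_lm.
    by move=> h; apply: formula_seed_wire => //; exact: geq_minr.
  case: (nat_bit v b).
    by apply: formula_ext (formula_weak P (leqnSn _) (leqnSn _)) _ => inp; rewrite eq_sym eqb_id.
  by apply: formula_ext (formula_not P) _ => inp; case: (odd _).
have := @formula_and N nat (iota 0 lm.+1) F 4 S1.+1 S2; rewrite size_iota ltnSn.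
move=> /(_ isT HF) G; apply: formula_ext G _ => inp.
rewrite -[lm.+1]addn1 iotaD all_cat andbC /= andbT {1}/F eqxx; congr andb.
apply/allP/hitsP => Hb b.
  move=> bl; have := Hb b; rewrite mem_iota add0n bl => /(_ isT).
  rewrite /F ltn_eqF // => /eqP ->; rewrite odd_pos_sum; congr odd.
  apply: eq_in_count => h hr /=; rewrite (minn_idPl (ltnW bl)) (minn_idPl _) //.
  move: hr; rewrite inE => /orP [/eqP -> //|/mapP [h']].
  by rewrite mem_filter mem_iota add0n => /andP [_ /= h'H] ->; exact: leq_trans h'H H_lm.
rewrite mem_iota add0n => /= bl; rewrite /F ltn_eqF // Hb // odd_pos_sum.
apply/eqP; congr odd; apply: eq_in_count => h hr /=.
rewrite (minn_idPl (ltnW bl)) (minn_idPl _) //.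
move: hr; rewrite inE => /orP [/eqP -> //|/mapP [h']].
by rewrite mem_filter mem_iota add0n => /andP [_ /= h'H] ->; exact: leq_trans h'H H_lm.
Qed.

Lemma formula_lookup i w : i < L ->
  formula_for N 6 S3 (fun inp => has (fun v => nth false inp v && hits lm H (seed_of inp i) w v) (iota 0 n)).
Proof.
move=> iL; have := @formula_or N 'I_n (enum 'I_n)
  (fun v inp => nth false inp v && hits lm H (seed_of inp i) w v) 5 S2 S3.
rewrite size_enum_ord ltnSn => /(_ isT (fun v => formula_hit w iL (ltn_ord v))) G.
apply: formula_ext G _ => inp; rewrite -val_enum_ord has_map; exact: eq_has.
Qed.

(** A summand, for a given round, point and level, of the fully expanded output bit. Expanding
    removes the intermediate sums, leaving one large parity of conjunctions. *)
Definition term (p : 'I_L * 'I_(2 ^ H) * 'I_H.+1) inp : bool :=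
  [&& p.1.2 %/ 2 ^ p.2 == 0, seed_of inp p.1.1 p.2 lm &
      has (fun v => nth false inp v && hits lm H (seed_of inp p.1.1) p.1.2 v) (iota 0 n)].

Lemma formula_term p : formula_for N 7 S4 (term p).
Proof.
rewrite /term; case: (_ == 0); last by exact: formula_false.
pose F (b : bool) inp := if b then seed_of inp p.1.1 p.2 lm else
  has (fun v => nth false inp v && hits lm H (seed_of inp p.1.1) p.1.2 v) (iota 0 n).
have HF b : formula_for N 6 S3 (F b).
  case: b; last exact: formula_lookup.
  apply: formula_seed_wire => //; apply: leq_trans H_lm; rewrite -ltnS; exact: ltn_ord.
apply: formula_ext (@formula_and N bool [:: true; false] F 6 S3 S4 _ HF) _; first exact: ltnSn.
by move=> inp /=; rewrite andbT.
Qed.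

Lemma out_bit_terms inp :
  one_bit lm H L n (nth false inp) (seed_of inp) =
  odd (count (term^~ inp) (enum {: 'I_L * 'I_(2 ^ H) * 'I_H.+1})).
Proof.
rewrite /one_bit; congr odd; rewrite -sum1_count big_enum_cond /=.
rewrite big_mkord.
transitivity (\sum_(i < L) \sum_(w < 2 ^ H) \sum_(h < H.+1) (term (i, w, h) inp : nat)).
  apply: eq_bigr => i _; rewrite /round_sum big_mkord; apply: eq_bigr => w _.
  rewrite sum_hitsE; last by apply/ltnW; exact: bitlen_gt.
  rewrite /coef big_mkord big_distrl /=; apply: eq_bigr => h _.
  by rewrite /term /= -mulnA !mulnb.
rewrite pair_big /= pair_big /= [RHS]big_mkcond /=.
by apply: eq_big => // -[[i w] h] _ /=; case: (term _ _).
Qed.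

Lemma formula_out_bit g q : L * 2 ^ H * H.+1 <= g ^ q ->
  formula_for N (8 + 3 * q) (iter q (parity_size g) S4.+1)
    (fun inp => one_bit lm H L n (nth false inp) (seed_of inp)).
Proof.
move=> le; apply: formula_ext (@formula_parity N _ (enum {: 'I_L * 'I_(2 ^ H) * 'I_H.+1}) term 7 S4 g q _ formula_term) _.
  by rewrite -cardE !card_prod !card_ord.
by move=> inp; rewrite out_bit_terms.
Qed.

End Fixed_n.

Let C0 := (8 * B * (2 * A + 1)).+1.

(** With l the bit length, up to constants the rounds contribute l^a, the points l^(c+1) and the
    levels l; [C0] collects the constants in the fan-in of the parity tree. *)
Lemma term_count_le n :
  rounds n * 2 ^ log_window n * (log_window n).+1 <= (C0 * (bitlen n).+1) ^ (a + c + 2).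
Proof.
set l := bitlen n.
have hH : (log_window n).+1 <= l.+1 by rewrite ltnS geq_minr.
have hp : 2 ^ log_window n <= (2 * A + 1) * l.+1 ^ c.+1.
  apply: leq_trans (_ : 2 ^ bitlen (A * l ^ c.+1) <= _); first by rewrite leq_exp2l // geq_minl.
  apply: leq_trans (bitlen_le _) _.
  have h1 : l ^ c.+1 <= l.+1 ^ c.+1 by rewrite leq_exp2r.
  have h2 : 0 < l.+1 ^ c.+1 by rewrite expn_gt0.
  by move: (l ^ _) (l.+1 ^ _) h1 h2 => P Q; nia.
have hr : rounds n <= 8 * B * l.+1 ^ a.
  by apply: leq_mul => //; case: (a) => // a'; rewrite leq_exp2r.
apply: leq_trans (leq_mul (leq_mul hr hp) hH) _.
have -> : 8 * B * l.+1 ^ a * ((2 * A + 1) * l.+1 ^ c.+1) * l.+1 =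
   (8 * B * (2 * A + 1)) * l.+1 ^ (a + c + 2).
  by rewrite -addnA addn2 expnD !expnSr; move: (l.+1 ^ a) (l.+1 ^ c) => P Q; nia.
rewrite expnMn leq_mul2r; apply/orP; right.
apply: leq_trans (leqnSn _) _; rewrite -/C0 addn2 expnS leq_pmulr // expn_gt0.
by [].
Qed.

Lemma pow2_bitlen_bound n e : 2 ^ (e * (bitlen n).+1) <= (4 * n.+1) ^ e.
Proof.
rewrite mulnC expnM; case: e => // e; rewrite leq_exp2r // expnS.
by have := bitlen_le n; lia.
Qed.

Theorem local_ext_AC0 : computable_in_AC0 (3 * (a + c) + 14) local_ext.
Proof.
(* The height of the parity tree; the depth is 8 + 3 q = 3 (a + c) + 14. *)
set q := a + c + 2.
suff [e He] : exists e, forall n, out_len n *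
    iter q (parity_size (C0 * (bitlen n).+1))
     (2 * (n * ((bitlen n).+1 * (parity_size (bitlen n).+1 0).+1).+1).+1).+2 <= (8 * n.+1) ^ e.
  exists (16 ^ e), e => n.
  pose F (j : 'I_(out_len n)) inp :=
    one_bit (bitlen n) (log_window n) (rounds n) n (nth false inp) (seed_of n j inp).
  have HF j : formula_for (n + seed_len n) (8 + 3 * q) (iter q (parity_size (C0 * (bitlen n).+1))
     (2 * (n * ((bitlen n).+1 * (parity_size (bitlen n).+1 0).+1).+1).+1).+2) (F j).
    exact: formula_out_bit (term_count_le n).
  have [ci [wf sz dp ev]] := formula_circuit HF.
  exists ci; split=> //.
  - apply: leq_trans sz _; apply: leq_trans (He n) _.
    rewrite /poly_bound [X in _ <= X]addnC -mulnS.
    apply: leq_trans (_ : 16 ^ e * ((n + seed_len n) ^ e).+1 <= _); last by [].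
    have [->|n0] := posnP n.
      apply: leq_trans (_ : 16 ^ e <= _); last by rewrite leq_pmulr.
      by case: (e) => // e'; rewrite leq_exp2r.
    apply: leq_trans (_ : 16 ^ e * (n + seed_len n) ^ e <= _).
      by rewrite -expnMn; case: (e) => // e'; rewrite leq_exp2r //; lia.
    by rewrite leq_mul2l leqnSn orbT.
  - by rewrite /q in dp *; apply: leq_trans dp _; lia.
  - move=> x r; rewrite ev ?size_cat ?size_tuple //.
    apply: (@eq_from_nth _ false); rewrite size_map size_enum_ord ?size_tuple //.
    move=> i im; rewrite (nth_map (Ordinal im)) ?size_enum_ord //.
    rewrite (_ : nth _ _ _ = Ordinal im); last by apply: val_inj; rewrite /= nth_enum_ord.
    rewrite -(tnth_nth false _ (Ordinal im)) tnth_the_ext /F /out_bit_of.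
    rewrite (@eq_one_bit _ _ _ _ _ (nth false x)); last first.
      by move=> v vn; rewrite nth_cat size_tuple vn.
    congr one_bit; apply/funext => i'; apply/funext => h; apply/funext => b.
    by rewrite /seed_of /seed_wire nth_cat size_tuple ltnNge leq_addr /= addKn.
set K1 := (2 * C0 + 2) * q.
exists ((1 + a) + (K1 + 9)) => n.
set l := bitlen n; set X := 8 * n.+1.
have X2 e : 2 ^ (e * l.+1) <= X ^ e.
  apply: leq_trans (pow2_bitlen_bound n e) _.
  by case: e => // e; rewrite leq_exp2r //; rewrite /X; lia.
have lX : 2 ^ l.+1 <= X by have := X2 1; rewrite mul1n expn1.
have llX : l.+1 < X by apply: leq_trans lX; exact: ltn_expl.
have h1 : out_len n <= X ^ (1 + a).
  rewrite expnD expn1 leq_mul //.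
    apply: leq_trans lX; rewrite leq_exp2l // leqW // leq_div //.
  by case: (a) => // a'; rewrite leq_exp2r //; lia.
have h2 : parity_size l.+1 0 <= X ^ 3.
  rewrite /parity_size muln1; apply: leq_ltn_trans (_ : X * X < _).
    apply: leq_mul => //.
  rewrite !expnS expn0 muln1; have : 1 < X by rewrite /X; lia.
  by move=> X1; rewrite ltn_pmul2l ?ltn_Pmull //; lia.
set S4 := (2 * _).+1.
have h3 : S4.+2 <= X ^ 9.
  have X8 : 8 <= X by rewrite /X; lia.
  have nX : n < X by rewrite /X; lia.
  have k1 : (l.+1 * (parity_size l.+1 0).+1).+1 <= X ^ 5.
    rewrite !expnS expn0 muln1; rewrite !expnS expn0 muln1 in h2.
    move: (parity_size _ _) h2 => p h2.
    have : l.+1 * p.+1 <= X * (X * (X * X) + 1) by apply: leq_mul; lia.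
    by move: (l.+1 * _) => z; nia.
  have k2 : (n * (l.+1 * (parity_size l.+1 0).+1).+1).+1 <= X ^ 6.
    rewrite expnS; apply: leq_trans (_ : (n * X ^ 5).+1 <= _).
      by rewrite ltnS leq_mul2l k1 orbT.
    apply: leq_trans (_ : n.+1 * X ^ 5 <= _); last by rewrite leq_mul2r nX orbT.
    rewrite mulSn addnC -addn1 leq_add2l expn_gt0; apply/orP; left; lia.
  have X3 : 8 <= X ^ 3 by apply: leq_trans X8 _; rewrite -{1}[X]expn1 leq_exp2l //; lia.
  rewrite /S4 -[9]/(6 + 3) expnD.
  apply: leq_trans (_ : X ^ 6 * 8 <= _); last by rewrite leq_mul2l X3 orbT.
  by move: k2; move: (X ^ 6) (n * _) => P z; lia.
apply: leq_trans (leq_mul h1 (ltnW (parity_size_iter_le _ _ _))) _.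
rewrite (expnD X (1 + a)) (expnD X K1) leq_mul2l leq_mul ?orbT //.
apply: leq_trans (X2 K1); rewrite leq_exp2l // /K1 mulnAC leq_mul2r.
by apply/orP; right; rewrite mulnDl -mulnA leq_add2l; lia.
Qed.

End AC0.

(** * Bias of a sampled parity *)

Definition xorf (T : finType) (f g : {ffun T -> bool}) : {ffun T -> bool} :=
  [ffun x => f x (+) g x].

Lemma xorfK (T : finType) (g : {ffun T -> bool}) : involutive (xorf g).
Proof. by move=> f; apply/ffunP => x; rewrite !ffunE addbA addbb. Qed.

Lemma xorf_inj (T : finType) (g : {ffun T -> bool}) : injective (xorf g).
Proof. exact: inv_inj (xorfK g). Qed.

(* P maps a uniform point to a uniform point, because every translation of V lifts
   to a permutation of Y. *)
Lemma sum_translation (Y V : finType) (P : Y -> V) (add : V -> V -> V)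
    (F : V -> nat) :
  (forall d, exists2 t : Y -> Y, injective t & forall y, P (t y) = add (P y) d) ->
  (forall v, injective (add v)) ->
  #|V| * \sum_y F (P y) = #|Y| * \sum_v F v.
Proof.
move=> trans inj.
transitivity (\sum_d \sum_y F (add (P y) d)).
  rewrite -sum_nat_const; apply: eq_bigr => d _.
  have [t ti Pt] := trans d; rewrite (reindex_inj ti) /=.
  by apply: eq_bigr => y _; rewrite Pt.
rewrite exchange_big /= -sum_nat_const; apply: eq_bigr => y _.
by rewrite [RHS](reindex_inj (@inj (P y))).
Qed.

Section Round.
Variables (lm H n : nat) (z : nat -> bool).
Hypotheses (H_lm : H <= lm) (n_lm : n <= 2 ^ lm).

Local Notation Y := {ffun 'I_lm.+1 * 'I_lm.+1 -> bool}.
Local Notation V := {ffun 'I_lm -> bool}.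

Definition round_seed (y : Y) (h b : nat) : bool := y (inord h, inord b).

Definition position (y : Y) (w : nat) : V :=
  [ffun b : 'I_lm => odd (pos_sum H (round_seed y) w b)].

Definition lookup (p : V) : nat :=
  \sum_(0 <= v < n) z v * [forall b : 'I_lm, nat_bit v b == p b].

Definition level_count h (y : Y) : nat := \sum_(w < 2 ^ h) lookup (position y w).

Definition weight : nat := \sum_(0 <= v < n) z v.

Lemma lookupE y w :
  \sum_(0 <= v < n) z v * hits lm H (round_seed y) w v = lookup (position y w).
Proof.
apply: eq_bigr => v _; congr (_ * nat_of_bool _).
apply/hitsP/forallP => [Hb b|Hb b bl]; first by rewrite ffunE Hb.
by have /eqP := Hb (Ordinal bl); rewrite ffunE.
Qed.

Lemma round_sumE y : round_sum lm H n z (round_seed y) =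
  \sum_(h < H.+1) round_seed y h lm * level_count h y.
Proof.
rewrite /round_sum /coef big_mkord.
under eq_bigr => w _ do rewrite lookupE big_mkord big_distrl /=.
rewrite exchange_big /=; apply: eq_bigr => h _.
rewrite /level_count -(big_mkord xpredT (fun w => lookup (position y w))).
rewrite (big_nat_widen _ _ (2 ^ H)); last by rewrite leq_exp2l // -ltnS.
rewrite [in RHS]big_mkord [in RHS]big_mkcond [in RHS]big_distrr /=; apply: eq_bigr => w _.
have -> : (w %/ 2 ^ h == 0) = (w < 2 ^ h).
  by rewrite -leqn0 -ltnS ltn_divLR ?expn_gt0 // mul1n.
by case: ltnP => _; rewrite ?mul0n ?muln0 ?mul1n.
Qed.

Lemma lookup_sum : \sum_p lookup p = weight.
Proof.
rewrite exchange_big /=; apply: eq_bigr => v _; rewrite -big_distrr /=.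
rewrite (bigD1 [ffun b : 'I_lm => nat_bit v b]) //= big1 => [|p pv].
  rewrite (introT forallP) ?muln1 // => b; by rewrite ffunE.
apply/eqP; rewrite eqb0; apply: contra pv => /forallP Hb.
by apply/eqP/ffunP => b; rewrite ffunE (eqP (Hb b)).
Qed.

Lemma lookup_sq p : lookup p * lookup p = lookup p.
Proof.
suff -> : lookup p = has (fun v => z v && [forall b : 'I_lm, nat_bit v b == p b]) (iota 0 n).
  by rewrite mulnb andbb.
case: hasP => [[v0]|no]; last first.
  rewrite /lookup big1_seq // => v; rewrite mem_index_iota => /andP [_ /andP [_ vn]].
  rewrite mulnb; apply/eqP; rewrite eqb0; apply/negP => h; apply: no.
  by exists v; rewrite ?mem_iota.
rewrite mem_iota add0n /= => v0n /andP [zv0 /forallP hv0].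
rewrite /lookup (bigD1_seq v0) ?iota_uniq ?mem_index_iota //= zv0 (introT forallP hv0).
rewrite big1_seq // => v; rewrite mem_index_iota => /andP [vv0 /andP [_ vn]].
case: (boolP [forall b : 'I_lm, _]) => [/forallP hv|]; last by rewrite muln0.
case/eqP: vv0; apply: (@nat_bit_inj lm); rewrite ?(leq_trans _ n_lm) // => b bl.
by rewrite (eqP (hv (Ordinal bl))) (eqP (hv0 (Ordinal bl))).
Qed.

Lemma position_xor y d w : position (xorf d y) w = xorf (position y w) (position d w).
Proof.
apply/ffunP => b; rewrite !ffunE /pos_sum !oddD !oddb /round_seed ffunE.
have -> : odd (\sum_(0 <= h < H) nat_bit w h * xorf d y (inord h.+1, inord b)) =
   odd (\sum_(0 <= h < H) nat_bit w h * y (inord h.+1, inord b)) (+)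
   odd (\sum_(0 <= h < H) nat_bit w h * d (inord h.+1, inord b)).
  rewrite -oddD -big_split /=; elim/big_ind2: _ => // [p1 q1 p2 q2|h _].
    by rewrite !oddD => -> ->.
  by rewrite ffunE !oddD !mulnb !oddb; case: nat_bit => //=; rewrite addbC.
by case: (y _); case: (d _); case: (odd _); case: (odd _).
Qed.

Definition two_rows (h : nat) (d0 d1 : V) : Y :=
  [ffun p : 'I_lm.+1 * 'I_lm.+1 =>
  if (insub (val p.2) : option 'I_lm) is Some b then
    if val p.1 == 0 then d0 b else if val p.1 == h.+1 then d1 b else false
  else false].

Lemma position_two_rows h d0 d1 w :
  position (two_rows h d0 d1) w =
  [ffun b => d0 b (+) [&& h < H, nat_bit w h & d1 b]].
Proof.
apply/ffunP => b; rewrite !ffunE /pos_sum oddD oddb.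
have E h' : h' <= lm -> round_seed (two_rows h d0 d1) h' b =
    if h' == 0 then d0 b else if h' == h.+1 then d1 b else false.
  move=> hl; rewrite /round_seed /two_rows ffunE /= !inordK ?ltnS // 1?ltnW //.
  by rewrite valK.
rewrite E //; congr addb.
have H0 h' : h' < H -> h' != h ->
    nat_bit w h' * round_seed (two_rows h d0 d1) h'.+1 b = 0.
  by move=> h'H h'h; rewrite E ?(leq_trans h'H) //= eqSS (negbTE h'h) muln0.
case: ltnP => hH /=.
  rewrite (bigD1_seq h) ?iota_uniq ?mem_index_iota //= E ?(leq_trans hH) //=.
  rewrite eqxx big1_seq => [|h']; first by rewrite addn0 mulnb oddb.
  by rewrite mem_index_iota => /andP [h'h /andP [_ h'H]]; exact: H0.
rewrite big1_seq // => h'; rewrite mem_index_iota => /andP [_ /andP [_ h'H]].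
by apply: H0 => //; rewrite neq_ltn (leq_trans h'H).
Qed.

Lemma position_uniform w : #|V| * \sum_y lookup (position y w) = #|{: Y}| * weight.
Proof.
rewrite -lookup_sum; apply: (@sum_translation _ _ (fun y => position y w) (@xorf _)).
  move=> d; exists (xorf (two_rows H d d)); first exact: xorf_inj.
  move=> y; rewrite position_xor position_two_rows ltnn /=; congr xorf.
  by apply/ffunP => b; rewrite ffunE addbF.
by move=> v; exact: xorf_inj.
Qed.

Lemma position_uniform2 w w' : w < 2 ^ H -> w' < 2 ^ H -> w != w' ->
  #|V| ^ 2 * \sum_y lookup (position y w) * lookup (position y w') =
  #|{: Y}| * weight ^ 2.
Proof.
move=> wH wH' ww'.
have /existsP [[h hH] /= hb] : [exists h : 'I_H, nat_bit w h != nat_bit w' h].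
  apply: contraNT ww' => /existsPn Hno; apply/eqP.
  apply: (nat_bit_inj wH wH') => h hH.
  by apply/eqP; move: (Hno (Ordinal hH)); rewrite negbK.
pose add (v d : V * V) := (xorf v.1 d.1, xorf v.2 d.2).
have := @sum_translation _ _ (fun y => (position y w, position y w')) add
  (fun v => lookup v.1 * lookup v.2).
rewrite card_prod mulnn => ->.
- congr (_ * _); rewrite -lookup_sum expnS expn1 big_distrlr /= pair_big /=.
  by apply: eq_bigr => -[].
- case=> d d' /=.
  (* Exactly one of w, w' has bit h set and sees row h + 1. The other one is moved by row 0 alone,
     and row h + 1 supplies the difference of the two wanted shifts. *)
  pose dd := if nat_bit w h then two_rows h d' (xorf d d') else two_rows h d (xorf d d').
  exists (xorf dd); first exact: xorf_inj.
  have Ew' : nat_bit w' h = ~~ nat_bit w h by case: (nat_bit w h) (nat_bit w' h) hb => -[].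
  have Ed : position dd w = d.
    apply/ffunP => b; rewrite /dd; case: ifP => Eb; rewrite position_two_rows !ffunE hH Eb /=;
      by case: (d b); case: (d' b).
  have Ed' : position dd w' = d'.
    apply/ffunP => b; rewrite /dd; case: ifP => Eb;
      rewrite position_two_rows !ffunE hH Ew' Eb /=; by case: (d b); case: (d' b).
  by move=> y; rewrite !position_xor Ed Ed'.
- by move=> [v v'] [d d'] [d1 d1'] /= [/xorf_inj -> /xorf_inj ->].
Qed.


Lemma card_V : #|V| = 2 ^ lm.
Proof. by rewrite card_ffun card_bool card_ord. Qed.

Section Bias.
Variable R : realFieldType.
Local Open Scope ring_scope.

(** Flipping the coefficient of level h, on which no position depends, changes the sign exactly when
    that level has an odd count; those seeds cancel in pairs. *)
Lemma even_level_sum h : (h <= H)%N ->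
  `|\sum_(y : Y) (-1) ^+ round_sum lm H n z (round_seed y)| <=
  (\sum_(y : Y) ~~ odd (level_count h y))%:R :> R.
Proof.
move=> hH; pose D : Y := [ffun p => p == (inord h, inord lm)].
have posD w : position D w = [ffun=> false].
  apply/ffunP => b; rewrite !ffunE /pos_sum big1_seq => [|h' _].
    rewrite /round_seed ffunE xpair_eqE [inord b == _](_ : _ = false) ?andbF //.
    by rewrite -val_eqE /= !inordK // ?ltn_eqF // ltnW // ltnS.
  rewrite /round_seed ffunE xpair_eqE [inord b == _](_ : _ = false) ?andbF ?muln0 //.
  by rewrite -val_eqE /= !inordK // ?ltn_eqF // ltnW // ltnS.
have posxD y w : position (xorf D y) w = position y w.
  rewrite position_xor posD; apply/ffunP => b; by rewrite !ffunE addbF.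
have lvD h' y : level_count h' (xorf D y) = level_count h' y.
  by apply: eq_bigr => w _; rewrite posxD.
have sgD y : (-1) ^+ round_sum lm H n z (round_seed (xorf D y)) =
    (-1) ^+ level_count h y * (-1) ^+ round_sum lm H n z (round_seed y) :> R.
  rewrite -signr_odd -[X in _ = X * _]signr_odd -[X in _ = _ * X]signr_odd -signr_addb.
  congr (_ ^+ nat_of_bool _); rewrite !round_sumE -oddD.
  have hlt : (h < H.+1)%N by [].
  rewrite (bigD1 (Ordinal hlt)) //= [in RHS](bigD1 (Ordinal hlt)) //=.
  rewrite addnA !oddD; congr addb; last first.
    congr odd; apply: eq_bigr => h' h'h; rewrite lvD; congr (nat_of_bool _ * _)%N.
    rewrite /round_seed ffunE [D _](_ : _ = false) // ffunE xpair_eqE.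
    apply/negbTE; rewrite negb_and -val_eqE /= !inordK ?ltnS ?(leq_trans hH) //.
      by rewrite -[_ == h]/(h' == Ordinal hlt) h'h.
    by apply: leq_trans H_lm; rewrite -ltnS.
  rewrite lvD /round_seed ffunE [D _](_ : _ = true); last by rewrite ffunE eqxx.
  rewrite !oddM !oddb; by case: (y _); case: (odd _).
pose sg y : R := (-1) ^+ round_sum lm H n z (round_seed y).
have S0 : \sum_(y : Y | odd (level_count h y)) sg y = 0.
  suff E : \sum_(y : Y | odd (level_count h y)) sg y =
           - \sum_(y : Y | odd (level_count h y)) sg y by lra.
  rewrite {1}(reindex_inj (@xorf_inj _ D)) /= -sumrN.
  rewrite (eq_bigl (fun y => odd (level_count h y))) => [|y]; last by rewrite lvD.
  by apply: eq_bigr => y od; rewrite /sg sgD -signr_odd od expr1 mulN1r.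
rewrite -/(sg _) (bigID (fun y => odd (level_count h y))) /= S0 add0r natr_sum.
apply: le_trans (ler_norm_sum _ _ _) _.
rewrite big_mkcond /=; apply: ler_sum => y _.
by case: (odd _) => //=; rewrite normrX normrN1 expr1n.
Qed.

(** For every natural number k, the indicator of k being odd is at least 2k - k^2. Both moments are
    exact, by pairwise independence and because [lookup] takes only the values 0 and 1. *)
Lemma odd_level_many h : (h <= H)%N ->
  #|{: Y}|%:R * ((2 ^ h)%:R * (weight%:R / (2 ^ lm)%:R) -
    (2 ^ h)%:R * ((2 ^ h)%:R - 1) * (weight%:R / (2 ^ lm)%:R) ^+ 2) <=
  (\sum_(y : Y) odd (level_count h y))%:R :> R.
Proof.
move=> hH; set T := (2 ^ h)%:R; set t := _ / _.
have M0 : (2 ^ lm)%:R != 0 :> R by rewrite pnatr_eq0 -lt0n expn_gt0.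
have u1 w : (\sum_(y : Y) lookup (position y w))%:R = #|{: Y}|%:R * t.
  have := congr1 (fun k => k%:R : R) (position_uniform w).
  rewrite card_V !natrM => E; rewrite /t; apply: (mulfI M0); rewrite E; field.
  exact: M0.
have lt_w (w : 'I_(2 ^ h)) : (w < 2 ^ H)%N.
  by apply: leq_trans (ltn_ord w) _; rewrite leq_exp2l.
have u2 (w w' : 'I_(2 ^ h)) : w != w' ->
    (\sum_(y : Y) lookup (position y w) * lookup (position y w'))%:R = #|{: Y}|%:R * t ^+ 2.
  move=> ww'; have := congr1 (fun k => k%:R : R) (position_uniform2 (lt_w w) (lt_w w') ww').
  rewrite card_V !natrM !natrX => E; rewrite /t.
  apply: (mulfI (expf_neq0 2 M0)); rewrite natrX E; field.
  by rewrite -natrX.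
have s1 : (\sum_(y : Y) level_count h y)%:R = #|{: Y}|%:R * (T * t).
  rewrite exchange_big /= natr_sum (eq_bigr (fun=> #|{: Y}|%:R * t)) => [|w _]; last exact: u1.
  by rewrite sumr_const card_ord -mulr_natl -/T; ring.
have s2 : (\sum_(y : Y) level_count h y * level_count h y)%:R =
    #|{: Y}|%:R * (T * t + T * (T - 1) * t ^+ 2).
  under eq_bigr => y _ do rewrite big_distrlr /=.
  rewrite exchange_big /= natr_sum.
  rewrite (eq_bigr (fun=> #|{: Y}|%:R * (t + (T - 1) * t ^+ 2))) => [|w _].
    by rewrite sumr_const card_ord -mulr_natl -/T; ring.
  rewrite exchange_big /= (bigD1 w) //= natrD.
  rewrite (eq_bigr _ (fun y _ => lookup_sq (position y w))).
  rewrite u1 natr_sum (eq_bigr (fun=> #|{: Y}|%:R * t ^+ 2)) => [|w' w'w]; last by apply: u2; rewrite eq_sym.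
  have cw : T = (#|[pred w' : 'I_(2 ^ h) | w' != w]|.+1)%:R.
    rewrite /T -[in LHS](card_ord (2 ^ h)) (cardD1 w) inE add1n; congr (_.+1%:R).
    by apply: eq_card => i; rewrite !inE andbT.
  by rewrite sumr_const -mulr_natl cw -natr1; ring.
have -> : #|{: Y}|%:R * (T * t - T * (T - 1) * t ^+ 2) =
    2 * (\sum_(y : Y) level_count h y)%:R -
    (\sum_(y : Y) level_count h y * level_count h y)%:R by rewrite s1 s2; ring.
rewrite !natr_sum mulr_sumr -sumrB; apply: ler_sum => y _.
move: (level_count h y) => k; rewrite natrM.
case: k => [|[|[|k]]]; rewrite ?odd0 /=; try lra.
apply: le_trans (ler0n _ _).
have : (3%:R : R) <= k.+3%:R by rewrite ler_nat.
by move: (k.+3%:R : R) => r; nra.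
Qed.

Lemma round_bias : (2 ^ lm <= 2 ^ (H + 2) * weight)%N ->
  `|\sum_(y : Y) (-1) ^+ round_sum lm H n z (round_seed y)| <=
  13 / 16 * #|{: Y}|%:R :> R.
Proof.
move=> far.
suff [h hH Hh] : exists2 h, (h <= H)%N &
    3 / 16 * #|{: Y}|%:R <= (\sum_(y : Y) odd (level_count h y))%:R :> R.
  apply: le_trans (even_level_sum hH) _.
  have : (\sum_(y : Y) ~~ odd (level_count h y))%:R +
         (\sum_(y : Y) odd (level_count h y))%:R = #|{: Y}|%:R :> R.
    rewrite -natrD -big_split /= -sum1_card; congr _%:R.
    by apply: eq_bigr => y _; case: (odd _).
  by lra.
have exh : exists h, (2 ^ lm <= 2 ^ (h + 2) * weight)%N by exists H.
case: (ex_minnP exh) => h hfar hmin.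
have hH : (h <= H)%N by exact: hmin.
exists h => //; apply: le_trans (odd_level_many hH).
rewrite mulrC; apply: ler_wpM2l; first exact: ler0n.
have M0 : 0 < (2 ^ lm)%:R :> R by rewrite ltr0n expn_gt0.
set t := weight%:R / _; have t0 : 0 <= t by rewrite divr_ge0 ?ler0n.
have tE : (2 ^ lm)%:R * t = weight%:R by rewrite /t mulrC divfK // gt_eqF.
have hf : 1 / 4 <= (2 ^ h)%:R * t.
  rewrite -(ler_pM2l M0); move: hfar; rewrite -(ler_nat R) expnD (_ : (2 ^ 2 = 4)%N) // !natrM -tE.
  by move: ((2 ^ h)%:R : R) ((2 ^ lm)%:R : R) M0 => T M M0; nra.
(* Level 0 has one point and no collision term, so the lower bound 1/4 suffices. At a positive
   level, minimality bounds the expected count s by 1/2, and s - s^2 >= 3/16 on [1/4, 1/2]. *)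
case: h hfar hmin hH hf => [|h] hfar hmin hH hf; first by lra.
have hl : (2 ^ h.+1)%:R * t <= 1 / 2.
  have lt : (2 ^ (h + 2) * weight < 2 ^ lm)%N.
    by rewrite ltnNge; apply/negP => /hmin; rewrite ltnn.
  move: lt; rewrite -(ltr_nat R) expnD (_ : (2 ^ 2 = 4)%N) // !natrM -tE => lt.
  rewrite -(ler_pM2l M0) expnS natrM; move: lt.
  by move: ((2 ^ h)%:R : R) ((2 ^ lm)%:R : R) M0 => T M M0; nra.
have T1 : 1 <= (2 ^ h.+1)%:R :> R by rewrite ler1n expn_gt0.
have : 0 <= (2 ^ h.+1)%:R * t ^+ 2 by rewrite mulr_ge0 ?ler0n ?sqr_ge0.
move: ((2 ^ h.+1)%:R : R) T1 hf hl => T T1 hf hl p0.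
rewrite (_ : T * t - T * (T - 1) * t ^+ 2 = T * t - (T * t) ^+ 2 + T * t ^+ 2); last by ring.
by move: (T * t) hf hl => s hf hl; nra.
Qed.

End Bias.
End Round.

Local Open Scope ring_scope.

(** * Extracting many bits from a design *)

Section Hybrid.
Variables (R : realType) (T : finType) (X : T -> R).

Definition mass (A : pred T) : R := \sum_(x | A x) X x.

Lemma mass_signed (A : pred T) (g : T -> bool) b :
  mass [pred x | A x & g x == b] =
  (mass A + (-1) ^+ b * \sum_(x | A x) X x * (-1) ^+ g x) / 2.
Proof.
rewrite /mass (bigID g) /= [\sum_(x | A x) X x](bigID g) /= [\sum_(x | A x) _ * _](bigID g) /=.
rewrite [\sum_(i | A i && g i) _ * _](eq_bigr (fun x => - X x)) => [|x /andP [_ ->]]; last first.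
  by rewrite expr1 mulrN1.
rewrite [\sum_(i | A i && ~~ g i) _ * _](eq_bigr X) => [|x /andP [_ /negbTE ->]]; last first.
  by rewrite expr0 mulr1.
rewrite sumrN; case: b.
  rewrite (eq_bigl (fun x => A x && g x)) => [|x]; last by case: (A x); case: (g x).
  rewrite [X in _ + X]big_pred0 => [|x]; last by case: (A x); case: (g x).
  by rewrite expr1; lra.
rewrite [X in X + _]big_pred0 => [|x]; last by case: (A x); case: (g x).
rewrite [X in _ + X](eq_bigl (fun x => A x && ~~ g x)) => [|x]; last by case: (A x); case: (g x).
by rewrite expr0; lra.
Qed.

Lemma big_rcons_tuple i (F : i.+1.-tuple bool -> R) :
  \sum_w F w = \sum_(w : i.-tuple bool) \sum_(b : bool) F [tuple of rcons w b].
Proof.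
have bij : bijective (fun p : i.-tuple bool * bool => [tuple of rcons p.1 p.2]).
  apply: inj_card_bij => [[w b] [w' b'] /(congr1 val) /= /rcons_inj [Ew ->]|].
    by congr pair; exact: val_inj.
  by rewrite card_prod !card_tuple card_bool -expnSr.
by rewrite pair_big /= (reindex _ (onW_bij _ bij)).
Qed.

(** Exposing one more bit splits a prefix of mass A into (A + S) / 2 and (A - S) / 2 with S the
    signed sum, so the total deviation grows by at most |S|. Signed sums replace conditional biases
    and avoid dividing by the mass of a prefix. *)
Lemma hybrid m (E : T -> seq bool) : (forall x, size (E x) = m) ->
  \sum_x X x = 1 ->
  \sum_(w : m.-tuple bool) `|mass [pred x | E x == w :> seq bool] - (2 ^+ m)^-1| <=
  \sum_(i < m) \sum_(w : i.-tuple bool)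
    `|\sum_(x | take i (E x) == w) X x * (-1) ^+ nth false (E x) i|.
Proof.
move=> szE X1.
suff H i : (i <= m)%N ->
    \sum_(w : i.-tuple bool) `|mass [pred x | take i (E x) == w] - (2 ^+ i)^-1| <=
    \sum_(j < i) \sum_(w : j.-tuple bool)
      `|\sum_(x | take j (E x) == w) X x * (-1) ^+ nth false (E x) j|.
  apply: le_trans (H m (leqnn _)); apply: ler_sum => w _; rewrite le_eqVlt; apply/orP; left.
  apply/eqP; congr `|_ - _|; apply: eq_bigl => x /=.
  by rewrite take_oversize // szE.
elim: i => [|i IH] im.
  rewrite big_ord0 big1 // => w _; rewrite expr0 invr1 /mass.
  rewrite (eq_bigl xpredT) => [|x /=]; last by rewrite take0 tuple0.
  by rewrite X1 subrr normr0.
rewrite big_ord_recr /=; apply: le_trans (lerD (IH (ltnW im)) (lexx _)).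
rewrite big_rcons_tuple -big_split /=; apply: ler_sum => w _.
set S := \sum_(x | _) _ * _; set A := mass _.
have E1 b : mass [pred x | take i.+1 (E x) == rcons w b] - (2 ^+ i.+1)^-1 =
    ((A - (2 ^+ i)^-1) + (-1) ^+ b * S) / 2.
  have -> : mass [pred x | take i.+1 (E x) == rcons w b] =
     mass [pred x | (take i (E x) == w) & nth false (E x) i == b].
    apply: eq_bigl => x /=; rewrite (take_nth false) ?szE // eqseq_rcons.
    by [].
  rewrite (mass_signed [pred x | take i (E x) == w] (fun x => nth false (E x) i)) -/A -/S.
  rewrite exprS invfM; lra.
rewrite big_bool /= !E1 expr1 expr0.
have n1 : `|(A - (2 ^+ i)^-1 + -1 * S) / 2| <= (`|A - (2 ^+ i)^-1| + `|S|) / 2.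
  rewrite normrM (ger0_norm (_ : 0 <= 2^-1)) ?invr_ge0 // ler_pM2r ?invr_gt0 //.
  by rewrite mulN1r; apply: ler_normB.
have n2 : `|(A - (2 ^+ i)^-1 + 1 * S) / 2| <= (`|A - (2 ^+ i)^-1| + `|S|) / 2.
  rewrite normrM (ger0_norm (_ : 0 <= 2^-1)) ?invr_ge0 // ler_pM2r ?invr_gt0 //.
  by rewrite mul1r; apply: ler_normD.
by move: n1 n2; lra.
Qed.

(** Refining a partition can only increase the sum of absolute values, by the triangle inequality.
    It serves to pass from prefixes of the output to truth tables. *)
Lemma sum_norm_refine (A W : finType) (k : T -> A) (w : T -> W) (a : T -> R) :
  (forall x x', k x = k x' -> w x = w x') ->
  \sum_v `|\sum_(x | w x == v) a x| <= \sum_q `|\sum_(x | k x == q) a x|.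
Proof.
move=> kw.
apply: le_trans (_ : \sum_v \sum_q `|\sum_(x | (w x == v) && (k x == q)) a x| <= _).
  apply: ler_sum => v _; rewrite (partition_big k xpredT) //=.
  exact: ler_norm_sum.
rewrite exchange_big /=; apply: ler_sum => q _.
have [x0 /eqP kx0|none] := pickP (fun x => k x == q); last first.
  rewrite big1 ?normr_ge0 // => v _; rewrite big_pred0 ?normr0 // => x.
  by rewrite none andbF.
rewrite (bigD1 (w x0)) //= [X in _ + X]big1 => [|v vw]; last first.
  rewrite big_pred0 ?normr0 // => x; apply/negP => /andP [/eqP wx /eqP kx].
  by case/eqP: vw; rewrite -wx; apply: kw; rewrite kx.
rewrite addr0 le_eqVlt; apply/orP; left; apply/eqP; congr `|_|.
apply: eq_bigl => x; apply/andP/idP => [[] //|/eqP kx]; split; last exact/eqP.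
by apply/eqP; apply: kw; rewrite kx.
Qed.

End Hybrid.

(** * Correlation with a function under a source with few near pairs *)

Section Pairs.
Variables (R : realType) (T Y : finType) (X : T -> R) (f : T -> Y -> bool).
Variables (near : rel T) (eta gam : R).
Hypotheses (X0 : forall x, 0 <= X x) (X1 : \sum_x X x = 1).
Hypotheses (eta0 : 0 <= eta) (gam0 : 0 <= gam).
Hypothesis near_small : forall x, \sum_(x' | near x x') X x' <= eta ^+ 2.
Hypothesis far_bias : forall x x', ~~ near x x' ->
  \sum_y (-1) ^+ f x y * (-1) ^+ f x' y <= gam ^+ 2 * #|Y|%:R.

Lemma sum_sqr_le (I : finType) (F : I -> R) :
  (\sum_i F i) ^+ 2 <= #|I|%:R * \sum_i F i ^+ 2.
Proof.
have H : 0 <= \sum_i \sum_j (F i - F j) ^+ 2.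
  by apply: sumr_ge0 => i _; apply: sumr_ge0 => j _; exact: sqr_ge0.
have E : \sum_i \sum_j (F i - F j) ^+ 2 =
    2 * (#|I|%:R * \sum_i F i ^+ 2 - (\sum_i F i) ^+ 2).
  under eq_bigr => i _ do
    (under eq_bigr => j _ do rewrite sqrrB; rewrite big_split /= sumrB sumr_const -mulr_natl).
  rewrite big_split /= sumrB sumr_const -mulr_natl -mulr_sumr.
  have -> : \sum_i \sum_j F i * F j *+ 2 = 2 * (\sum_i F i) ^+ 2.
    rewrite expr2 mulr_suml mulr_sumr; apply: eq_bigr => i _.
    by rewrite mulr_sumr mulr_sumr; apply: eq_bigr => j _; rewrite -mulr_natl.
  by rewrite -/(#|I|); ring.
by move: H; rewrite E pmulr_rge0 // subr_ge0.
Qed.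

(** The expanded square is a sum over pairs of samples in K: near pairs contribute at most eta^2,
    far pairs at most mass(K)^2 gam^2. The factor mass(K)^2 is kept for the summation over
    classes. *)
Lemma second_moment (K : pred T) :
  \sum_y (\sum_(x | K x) X x * (-1) ^+ f x y) ^+ 2 <=
  #|Y|%:R * (eta + mass X K * gam) ^+ 2.
Proof.
have P0 : 0 <= mass X K by apply: sumr_ge0.
have P1 : mass X K <= 1.
  by rewrite -X1 [X in _ <= X](bigID K) /= lerDl; apply: sumr_ge0.
apply: le_trans (_ : #|Y|%:R * (eta ^+ 2 + mass X K ^+ 2 * gam ^+ 2) <= _); last first.
  apply: ler_wpM2l; first exact: ler0n.
  have : 0 <= eta * (mass X K * gam) by rewrite !mulr_ge0.
  by nra.
have -> : \sum_y (\sum_(x | K x) X x * (-1) ^+ f x y) ^+ 2 =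
    \sum_(x | K x) \sum_(x' | K x') X x * X x' * \sum_y (-1) ^+ f x y * (-1) ^+ f x' y.
  under eq_bigr => y _ do rewrite expr2 big_distrlr /=.
  rewrite exchange_big /=; apply: eq_bigr => x _; rewrite exchange_big /=.
  apply: eq_bigr => x' _; rewrite mulr_sumr; apply: eq_bigr => y _; ring.
have bnd x x' : \sum_y (-1) ^+ f x y * (-1) ^+ f x' y <=
    #|Y|%:R * ((near x x')%:R + gam ^+ 2).
  have g2 : 0 <= gam ^+ 2 by exact: sqr_ge0.
  case: (boolP (near x x')) => [_|/far_bias H]; last by rewrite add0r mulrC.
  apply: le_trans (_ : #|Y|%:R <= _).
    rewrite -sumr_const; apply: ler_sum => y _; rewrite -signr_addb; case: (_ (+) _) => //.
    by rewrite expr1; lra.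
  rewrite -[X in X <= _]mulr1; apply: ler_wpM2l; first exact: ler0n.
  by rewrite [true%:R]mulr1n; lra.
apply: le_trans (_ : \sum_(x | K x) \sum_(x' | K x') X x * X x' *
    (#|Y|%:R * ((near x x')%:R + gam ^+ 2)) <= _).
  apply: ler_sum => x _; apply: ler_sum => x' _; apply: ler_wpM2l (bnd x x').
  exact: mulr_ge0.
have -> : \sum_(x | K x) \sum_(x' | K x') X x * X x' *
    (#|Y|%:R * ((near x x')%:R + gam ^+ 2)) =
    #|Y|%:R * (\sum_(x | K x) X x * (\sum_(x' | K x') X x' * (near x x')%:R)
      + mass X K ^+ 2 * gam ^+ 2).
  have -> : mass X K ^+ 2 * gam ^+ 2 =
      \sum_(x | K x) \sum_(x' | K x') X x * X x' * gam ^+ 2.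
    rewrite /mass expr2 big_distrlr /= mulr_suml; apply: eq_bigr => x _.
    by rewrite mulr_suml.
  rewrite -big_split mulr_sumr; apply: eq_bigr => x _.
  rewrite mulr_sumr -big_split mulr_sumr; apply: eq_bigr => x' _ /=; ring.
apply: ler_wpM2l; first exact: ler0n.
rewrite lerD2r; apply: le_trans (_ : \sum_(x | K x) X x * eta ^+ 2 <= _).
  apply: ler_sum => x _; apply: ler_wpM2l => //; apply: le_trans (near_small x).
  rewrite [X in _ <= X]big_mkcond [X in X <= _]big_mkcond; apply: ler_sum => x' _.
  by case: (K x'); case: (near x x'); rewrite ?mulr1 ?mulr0.
by rewrite -mulr_suml -/(mass X K) -[X in _ <= X]mul1r ler_wpM2r ?sqr_ge0.
Qed.

Lemma first_moment (K : pred T) :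
  \sum_y `|\sum_(x | K x) X x * (-1) ^+ f x y| <= #|Y|%:R * (eta + mass X K * gam).
Proof.
have P0 : 0 <= mass X K by apply: sumr_ge0.
have rhs0 : 0 <= #|Y|%:R * (eta + mass X K * gam).
  by rewrite mulr_ge0 ?ler0n // addr_ge0 // mulr_ge0.
rewrite -(@ler_pXn2r _ 2) // ?nnegrE //; last by apply: sumr_ge0.
apply: le_trans (sum_sqr_le _) _.
under eq_bigr => y _ do rewrite real_normK ?num_real //.
rewrite exprMn [X in _ <= X * _]expr2 -mulrA ler_wpM2l ?ler0n //.
exact: second_moment.
Qed.

(** Over the classes of a partition the masses add up to 1, so gam is paid once, while eta is paid
    once per class. *)
Lemma refined_moment (A : finType) (k : T -> A) (D : {set A}) :
  (forall x, k x \in D) ->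
  \sum_y \sum_q `|\sum_(x | k x == q) X x * (-1) ^+ f x y| <=
  #|Y|%:R * (#|D|%:R * eta + gam).
Proof.
move=> kD; rewrite exchange_big /=.
apply: le_trans (_ : \sum_(q in D) #|Y|%:R * (eta + mass X [pred x | k x == q] * gam) <= _).
  rewrite [X in _ <= X]big_mkcond; apply: ler_sum => q _; case: ifP => qD.
    exact: first_moment.
  rewrite big1 // => y _; rewrite big_pred0 ?normr0 // => x.
  by apply: contraFF qD => /eqP <-.
rewrite -mulr_sumr big_split /= sumr_const -mulr_suml -(mulr_natl eta) ler_wpM2l ?ler0n //.
rewrite lerD2l -[X in _ <= X]mul1r ler_wpM2r // -X1 (partition_big k (mem D)) //=.
Qed.

End Pairs.

(** * The Nisan-Wigderson argument *)

Section NW.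
Variables (R : realType) (n d m : nat) (U : finType).
Variables (idx : 'I_m -> U -> 'I_d).
Variable (f : n.-tuple bool -> {ffun U -> bool} -> bool).
Local Notation T := (n.-tuple bool).
Local Notation Y := {ffun U -> bool}.

Definition sub_seed (r : d.-tuple bool) (j : 'I_m) : Y := [ffun u => tnth r (idx j u)].

Definition nw_ext (x : T) (r : d.-tuple bool) : m.-tuple bool :=
  [tuple f x (sub_seed r j) | j < m].

Definition resample (i : 'I_m) (r : d.-tuple bool) (y : Y) : d.-tuple bool :=
  [tuple if [pick u | idx i u == p] is Some u then y u else tnth r p | p < d].

Definition overlap (i j : 'I_m) : {set U} := [set u | [exists u', idx j u' == idx i u]].

Hypothesis idx_inj : forall j, injective (idx j).

Lemma sub_seed_resample i r y : sub_seed (resample i r y) i = y.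
Proof.
apply/ffunP => u; rewrite ffunE tnth_mktuple.
by case: pickP => [u' /eqP /idx_inj ->|/(_ u)]; rewrite ?eqxx.
Qed.

Lemma resampleK i r y : resample i (resample i r y) (sub_seed r i) = r.
Proof.
apply: eq_from_tnth => p; rewrite !tnth_mktuple.
by case: pickP => [u /eqP <-|//]; rewrite ffunE.
Qed.

(** Exchanging y with the seed bits that it replaces is an involution on the pairs (r, y). *)
Lemma sum_resample i (F : d.-tuple bool -> R) :
  #|{: Y}|%:R * \sum_r F r = \sum_r \sum_(y : Y) F (resample i r y).
Proof.
pose sw (p : d.-tuple bool * Y) := (resample i p.1 p.2, sub_seed p.1 i).
have swK : involutive sw.
  by case=> r y; rewrite /sw /= resampleK sub_seed_resample.
rewrite [RHS]pair_big /= (reindex_inj (inv_inj swK)) /=.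
rewrite (eq_bigr (fun p => F p.1)) => [|[r y] _ /=]; last by rewrite resampleK.
rewrite -(pair_big xpredT xpredT (fun r (_ : Y) => F r)) /= mulr_sumr.
by apply: eq_bigr => r _; rewrite sumr_const mulr_natl.
Qed.

Lemma sub_seed_overlap i j r (y y' : Y) : {in overlap i j, y =1 y'} ->
  sub_seed (resample i r y) j = sub_seed (resample i r y') j.
Proof.
move=> yy'; apply/ffunP => u; rewrite !ffunE !tnth_mktuple.
case: pickP => [u' /eqP E|//]; apply: yy'; rewrite inE; apply/existsP; exists u.
by rewrite E.
Qed.

(** An entry is an earlier bit together with an assignment of the shared seed bits, coded as the set
    of those equal to true. *)
Definition table_dom (i : 'I_m) : {set 'I_m * {set U}} :=
  [set q : 'I_m * {set U} | (q.1 < i)%N && (q.2 \subset overlap i q.1)].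

(* The truth tables of all the output bits before i, as functions of the seed
   bits they share with bit i. *)
Definition table (i : 'I_m) r (x : T) : {set 'I_m * {set U}} :=
  [set q : 'I_m * {set U} in table_dom i |
     f x (sub_seed (resample i r [ffun u => u \in q.2]) q.1)].

Lemma table_prefix i r y x x' : table i r x = table i r x' ->
  take i (nw_ext x (resample i r y)) = take i (nw_ext x' (resample i r y)).
Proof.
move=> tt; apply: (@eq_from_nth _ false); first by rewrite !size_takel ?size_tuple // ltnW.
move=> j; rewrite size_takel ?size_tuple; last exact/ltnW.
move=> ji.
have jm : (j < m)%N by exact: ltn_trans ji (ltn_ord i).
rewrite !nth_take // -!(tnth_nth false _ (Ordinal jm)) !tnth_mktuple.
set y' : Y := [ffun u => u \in [set u in overlap i (Ordinal jm) | y u]].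
have -> : sub_seed (resample i r y) (Ordinal jm) = sub_seed (resample i r y') (Ordinal jm).
  by apply: sub_seed_overlap => u uo; rewrite ffunE inE uo.
move/setP: tt => /(_ (Ordinal jm, [set u in overlap i (Ordinal jm) | y u])).
rewrite !inE /= ji /=.
by have -> : [set u in overlap i (Ordinal jm) | y u] \subset overlap i (Ordinal jm)
  by apply/fintype.subsetP => u; rewrite inE => /andP [].
Qed.

Lemma card_table_dom i :
  #|table_dom i| = (\sum_(j < m | (j < i)%N) 2 ^ #|overlap i j|)%N.
Proof.
rewrite -sum1_card (eq_bigl (fun q : 'I_m * {set U} =>
  (q.1 < i)%N && (q.2 \in powerset (overlap i q.1)))) => [|q]; last by rewrite !inE.
rewrite -(pair_big_dep (fun j : 'I_m => (j < i)%N)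
  (fun j (S : {set U}) => S \in powerset (overlap i j)) (fun _ _ => 1%N)) /=.
by apply: eq_bigr => j _; rewrite sum1_card card_powerset.
Qed.

Variable X : {ffun T -> R}.
Hypothesis distX : is_dist X.
Variables (near : rel T) (eta gam : R) (Delta : nat).
Hypotheses (eta0 : 0 <= eta) (gam0 : 0 <= gam).
Hypothesis near_small : forall x, \sum_(x' | near x x') X x' <= eta ^+ 2.
Hypothesis far_bias : forall x x', ~~ near x x' ->
  \sum_(y : Y) (-1) ^+ f x y * (-1) ^+ f x' y <= gam ^+ 2 * #|{: Y}|%:R.
Hypothesis overlap_small : forall i : 'I_m,
  (\sum_(j < m | (j < i)%N) 2 ^ #|overlap i j| <= Delta)%N.

Let X0 x : 0 <= X x. Proof. by case: distX. Qed.
Let X1 : \sum_x X x = 1. Proof. by case: distX. Qed.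

Definition next_bit_bias (i : 'I_m) (r : d.-tuple bool) : R :=
  \sum_(w : i.-tuple bool)
    `|\sum_(x | take i (nw_ext x r) == w) X x * (-1) ^+ nth false (nw_ext x r) i|.

(** For fixed r the table does not depend on y, yet it determines the prefix for every y. Hence the
    classes may be taken by table, before y is averaged out. *)
Lemma next_bit_bias_resample i r :
  \sum_(y : Y) next_bit_bias i (resample i r y) <=
  #|{: Y}|%:R * ((2 ^ Delta)%:R * eta + gam).
Proof.
apply: le_trans (_ : \sum_(y : Y) \sum_q `|\sum_(x | table i r x == q) X x * (-1) ^+ f x y| <= _).
  apply: ler_sum => y _; rewrite /next_bit_bias.
  have sz x : size (take i (nw_ext x (resample i r y))) == i.
    by rewrite size_takel ?size_tuple // ltnW.
  have := @sum_norm_refine R T _ _ (table i r) (fun x => Tuple (sz x))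
    (fun x => X x * (-1) ^+ f x y).
  move=> /(_ _) H; apply: le_trans (H _); last first.
    by move=> x x' E; apply: val_inj => /=; exact: table_prefix.
  rewrite le_eqVlt; apply/orP; left; apply/eqP; apply: eq_bigr => w _; congr `|_|.
  apply: eq_bigr => x _; rewrite -(tnth_nth false _ i) tnth_mktuple.
  by rewrite sub_seed_resample.
apply: le_trans (refined_moment X0 X1 eta0 gam0 near_small far_bias
  (D := powerset (table_dom i)) _) _.
  by move=> x; rewrite powersetE; apply/fintype.subsetP => q; rewrite inE => /andP [].
apply: ler_wpM2l; first exact: ler0n.
rewrite lerD2r card_powerset ler_wpM2r // ler_nat leq_exp2l // card_table_dom.
exact: overlap_small.
Qed.

Lemma next_bit_bias_sum i :
  \sum_r next_bit_bias i r <= (2 ^+ d) * ((2 ^ Delta)%:R * eta + gam).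
Proof.
have Y0 : 0 < #|{: Y}|%:R :> R by rewrite card_ffun card_bool ltr0n expn_gt0.
rewrite -(ler_pM2l Y0) (sum_resample i).
apply: le_trans (ler_sum _ (fun r _ => next_bit_bias_resample i r)) _.
by rewrite sumr_const card_tuple card_bool -[X in X <= _]mulr_natl natrX mulrCA.
Qed.

Lemma big_cat_tuple (F : (d + m).-tuple bool -> R) :
  \sum_v F v = \sum_(r : d.-tuple bool) \sum_(w : m.-tuple bool) F [tuple of r ++ w].
Proof.
have bij : bijective (fun p : d.-tuple bool * m.-tuple bool => [tuple of p.1 ++ p.2]).
  apply: inj_card_bij => [[w b] [w' b'] /(congr1 val) /= /eqP|].
    rewrite eqseq_cat ?size_tuple // => /andP [/eqP e1 /eqP e2].
    by congr pair; exact: val_inj.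
  by rewrite card_prod !card_tuple card_bool -expnD.
by rewrite pair_big /= (reindex _ (onW_bij _ bij)).
Qed.

Lemma nw_stat_dist :
  stat_dist
    (image_dist (fun z : T * d.-tuple bool => [tuple of z.2 ++ nw_ext z.1 z.2])
       (prod_dist X (uniform R (d.-tuple bool))))
    (uniform R ((d + m).-tuple bool)) <=
  m%:R * ((2 ^ Delta)%:R * eta + gam) / 2.
Proof.
rewrite /stat_dist big_cat_tuple [X in _ <= X]mulrC ler_pM2l ?invr_gt0 //.
have d0 : 0 < 2 ^+ d :> R by rewrite exprn_gt0.
have E (r : d.-tuple bool) (w : m.-tuple bool) : image_dist (fun z : T * d.-tuple bool => [tuple of z.2 ++ nw_ext z.1 z.2])
       (prod_dist X (uniform R (d.-tuple bool))) [tuple of r ++ w]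
     - uniform R ((d + m).-tuple bool) [tuple of r ++ w]
   = (2 ^+ d)^-1 * (mass X [pred x | nw_ext x r == w :> seq bool] - (2 ^+ m)^-1).
  rewrite !ffunE card_tuple card_bool natrX exprD invfM mulrBr; congr (_ - _).
  rewrite (eq_bigl (fun z => [pred x | nw_ext x r == w :> seq bool] z.1 && (z.2 == r))).
    rewrite (eq_bigr (fun z => X z.1 * (2 ^+ d)^-1)) => [|z _]; last first.
      by rewrite !ffunE card_tuple card_bool natrX.
    rewrite -(pair_big [pred x | nw_ext x r == w :> seq bool]
      (fun r' => r' == r) (fun x _ => X x * (2 ^+ d)^-1)) /=.
    by rewrite /mass mulr_sumr; apply: eq_bigr => x _; rewrite big_pred1_eq mulrC.
  move=> [x r'] /=; rewrite -val_eqE /= eqseq_cat ?size_tuple //.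
  by rewrite [(r' : seq bool) == r]val_eqE; case: (r' =P r) => [->|_]; rewrite ?andbT ?andbF.
apply: le_trans (_ : \sum_(r : d.-tuple bool) (2 ^+ d)^-1 * \sum_(i < m) next_bit_bias i r <= _).
  apply: ler_sum => r _.
  apply: le_trans (_ : (2 ^+ d)^-1 * \sum_(w : m.-tuple bool)
      `|mass X [pred x | nw_ext x r == w :> seq bool] - (2 ^+ m)^-1| <= _).
    rewrite mulr_sumr; apply: ler_sum => w _; by rewrite E normrM (ger0_norm (_ : 0 <= (2 ^+ d)^-1)) // invr_ge0 ltW.
  apply: ler_wpM2l; first by rewrite invr_ge0 ltW.
  apply: (@hybrid R T X m (fun x => nw_ext x r)) => // x; exact: size_tuple.
rewrite -mulr_sumr exchange_big /= mulrC ler_pdivrMr //.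
apply: le_trans (ler_sum _ (fun i _ => next_bit_bias_sum i)) _.
rewrite sumr_const card_ord -[X in X <= _]mulr_natl.
by rewrite mulrCA mulrC.
Qed.

End NW.

(** * The extractor property *)

(** A small set is listed by a tuple of length W padded with [None]. *)
Lemma card_small_sets n W : (#|[set S : {set 'I_n} | (#|S| <= W)%N]| <= n.+1 ^ W)%N.
Proof.
pose g (t : W.-tuple (option 'I_n)) : {set 'I_n} := [set v | Some v \in t].
have -> : (n.+1 ^ W = #|{: W.-tuple (option 'I_n)}|)%N.
  by rewrite card_tuple card_option card_ord.
apply: leq_trans (leq_imset_card g _); apply: subset_leq_card.
apply/fintype.subsetP => S; rewrite inE => SW.
have sz : size (map Some (enum S) ++ nseq (W - #|S|) None) == W.
  by rewrite size_cat size_map -cardE size_nseq subnKC.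
apply/imsetP; exists (Tuple sz) => //; apply/setP => v.
rewrite inE /= mem_cat mem_nseq andbF orbF mem_map; last by move=> ? ? [].
by rewrite mem_enum.
Qed.

Lemma exp2_size_primes N : (0 < N)%N -> (2 ^ size (primes N) <= N)%N.
Proof.
move=> N0; rewrite [X in (_ <= X)%N](prod_prime_decomp N0) prime_decompE big_map /=.
have -> : (2 ^ size (primes N) = \prod_(p <- primes N) 2)%N.
  by rewrite big_const_seq count_predT iter_muln_1.
rewrite big_seq [X in (_ <= X)%N]big_seq; apply: leq_prod => p.
rewrite mem_primes => /and3P [pp _ pN]; apply: leq_trans (prime_gt1 pp) _.
by rewrite -{1}[p]expn1 leq_exp2l ?prime_gt1 // logn_gt0 mem_primes pp N0.
Qed.

Lemma eq_one_bit_seed lm H L n x y y' : (H <= lm)%N ->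
  (forall i h b, (i < L)%N -> (h <= lm)%N -> (b <= lm)%N -> y i h b = y' i h b) ->
  one_bit lm H L n x y = one_bit lm H L n x y'.
Proof.
move=> Hl yy; rewrite /one_bit; congr odd; apply: eq_big_nat => i /andP [_ iL].
apply: eq_bigr => w _; congr (_ * _)%N.
  by apply: eq_big_nat => h /andP [_ hH]; rewrite yy //; lia.
apply: eq_bigr => v _; congr (_ * (_ == _))%N.
apply: eq_big_nat => b /andP [_ bl]; congr (odd (_ + _)).
rewrite /pos_sum yy //; last by lia.
by congr addn; apply: eq_big_nat => h /andP [_ hH]; rewrite yy //; lia.
Qed.

Lemma round_sum_xor lm H n x x' y :
  odd (round_sum lm H n (fun v => x v (+) x' v) y) =
  odd (round_sum lm H n x y) (+) odd (round_sum lm H n x' y).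
Proof.
rewrite -oddD -big_split /=; apply: (big_ind2 (fun p q : nat => odd p = odd q)) => // [p1 q1 p2 q2|w _].
  by rewrite !oddD => -> ->.
rewrite -mulnDr !oddM; congr andb; rewrite -big_split /=.
apply: (big_ind2 (fun p q : nat => odd p = odd q)) => // [p1 q1 p2 q2|v _]; first by rewrite !oddD => -> ->.
by rewrite -mulnDl !oddM oddD !oddb.
Qed.

Section Rounds.
Variables (R : realType) (lm H L n : nat).
Hypotheses (H_lm : (H <= lm)%N) (n_lm : (n <= 2 ^ lm)%N).
Local Notation U := ('I_L * ('I_lm.+1 * 'I_lm.+1))%type.
Local Notation Y := {ffun 'I_lm.+1 * 'I_lm.+1 -> bool}.

Definition seed_fun (y : {ffun U -> bool}) (i h b : nat) : bool :=
  if (insub i : option 'I_L) is Some i' then y (i', (inord h, inord b)) else false.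

Definition round_of (y : {ffun U -> bool}) (i : 'I_L) : Y := [ffun p => y (i, p)].

Lemma sign_one_bit x y : (-1) ^+ one_bit lm H L n x (seed_fun y) =
  \prod_(i < L) (-1) ^+ round_sum lm H n x (round_seed (round_of y i)) :> R.
Proof.
rewrite /one_bit signr_odd big_mkord -expr_sum; congr (_ ^+ _).
apply: eq_bigr => i _; congr round_sum; apply/funext => h; apply/funext => b.
by rewrite /seed_fun valK /round_seed ffunE.
Qed.

Lemma sum_rounds (F : Y -> R) :
  \sum_(y : {ffun U -> bool}) \prod_(i < L) F (round_of y i) = (\sum_(y : Y) F y) ^+ L.
Proof.
rewrite -[in RHS](card_ord L) -prodr_const bigA_distr_bigA /=.
pose phi (g : {ffun 'I_L -> Y}) : {ffun U -> bool} := [ffun u => g u.1 u.2].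
have bij : bijective phi.
  exists (fun y => [ffun i => round_of y i]) => [g|y].
    by apply/ffunP => i; apply/ffunP => p; rewrite !ffunE.
  by apply/ffunP => -[i p]; rewrite !ffunE.
rewrite (reindex _ (onW_bij _ bij)) /=; apply: eq_bigr => g _; apply: eq_bigr => i _.
by congr F; apply/ffunP => p; rewrite !ffunE.
Qed.

(** By linearity the product of the two signs is the sign of the bit on the difference z; since the
    rounds use separate seed bits, its sum is the power [L] of the sum for one round. *)
Lemma pair_bias x x' :
  (2 ^ lm <= 2 ^ (H + 2) * \sum_(0 <= v < n) (x v (+) x' v))%N ->
  \sum_(y : {ffun U -> bool}) (-1) ^+ one_bit lm H L n x (seed_fun y) *
     (-1) ^+ one_bit lm H L n x' (seed_fun y) <=
  (13 / 16) ^+ L * #|{: {ffun U -> bool}}|%:R :> R.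
Proof.
move=> far; set z := fun v => x v (+) x' v.
have -> : \sum_(y : {ffun U -> bool}) (-1) ^+ one_bit lm H L n x (seed_fun y) *
     (-1) ^+ one_bit lm H L n x' (seed_fun y) =
   (\sum_(y : Y) (-1) ^+ round_sum lm H n z (round_seed y)) ^+ L :> R.
  rewrite -sum_rounds; apply: eq_bigr => y _; rewrite !sign_one_bit -big_split /=.
  apply: eq_bigr => i _; rewrite -signr_odd -[X in _ * X = _]signr_odd -signr_addb.
  by rewrite -round_sum_xor signr_odd.
apply: le_trans (ler_norm _) _; rewrite normrX.
have -> : #|{: {ffun U -> bool}}| = (#|{: Y}| ^ L)%N.
  by rewrite !card_ffun !card_prod !card_ord card_bool -expnM [(L * _)%N]mulnC.
rewrite natrX -exprMn; apply: lerXn2r; last exact: round_bias.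
  by rewrite nnegrE.
by rewrite nnegrE mulr_ge0 ?ler0n.
Qed.

End Rounds.

Section Entropy.
Variable R : realType.

Lemma source_bound n (k : R) (X : {ffun n.-tuple bool -> R}) :
  is_source k X -> forall x, X x <= 2 `^ (- k).
Proof.
move=> [[X0 X1] kX] x.
have [x0|x0] := ltP 0 (X x); last by apply: le_trans x0 _; exact: powR_ge0.
have ln2 : 0 < ln 2 :> R by rewrite ln_gt0 // ltr1n.
have X_le1 y : X y <= 1.
  by rewrite -X1 (bigD1 y) //= lerDl; apply: sumr_ge0.
have : k <= log2 (X x)^-1.
  (* The infimum is a lower bound only for a set bounded below; 0 bounds it, since probabilities are
     at most 1. *)
  apply: le_trans kX _; apply: ge_inf; last by exists x.
  exists 0 => _ [y /= y0 <-]; apply: divr_ge0; last exact: ltW.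
  by apply: ln_ge0; rewrite invf_ge1.
rewrite /log2 ler_pdivlMr // lnV // => H.
rewrite -(lnK (x0 : X x \is Num.pos)) /powR pnatr_eq0 /= ler_expR; lra.
Qed.

End Entropy.

Section Strong.
Variables (R : realType) (a c A B k0 n : nat).
Local Notation lm := (bitlen n).
Local Notation H := (log_window c A n).
Local Notation L := (rounds a B n).
Local Notation d := (seed_len a B n).
Local Notation m := (out_len a k0 n).
Local Notation Q := (seed_width a B n).
Local Notation U := ('I_L * ('I_lm.+1 * 'I_lm.+1))%type.
Local Notation T := (n.-tuple bool).

Definition coord (u : U) : nat := bit_seed_idx n u.1 u.2.1 u.2.2.

Lemma coord_lt u : (coord u < bit_seed_len a B n)%N.
Proof.
by apply: bit_seed_idx_lt; [exact: ltn_ord|rewrite -ltnS; exact: ltn_ord..].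
Qed.

Lemma coord_inj : injective coord.
Proof.
move=> [i [h b]] [i' [h' b']]; rewrite /coord /bit_seed_idx /= => E.
have := ltn_ord b; have := ltn_ord b'; have := ltn_ord h; have := ltn_ord h'.
move=> hl' hl bl' bl.
have bb : b = b' :> nat.
  by have := congr1 (modn^~ lm.+1) E; rewrite /= !modnMDl !modn_small.
have E2 : (i * lm.+1 + h = i' * lm.+1 + h')%N.
  by have := congr1 (divn^~ lm.+1) E; rewrite /= !divnMDl // !divn_small // !addn0.
have hh : h = h' :> nat.
  by have := congr1 (modn^~ lm.+1) E2; rewrite /= !modnMDl !modn_small.
have ii : i = i' :> nat.
  by have := congr1 (divn^~ lm.+1) E2; rewrite /= !divnMDl // !divn_small // !addn0.
by congr (_, (_, _)); exact: val_inj.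
Qed.

Definition design (j : 'I_m) (u : U) : 'I_d := Ordinal (design_idx_lt j (coord_lt u)).

Lemma design_eq j j' u u' : design j u = design j' u' ->
  u = u' /\ (j %% nth_prime Q (coord u) = j' %% nth_prime Q (coord u))%N.
Proof.
move/(congr1 val) => /=; rewrite /design_idx => E.
have [p1 q1 _] := design_prime (coord_lt u); have [p2 q2 _] := design_prime (coord_lt u').
have r1 := ltn_trans (ltn_pmod j (prime_gt0 p1)) q1.
have r2 := ltn_trans (ltn_pmod j' (prime_gt0 p2)) q2.
have Q0 : (0 < Q)%N by exact: leq_ltn_trans q1.
have uu : u = u'.
  apply: coord_inj.
  by have := congr1 (divn^~ Q) E; rewrite /= !divnMDl // !divn_small // !addn0.
split=> //; move: E; rewrite -uu => /eqP; rewrite eqn_add2l => /eqP ->.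
by [].
Qed.

Lemma design_inj j : injective (design j).
Proof. by move=> u u' /design_eq []. Qed.

Lemma overlap_card (i j : 'I_m) : (j < i)%N -> (2 ^ #|overlap design i j| <= m)%N.
Proof.
move=> ji; have ij0 : (0 < i - j)%N by rewrite subn_gt0.
apply: leq_trans (_ : 2 ^ size (primes (i - j)) <= _)%N; last first.
  by apply: leq_trans (exp2_size_primes ij0) _; have := ltn_ord i; lia.
rewrite leq_exp2l // cardE -(size_map (fun u => nth_prime Q (coord u))).
apply: uniq_leq_size.
  rewrite map_inj_in_uniq ?enum_uniq // => u u' _ _ E; apply: coord_inj.
  have [_ _ <-] := design_prime (coord_lt u); have [_ _ <-] := design_prime (coord_lt u').
  by rewrite E.
move=> p /mapP [u]; rewrite mem_enum inE => /existsP [u' /eqP /design_eq [uu E]] ->.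
have [pp _ _] := design_prime (coord_lt u); rewrite mem_primes pp ij0 /=.
by rewrite -eqn_mod_dvd ?(ltnW ji) //; apply/eqP; move: E; rewrite uu => ->.
Qed.

Definition bit_fun (x : T) (y : {ffun U -> bool}) : bool :=
  one_bit lm H L n (nth false x) (seed_fun y).

Lemma local_ext_nw : @local_ext a c A B k0 n = nw_ext design bit_fun.
Proof.
apply/funext => x; apply/funext => r; apply: eq_from_tnth => j.
rewrite tnth_the_ext tnth_mktuple /out_bit_of /bit_fun.
apply: eq_one_bit_seed; first exact: geq_minr.
move=> i h b iL hl bl; rewrite /seed_fun insubT ffunE (tnth_nth false) /=.
by rewrite /coord /= !inordK.
Qed.

Variable W : nat.
Hypothesis W_close : forall s, (2 ^ (H + 2) * s < 2 ^ lm)%N -> (s <= W)%N.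

Definition close (x x' : T) : bool :=
  (2 ^ (H + 2) * (\sum_(0 <= v < n) (nth false x v (+) nth false x' v)) < 2 ^ lm)%N.

(** A near string is given by the at most W places where it differs from x, and n + 1 <= 2^lm. *)
Lemma card_close x : (#|[pred x' | close x x']| <= 2 ^ (lm * W))%N.
Proof.
pose S (x' : T) : {set 'I_n} := [set v | tnth x v (+) tnth x' v].
have S_inj : injective S.
  move=> x1 x2 E; apply: eq_from_tnth => v.
  by move/setP: E => /(_ v); rewrite !inE => /addbI.
rewrite expnM; apply: leq_trans (_ : n.+1 ^ W <= _)%N; last first.
  case: (W) => // w; rewrite leq_exp2r //; exact: bitlen_gt.
apply: leq_trans (card_small_sets n W); rewrite -(card_imset _ S_inj).
apply: subset_leq_card; apply/fintype.subsetP => Z /imsetP [x' cl ->]; rewrite inE.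
apply: leq_trans (W_close cl); rewrite -sum1_card big_mkcond /= big_mkord.
by apply: leq_sum => v _; rewrite inE -!(tnth_nth false); case: (_ (+) _).
Qed.

Theorem local_ext_strong (k eta eps : R) : 0 <= eta ->
  (2 ^ (lm * W))%:R * 2 `^ (- k) <= eta ^+ 2 ->
  m%:R * ((2 ^ (m * m))%:R * eta + (13 / 16) ^+ (4 * B * lm ^ a)) / 2 <= eps ->
  strong_extractor k eps (@local_ext a c A B k0 n).
Proof.
move=> eta0 etaE le_eps X srcX; apply: le_trans le_eps; rewrite local_ext_nw.
have sb := source_bound srcX; case: srcX => distX _.
apply: (nw_stat_dist design_inj distX (near := close) eta0).
- by apply: exprn_ge0.
- move=> x; apply: le_trans etaE.
  apply: le_trans (ler_sum _ (fun x' _ => sb x')) _.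
  rewrite sumr_const -[X in X <= _]mulr_natl ler_wpM2r ?powR_ge0 // ler_nat.
  exact: card_close.
- move=> x x'; rewrite /close -leqNgt => far.
  (* gam is the square root of the bias of a far pair, hence has half the number of rounds as
     exponent. *)
  have -> : (13 / 16) ^+ (4 * B * lm ^ a) ^+ 2 = (13 / 16) ^+ L :> R.
    by rewrite -exprM /rounds; congr (_ ^+ _); lia.
  by apply: pair_bias => //; [exact: geq_minr|apply/ltnW; exact: bitlen_gt].
- move=> i; apply: leq_trans (_ : \sum_(j < m) m <= _)%N; last by rewrite sum_nat_const card_ord.
  by rewrite big_mkcond /=; apply: leq_sum => j _; case: ifP => // ji; exact: overlap_card.
Qed.

End Strong.

Local Open Scope classical_set_scope.
Local Open Scope ring_scope.

(** * Locality and asymptotics *)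

(** For a fixed seed, each pair of a round and a point reads at most one source bit; the levels are
    nested and read nothing more. *)
Lemma local_ext_locality a c A B k0 n l :
  (rounds a B n * 2 ^ log_window c A n <= l)%N ->
  has_locality l (@local_ext a c A B k0 n).
Proof.
move=> le r j.
pose y i h b := nth false r (design_idx a B n j (bit_seed_idx n i h b)).
pose hit (p : 'I_(rounds a B n) * 'I_(2 ^ log_window c A n)) (v : nat) :=
  hits (bitlen n) (log_window c A n) (y p.1) p.2 v.
exists (\bigcup_(p : 'I_(rounds a B n) * 'I_(2 ^ log_window c A n))
          [set v : 'I_n | hit p v])%SET; split.
  apply: leq_trans le; apply: leq_trans (_ : \sum_(p : 'I_(rounds a B n) * 'I_(2 ^ log_window c A n)) 1 <= _)%N; last first.
    by rewrite sum1_card card_prod !card_ord.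
  apply: leq_trans (_ : \sum_(p : 'I_(rounds a B n) * 'I_(2 ^ log_window c A n)) #|[set v : 'I_n | hit p v]%SET| <= _)%N.
    apply: (@big_ind2 _ _ (fun (S : {set 'I_n}) (s : nat) => #|S| <= s)%N) => //.
      by rewrite cards0.
    move=> S1 s1 S2 s2 le1 le2; apply: leq_trans (leq_card_setU _ _) _.
    exact: leq_add.
  apply: leq_sum => p _; apply/fintype.card_le1_eqP => v v'; rewrite !inE => hv hv'.
  apply: val_inj; apply: hits_inj hv' hv.
    by apply: ltn_trans (ltn_ord _) (bitlen_gt n).
  by apply: ltn_trans (ltn_ord _) (bitlen_gt n).
move=> x x' agree; rewrite !tnth_the_ext /out_bit_of /one_bit; congr odd.
apply: eq_big_nat => i /andP [_ iL]; apply: eq_big_nat => w /andP [_ wH].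
congr (_ * _)%N; apply: eq_big_nat => v /andP [_ vn].
case: (boolP (hits _ _ _ w v)) => [hv|]; last by rewrite !muln0.
have := agree (Ordinal vn); rewrite !(tnth_nth false) /= => -> //.
apply/bigcupP; exists (Ordinal iL, Ordinal wH) => //.
by rewrite inE.
Qed.

(** * Polynomials against exponentials, bit lengths against logarithms *)

Lemma sqr_le_exp2 y : (4 <= y)%N -> (y * y <= 2 ^ y)%N.
Proof.
elim: y => // y IH; rewrite ltnS leq_eqVlt => /orP [/eqP <- //|y4].
by have := IH y4; rewrite expnS; nia.
Qed.

Lemma poly_le_exp2 D : exists N0, forall x, (N0 <= x)%N -> (x ^ D <= 2 ^ x)%N.
Proof.
elim: D => [|D [N0 IH]]; first by exists 0%N => x _; rewrite expn0 expn_gt0.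
exists (2 * (N0 + 4 + 4 ^ D.+1) + 2)%N => x xN.
(* One factor 2^y pays for the power D, the other for the additional factor and the constant
   4^(D+1). *)
pose y := x./2; have [y1 y2 y3] : [/\ N0 <= y, 4 <= y & 4 ^ D.+1 <= y]%N.
  by rewrite /y; move: (4 ^ _)%N xN => q; split; lia.
apply: leq_trans (_ : (4 * y) ^ D.+1 <= _)%N; first by rewrite leq_exp2r // /y; lia.
apply: leq_trans (_ : 2 ^ y * 2 ^ y <= _)%N; last by rewrite -expnD leq_exp2l // /y; lia.
rewrite expnMn [(y ^ _)%N]expnS mulnA; apply: leq_mul; last exact: IH.
by apply: leq_trans (sqr_le_exp2 y2); rewrite leq_mul2r y3 orbT.
Qed.

Lemma poly_le_exp2_half D E : exists N0, forall x, (N0 <= x)%N ->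
  (E * x ^ D <= 2 ^ (x %/ 2))%N.
Proof.
have [N0 H] := poly_le_exp2 D.+1.
exists (2 * (N0 + 4 ^ D.+1 * E.+1) + 2)%N => x xN.
pose y := (x %/ 2)%N; have xy : (x <= 4 * y)%N by rewrite /y; lia.
have y1 : (N0 <= y)%N by rewrite /y; lia.
have y2 : (4 ^ D * E <= y)%N.
  have : (4 ^ D * E <= 4 ^ D.+1 * E.+1)%N by rewrite leq_mul // leq_exp2l.
  move=> h; apply: leq_trans h _; rewrite /y; move: xN.
  by move: (4 ^ D.+1 * E.+1)%N => q; lia.
apply: leq_trans (H _ y1); apply: leq_trans (_ : E * (4 * y) ^ D <= _)%N.
  by apply: leq_mul => //; case: (D) => // D'; rewrite leq_exp2r.
by rewrite expnMn mulnA [(E * _)%N]mulnC expnS leq_mul2r y2 orbT.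
Qed.

Lemma bitlen_large l0 : \forall n \near \oo, (l0 <= bitlen n)%N.
Proof.
exists (2 ^ l0)%N => // n /= ln; apply: ltnW; rewrite -(@ltn_exp2l 2) //.
by apply: leq_ltn_trans ln _; exact: bitlen_gt.
Qed.

Section Logs.
Variable R : realType.

Lemma log2_exp (x : nat) : log2 (2 ^+ x : R) = x%:R.
Proof.
have ln2 : 0 < ln 2 :> R by rewrite ln_gt0 // ltr1n.
by rewrite /log2 lnXn // -[ln 2 *+ x]mulr_natl mulfK // gt_eqF.
Qed.

Lemma ler_log2 (x y : R) : 0 < x -> x <= y -> log2 x <= log2 y.
Proof.
move=> x0 xy; have ln2 : 0 < ln 2 :> R by rewrite ln_gt0 // ltr1n.
by rewrite /log2 ler_pM2r ?invr_gt0 // ler_ln ?posrE // (lt_le_trans x0).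
Qed.

Lemma log2_bitlen n : (0 < n)%N ->
  log2 (n%:R : R) <= (bitlen n)%:R <= log2 (n%:R : R) + 2.
Proof.
move=> n0; apply/andP; split.
  rewrite -[(bitlen n)%:R]log2_exp; apply: ler_log2; rewrite ?ltr0n // -natrX ler_nat.
  exact/ltnW/bitlen_gt.
have -> : log2 (n%:R : R) + 2 = log2 (n%:R * 2 ^+ 2 : R).
  have ln2 : 0 < ln 2 :> R by rewrite ln_gt0 // ltr1n.
  rewrite -[X in _ + X = _](log2_exp 2) /log2 lnM ?posrE ?ltr0n ?exprn_gt0 //.
  by rewrite mulrDl.
rewrite -[(bitlen n)%:R]log2_exp; apply: ler_log2; first by rewrite exprn_gt0.
rewrite -!natrX -natrM ler_nat; apply: leq_trans (bitlen_le n) _; lia.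
Qed.

End Logs.

Lemma seed_len_ge a B n : (0 < B)%N -> (bitlen n ^ a <= seed_len a B n)%N.
Proof.
move=> B0; rewrite /seed_len /bit_seed_len /rounds.
apply: leq_trans (_ : 8 * B * bitlen n ^ a * (bitlen n).+1 ^ 2 <= _)%N.
  have h1 : (0 < (bitlen n).+1 ^ 2)%N by rewrite expn_gt0.
  have h2 : (bitlen n ^ a <= 8 * B * bitlen n ^ a)%N by rewrite leq_pmull //; lia.
  by apply: leq_trans h2 _; rewrite leq_pmulr.
by rewrite leq_pmulr.
Qed.

(** With l the bit length, [bit_seed_len] is at most l^(a+5), and [seed_width], quadratic in it, at
    most l^8 * l^(2(a+5)). The total exponent 3a + 23 is at most 26a. *)
Lemma seed_len_le a B n : (0 < a)%N -> (8 * B <= bitlen n)%N -> (2 <= bitlen n)%N ->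
  (seed_len a B n <= bitlen n ^ (26 * a))%N.
Proof.
move=> a0; set l := bitlen n => lB l2.
have ellE : (bit_seed_len a B n <= l ^ (a + 5))%N.
  rewrite /bit_seed_len /rounds -/l (_ : a + 5 = 1 + a + 4)%N; last by lia.
  rewrite !expnD expn1 (_ : l ^ 4 = (l ^ 2) ^ 2)%N; last by rewrite -expnM.
  by apply: leq_mul; [exact: leq_mul|rewrite leq_exp2r // expnS expn1; nia].
rewrite /seed_len /seed_width /prime_range.
have := bitlen_le (bit_seed_len a B n); move: (bit_seed_len a B n) ellE => s sE bE.
set E := (l ^ (a + 5))%N in sE; have E0 : (0 < E)%N by rewrite expn_gt0; lia.
have q1 : (2 ^ bitlen s <= 3 * E)%N by lia.
have q2 : ((2 ^ bitlen s) ^ 2 <= 9 * (E * E))%N.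
  by rewrite expnS expn1; apply: leq_trans (leq_mul q1 q1) _; lia.
have q3 : ((16 * (2 ^ bitlen s) ^ 2).+1 <= l ^ 8 * (E * E))%N.
  have h8 : (2 ^ 8 <= l ^ 8)%N by rewrite leq_exp2r.
  have EE : (0 < E * E)%N by rewrite muln_gt0 E0.
  apply: leq_trans (_ : 2 ^ 8 * (E * E) <= _)%N; last by rewrite leq_mul2r h8 orbT.
  by rewrite (_ : 2 ^ 8 = 256)%N //; move: q2 EE; move: (E * E)%N (_ ^ 2)%N => P Q; lia.
apply: leq_trans (leq_mul sE q3) _.
rewrite /E -!expnD leq_exp2l //; lia.
Qed.

(** Exponent a + 1 for the rounds and c + 2 for the points, constants included; a + c + 3 <= 4 (a +
    c) because a is positive. *)
Lemma locality_bound a c A B n : (0 < a)%N -> (8 * B <= bitlen n)%N ->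
  (2 * A + 2 <= bitlen n)%N ->
  (rounds a B n * 2 ^ log_window c A n <= bitlen n ^ (4 * (a + c)))%N.
Proof.
move=> a0; set l := bitlen n => lB lA.
have h1 : (rounds a B n <= l ^ a.+1)%N by rewrite /rounds expnS leq_mul2r lB orbT.
have h2 : (2 ^ log_window c A n <= l ^ c.+2)%N.
  apply: leq_trans (_ : 2 ^ bitlen (A * l ^ c.+1) <= _)%N.
    by rewrite leq_exp2l // geq_minl.
  apply: leq_trans (bitlen_le _) _.
  have : (0 < l ^ c.+1)%N by rewrite expn_gt0; lia.
  rewrite (expnS l c.+1); move: (l ^ c.+1)%N => P P0.
  apply: leq_trans (_ : (2 * A + 2) * P <= _)%N; first by nia.
  by rewrite leq_mul2r lA orbT.
apply: leq_trans (leq_mul h1 h2) _; rewrite -expnD leq_exp2l; lia.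
Qed.

(** * Choice of parameters *)

Section Final.
Variable R : realType.

Lemma pow2_powR (x : nat) : (2 ^ x)%:R = 2 `^ x%:R :> R.
Proof. by rewrite powR_mulrn // natrX. Qed.

Lemma exp2D (x y : R) : 2 `^ (x + y) = 2 `^ x * 2 `^ y.
Proof. by rewrite powRD // pnatr_eq0 implybT. Qed.

Lemma exp2_le (x y : R) : x <= y -> 2 `^ x <= 2 `^ y.
Proof. by move=> xy; apply: ler_powR => //; rewrite ler1n. Qed.

Lemma bitlen_pow_ge n : (0 < n)%N -> (2 ^ bitlen n <= 4 * n)%N.
Proof. by move=> n0; apply: leq_trans (bitlen_le n) _; lia. Qed.

Lemma root_bounds k0 n : (0 < k0)%N -> (0 < n)%N ->
  n%:R `^ (k0%:R^-1) <= 2 * (2 ^ (bitlen n %/ k0))%:R :> R /\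
  (2 ^ (bitlen n %/ k0))%:R <= 4 * n%:R `^ (k0%:R^-1) :> R.
Proof.
move=> k00 n0; set l := bitlen n; set q := (l %/ k0)%N.
have K0 : k0%:R != 0 :> R by rewrite pnatr_eq0 -lt0n.
have Ki : 0 <= k0%:R^-1 :> R by rewrite invr_ge0.
have root (x : nat) : ((x ^ k0)%:R : R) `^ (k0%:R^-1) = x%:R.
  by rewrite natrX -powR_mulrn // -powRrM mulfV // powRr1.
split.
  rewrite -[X in X * _]/(2%:R) -natrM -expnS -[X in _ <= X]root.
  apply: ge0_ler_powR; rewrite ?nnegrE ?ler0n // ler_nat -expnM.
  apply: leq_trans (ltnW (bitlen_gt n)) _; rewrite leq_exp2l //.
  by rewrite -/l (divn_eq l k0) -/q mulSn addnC leq_add2r ltnW // ltn_pmod.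
rewrite -[X in X <= _]root.
apply: le_trans (_ : (4 * n)%:R `^ (k0%:R^-1) <= _).
  apply: ge0_ler_powR; rewrite ?nnegrE ?ler0n // ler_nat -expnM.
  apply: leq_trans (bitlen_pow_ge n0); rewrite leq_exp2l //.
  exact: leq_trunc_div.
rewrite natrM powRM ?ler0n // ler_wpM2r ?powR_ge0 //.
rewrite -[X in _ <= X]powRr1 ?ler0n //; apply: ler_powR; first by rewrite ler1n.
by rewrite invf_le1 ?ler1n // ltr0n.
Qed.

(** The two comparisons with 2^(l / 2), about the square root of n, ask n to be large: the first
    places the length of m, m^2 and e together below k / 4, the second makes the minimum in
    [log_window] its first argument. *)
Lemma strong_params a c A B k0 n (k e Be : R) :
  (0 < a)%N -> (0 < A)%N -> (4 <= k0)%N -> (0 < n)%N ->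
  (8 * A * (a + 2 + B) * bitlen n ^ (2 * a + c) <= 2 ^ (bitlen n %/ 2))%N ->
  (A.+1 * bitlen n ^ c.+1 <= 2 ^ (bitlen n %/ 2))%N ->
  2 * n%:R <= k * (A * bitlen n ^ c)%:R ->
  e <= Be * (bitlen n ^ a)%:R -> Be + a%:R + 1 <= B%:R -> 0 <= Be ->
  strong_extractor k (1 / 2 `^ e) (@local_ext a c A B k0 n).
Proof.
move=> a0 A0 k04 n0; set l := bitlen n => big1 big2 kA eB BeB Be0.
have l0 : (0 < l)%N by rewrite up_log_gt0; lia.
have lc0 : (0 < l ^ c)%N by rewrite expn_gt0 l0.
have Alc : (0 < A * l ^ c)%N by rewrite muln_gt0 A0 lc0.
set W := (n %/ (A * l ^ c.+1))%N.
have WE : (l * W * (A * l ^ c) <= n)%N.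
  have := leq_trunc_div n (A * l ^ c.+1); rewrite -/W expnS; lia.
have k_W : (l * W)%:R <= k / 2.
  have : (l * W)%:R * (A * l ^ c)%:R <= n%:R :> R by rewrite -natrM ler_nat.
  have : 0 < (A * l ^ c)%:R :> R by rewrite ltr0n.
  move: ((A * l ^ c)%:R : R) ((l * W)%:R : R) (n%:R : R) kA => P Q N kA P0 QN.
  by rewrite -(ler_pM2r P0); lra.
have m_le : (out_len a k0 n <= 2 ^ (l * a.+1))%N.
  rewrite /out_len mulnS expnD; apply: leq_mul; first by rewrite leq_exp2l // leq_div.
  rewrite expnM; case: (a) => // a'; rewrite leq_exp2r //; apply/ltnW; exact: ltn_expl.
set m := out_len a k0 n in m_le.
(* Here [4 <= k0] enters: the square of 2^(l / k0) is at most 2^(l / 2). *)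
have mm_le : (m * m <= 2 ^ (l %/ 2) * l ^ (2 * a))%N.
  rewrite /m /out_len -/l mulnACA -!expnD !addnn -!mul2n leq_mul2r leq_exp2l //.
  apply/orP; right; rewrite leq_divRL // mulnAC mulnC.
  apply: leq_trans (_ : (l %/ k0) * k0 <= _)%N; last exact: leq_trunc_div.
  by rewrite leq_mul2l; lia.
have la1 : (l <= l ^ a)%N by case: (a) a0 => // a' _; rewrite expnS leq_pmulr // expn_gt0 l0.
have la2 : (l ^ a <= l ^ (2 * a))%N by rewrite leq_pexp2l //; lia.
have sumE : (l * a.+1)%:R + (m * m)%:R + e <= k / 4.
  have kk : (2 ^ (l %/ 2) * ((a + 2 + B) * l ^ (2 * a)))%:R <= k / 4.
    have n4 : (2 ^ (l %/ 2) * 2 ^ (l %/ 2) <= 4 * n)%N.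
      apply: leq_trans (bitlen_pow_ge n0); rewrite -expnD leq_exp2l //; lia.
    have P0 : 0 < (A * l ^ c)%:R :> R by rewrite ltr0n.
    rewrite -(ler_pM2r P0).
    have : (2 ^ (l %/ 2) * ((a + 2 + B) * l ^ (2 * a)) * (A * l ^ c) * 8 <= 4 * n)%N.
      apply: leq_trans n4; rewrite -!mulnA leq_mul2l; apply/orP; right.
      by apply: leq_trans big1; rewrite expnD; lia.
    rewrite -(ler_nat R) !natrM; move: kA; rewrite !natrM; lra.
  apply: le_trans kk; have : (l * a.+1 + m * m + B * l ^ a <=
      2 ^ (l %/ 2) * ((a + 2 + B) * l ^ (2 * a)))%N.
    have h0 : (0 < 2 ^ (l %/ 2))%N by rewrite expn_gt0.
    rewrite (_ : (a + 2 + B) = (a.+1 + 1 + B))%N; last by lia.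
    move: (a.+1) => b; rewrite mulnDl mulnDl mul1n mulnDr mulnDr.
    apply: leq_add; first apply: leq_add => //.
    - rewrite mulnC; apply: leq_trans (_ : b * l ^ (2 * a) <= _)%N.
        by rewrite leq_mul2l (leq_trans la1 la2) orbT.
      by rewrite leq_pmull.
    - apply: leq_trans (_ : B * l ^ (2 * a) <= _)%N; last by rewrite leq_pmull.
      by rewrite leq_mul2l la2 orbT.
  rewrite -(ler_nat R) !natrD => h; apply: le_trans h.
  rewrite lerD2l; apply: le_trans eB _; rewrite natrM ler_wpM2r ?ler0n //.
  by have : 0 <= a%:R :> R by []; lra.
(* The 2^(l W) near strings have mass at most 2^(-k) each and l W <= k / 2, so eta^2 = 2^(-k/2)
   covers them. The k / 4 bits of eta then pay for m, for the 2^(m^2) tables and for the error. *)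
pose eta : R := 2 `^ (- (k / 4)).
have eta_sq : eta ^+ 2 = 2 `^ (- (k / 2)).
  by rewrite expr2 /eta -exp2D; congr (_ `^ _); lra.
apply: (@local_ext_strong R a c A B k0 n W _ k eta).
- move=> s; rewrite -/l => sl.
  have HE : log_window c A n = bitlen (A * l ^ c.+1).
    rewrite /log_window -/l (minn_idPl _) //; apply: up_log_min => //.
    apply: leq_trans (_ : A.+1 * l ^ c.+1 <= _)%N.
      by rewrite mulSn -add1n leq_add2r expn_gt0 l0.
    by apply: leq_trans big2 _; rewrite leq_exp2l // leq_div.
  rewrite leq_divRL ?muln_gt0 ?A0 ?expn_gt0 ?l0 //.
  have := bitlen_gt (A * l ^ c.+1); rewrite -HE.
  have := bitlen_le n; rewrite -/l; move: sl; rewrite expnD (_ : 2 ^ 2 = 4)%N //.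
  move: (2 ^ log_window c A n)%N (2 ^ l)%N (A * l ^ c.+1)%N => P Q V sl Qn VP.
  have : (V * s <= P * s)%N by rewrite leq_mul2r ltnW ?orbT.
  by rewrite [(s * V)%N]mulnC; lia.
- exact: powR_ge0.
- rewrite -/l eta_sq pow2_powR -exp2D; apply: exp2_le; lra.
- rewrite -/m -/l div1r -powRN.
  (* m <= 2^(l (a+1)) and l <= l^a, so with B >= Be + a + 1 at least e of the B l^a bits remain. *)
  have g_le : m%:R * (13 / 16) ^+ (4 * B * l ^ a) <= 2 `^ (- e) :> R.
    have -> : (13 / 16) ^+ (4 * B * l ^ a) = ((13 / 16) ^+ 4) ^+ (B * l ^ a) :> R.
      by rewrite -exprM mulnA.
    apply: le_trans (_ : (2 ^ (l * a.+1))%:R * (2 `^ (-1)) ^+ (B * l ^ a) <= _).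
      apply: ler_pM => //; rewrite ?ler_nat // ?exprn_ge0 //.
      apply: lerXn2r; rewrite ?nnegrE ?exprn_ge0 ?powR_ge0 //.
      by rewrite powRN powRr1 // !exprS expr0; lra.
    rewrite pow2_powR -powR_mulrn ?powR_ge0 // -powRrM -exp2D; apply: exp2_le.
    have h : l%:R <= (l ^ a)%:R :> R by rewrite ler_nat.
    rewrite !natrM; move: h eB; move: (l%:R : R) ((l ^ a)%:R : R) (ler0n R (l ^ a)) => x y y0 xy eB.
    have a1 : a.+1%:R = a%:R + 1 :> R by rewrite -natr1.
    have ag : 0 <= a%:R :> R by [].
    rewrite a1; nra.
  have e_le : m%:R * ((2 ^ (m * m))%:R * eta) <= 2 `^ (- e) :> R.
    apply: le_trans (_ : (2 ^ (l * a.+1))%:R * ((2 ^ (m * m))%:R * eta) <= _).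
      by rewrite ler_wpM2r ?mulr_ge0 ?powR_ge0 ?ler0n // ler_nat.
    rewrite /eta !pow2_powR -!exp2D; apply: exp2_le; lra.
  by rewrite mulrDr; lra.
Qed.

End Final.

Section Asymptotic_bounds.
Variables (R : realType) (n : nat).
Local Notation l := (bitlen n).
Local Notation t := (log2 (n%:R : R)).
Hypothesis l6 : (6 <= l)%N.

Lemma large_n_gt0 : (0 < n)%N.
Proof. by case: n l6 => //; rewrite /bitlen up_log1. Qed.

Lemma large_log : 4 <= t.
Proof.
have /andP [_ tl] := log2_bitlen R large_n_gt0.
have h : 6%:R <= l%:R :> R by rewrite ler_nat.
lra.
Qed.

Lemma log_pow_le N : t `^ N%:R <= (l ^ N)%:R.
Proof.
have t4 := large_log; have /andP [tl _] := log2_bitlen R large_n_gt0.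
rewrite powR_mulrn; last by lra.
by rewrite natrX lerXn2r // ?nnegrE ?ler0n //; lra.
Qed.

(** l <= t + 2 <= t^2 for t >= 4; doubling the exponent leaves no multiplicative constant. *)
Lemma pow_le_log N : (l ^ N)%:R <= t `^ (2 * N)%:R.
Proof.
have t4 := large_log; have /andP [_ tl] := log2_bitlen R large_n_gt0.
rewrite powR_mulrn; last by lra.
rewrite natrX exprM lerXn2r // ?nnegrE ?ler0n ?exprn_ge0 //; first by lra.
by rewrite expr2; nra.
Qed.

Lemma out_len_ge a k0 : (0 < k0)%N ->
  n%:R `^ (k0%:R^-1) * t ^+ a / 2 <= (out_len a k0 n)%:R :> R.
Proof.
move=> k00; have [h _] := root_bounds R k00 large_n_gt0.
have := log_pow_le a; rewrite powR_mulrn; last by have := large_log; lra.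
rewrite /out_len natrM => ta.
have t0 : 0 <= t ^+ a by rewrite exprn_ge0 //; have := large_log; lra.
have r0 : 0 <= n%:R `^ (k0%:R^-1) :> R by exact: powR_ge0.
rewrite -mulrA [_ ^+ a / _]mulrC mulrA; apply: ler_pM => //.
by rewrite ler_pdivrMr // mulrC.
Qed.

(** Halving the exponent of t gains a factor t^(a/2) >= 2, which makes up for the rounding of l /
    k0. *)
Lemma out_len_polylog_ge a k0 : (0 < a)%N -> (0 < k0)%N ->
  n%:R `^ (k0%:R^-1) * t `^ (2^-1 * a%:R) <= (out_len a k0 n)%:R :> R.
Proof.
move=> a0 k00; apply: le_trans (out_len_ge a k00).
rewrite -mulrA ler_wpM2l ?powR_ge0 //.
have t4 := large_log; set s := t `^ _.
have s0 : 0 <= s by exact: powR_ge0.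
have ss : s * s = t ^+ a.
  rewrite -powR_mulrn; last by lra.
  rewrite /s -powRD; last by apply/implyP => _; lra.
  by congr (_ `^ _); lra.
have : 4 <= t ^+ a.
  apply: (le_trans t4); rewrite -{1}[t]expr1; apply: ler_weXn2l => //; lra.
by rewrite -ss ler_pdivlMr //; nra.
Qed.

Lemma out_len_polylog_le a k0 : (0 < a)%N -> (0 < k0)%N ->
  (out_len a k0 n)%:R <= n%:R `^ (k0%:R^-1) * t `^ (3 * a%:R) :> R.
Proof.
move=> a0 k00; have [_ h] := root_bounds R k00 large_n_gt0.
have t4 := large_log; rewrite /out_len natrM.
apply: le_trans (_ : 4 * n%:R `^ (k0%:R^-1) * t `^ (2 * a)%:R <= _).
  by apply: ler_pM => //; exact: pow_le_log.
rewrite [4 * _]mulrC -mulrA ler_wpM2l ?powR_ge0 // natrM.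
have -> : 3 * a%:R = a%:R + 2 * a%:R :> R by ring.
rewrite powRD; last by apply/implyP => _; lra.
rewrite ler_wpM2r ?powR_ge0 // powR_mulrn; last by lra.
by apply: (le_trans t4); rewrite -{1}[t]expr1; apply: ler_weXn2l => //; lra.
Qed.

End Asymptotic_bounds.

(** * Assembling the extractor family *)

Lemma bitlen_large_seq (ls : seq nat) :
  \forall n \near \oo, all (fun l0 => l0 <= bitlen n)%N ls.
Proof.
elim: ls => [|l0 ls IH]; first exact: filterS (bitlen_large 0).
by apply: filterS2 (bitlen_large l0) IH => n l0n /= ->; rewrite l0n.
Qed.

Lemma extractor_family (R : realType) (k0 : nat) : (4 <= k0)%N ->
  exists (Cdepth Cd Cm Cl : R * R) (delta : R),
    [/\ Theta_consts Cdepth, Theta_consts Cd, Theta_consts Cm,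
        Theta_consts Cl & 0 < delta] /\
    forall (a c : nat) (k eps e : nat -> R),
      (0 < a)%N ->
      is_Theta k (fun n => n%:R / log2 n%:R ^+ c) ->
      is_Theta e (fun n => log2 n%:R ^+ a) ->
      (forall n, eps n = 1 / 2 `^ e n) ->
      exists (d m l : nat -> nat) (depth : nat) (Ext : ext_family d m),
        explicit Ext /\
        computable_in_AC0 depth Ext /\
        Theta_with Cdepth depth%:R (a + c)%:R /\
        (\forall n \near \oo, strong_extractor (k n) (eps n) (Ext n)) /\
        (\forall n \near \oo, has_locality (l n) (Ext n)) /\
        polylog_Theta_with Cd a%:R (fun _ => 1) (fun n => (d n)%:R) /\
        polylog_Theta_with Cm a%:R (fun n => n%:R `^ (k0%:R^-1))
          (fun n => (m n)%:R) /\
        (\forall n \near \oo, k n `^ delta <= (m n)%:R) /\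
        polylog_Theta_with Cl (a + c)%:R (fun _ => 1) (fun n => (l n)%:R).
Proof.
move=> k04; have k00 : (0 < k0)%N by lia.
(* 3 (a + c) + 14 <= 17 (a + c) as a is positive; 52 and 8 double the exponents 26 and 4 of the bit
   length in the seed length and the locality; 1/2 and 3 absorb the constants in the output
   length. *)
exists (1, 17), (1, 52), (2^-1, 3), (1, 8), (k0%:R^-1).
split.
  split; rewrite /Theta_consts /=; try (split; lra).
  by rewrite invr_gt0 ltr0n.
move=> a c k eps e a0 [c1 [c2 [c10 c20 Tk]]] [e1 [e2 [e10 e20 Te]]] epsE.
(* [A] makes k * A log^c n at least 2n; [B] dominates the constant of e and the loss caused by the
   factor m. *)
pose A := Num.bound (2 / c1); pose B := Num.bound (e2 + a%:R + 1).
have AE : 2 <= A%:R * c1.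
  have : 2 / c1 < A%:R by apply: archi_boundP; rewrite divr_ge0 ?ltW.
  by rewrite ltr_pdivrMr // => /ltW.
have A0 : (0 < A)%N.
  by rewrite lt0n; apply/eqP => AE0; move: AE; rewrite AE0 mul0r; lra.
have BE : e2 + a%:R + 1 <= B%:R.
  apply/ltW/archi_boundP; have : 0 <= a%:R :> R by []; lra.
have B0 : (0 < B)%N.
  rewrite lt0n; apply/eqP => BE0; move: BE; rewrite BE0.
  by have : 0 <= a%:R :> R by []; lra.
have [N1 H1] := poly_le_exp2_half (2 * a + c) (8 * A * (a + 2 + B)).
have [N2 H2] := poly_le_exp2_half c.+1 A.+1.
(* Once log n >= M, the factor log^a n of the output length outweighs the constant lost between
   k^(1/k0) and n^(1/k0). *)
pose M := Num.bound (2 * (c2 + 1)).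
have ME : 2 * (c2 + 1) <= M%:R by apply/ltW/archi_boundP; lra.
have near_l := bitlen_large_seq [:: N1; N2; 8 * B; 2 * A + 2; M + 2; 6]%N.
exists (seed_len a B), (out_len a k0), (fun n => bitlen n ^ (4 * (a + c)))%N,
  (3 * (a + c) + 14)%N, (@local_ext a c A B k0).
split; first exact: local_ext_explicit.
split; first exact: local_ext_AC0.
split.
  rewrite /Theta_with /= !mul1r -natrM !ler_nat; apply/andP; split; lia.
split.
  apply: filterS3 near_l Tk Te => n /and5P [lN1 lN2 lB lA /and3P [lM l6 _]] /andP [Tk1 _] /andP [_ Te2].
  have n0 := large_n_gt0 l6; have t4 := large_log R l6.
  have /andP [tl _] := log2_bitlen R n0.
  rewrite epsE; apply: (@strong_params R a c A B k0 n (k n) (e n) e2) => //.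
  - exact: H1.
  - exact: H2.
  - rewrite natrM natrX; set t := log2 _ in t4 tl Tk1 *.
    have tc : 0 < t ^+ c by rewrite exprn_gt0 //; lra.
    have lc : t ^+ c <= (bitlen n)%:R ^+ c by rewrite lerXn2r // ?nnegrE ?ler0n //; lra.
    apply: le_trans (_ : c1 * (n%:R / t ^+ c) * (A%:R * t ^+ c) <= _).
      rewrite (_ : c1 * (n%:R / t ^+ c) * (A%:R * t ^+ c) = A%:R * c1 * n%:R); last first.
        by field; rewrite gt_eqF.
      by rewrite ler_wpM2r.
    apply: ler_pM => //; rewrite ?ler_wpM2l //.
      by apply: mulr_ge0; [exact: ltW|apply: divr_ge0; [exact: ler0n|exact: ltW]].
    by apply: mulr_ge0; [exact: ler0n|exact: ltW].
  - apply: le_trans Te2 _; apply: ler_wpM2l; first exact: ltW.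
    by rewrite natrX lerXn2r // ?nnegrE ?ler0n //; lra.
  - exact: ltW.
split.
  apply: filterS near_l => n /and5P [lN1 lN2 lB lA /and3P [lM l6 _]]; apply: local_ext_locality.
  exact: locality_bound.
split.
  apply: filterS near_l => n /and5P [lN1 lN2 lB lA /and3P [lM l6 _]].
  rewrite !mul1r /=; apply/andP; split.
    apply: le_trans (log_pow_le R l6 a) _; rewrite ler_nat; exact: seed_len_ge.
  rewrite (_ : 52 * a%:R = (2 * (26 * a))%:R); last by rewrite mulnA natrM.
  apply: le_trans (pow_le_log R l6 _); rewrite ler_nat.
  by apply: seed_len_le => //; exact: leq_trans l6.
split.
  apply: filterS near_l => n /and5P [lN1 lN2 lB lA /and3P [lM l6 _]].
  by rewrite /= out_len_polylog_ge // out_len_polylog_le.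
split.
  apply: filterS2 near_l Tk => n /and5P [lN1 lN2 lB lA /and3P [lM l6 _]] /andP [Tk1 Tk2].
  have n0 := large_n_gt0 l6; have t4 := large_log R l6.
  have /andP [_ tl] := log2_bitlen R n0.
  apply: le_trans (out_len_ge R l6 a k00).
  set t := log2 _ in t4 tl Tk1 Tk2 *.
  have tc : 1 <= t ^+ c by rewrite exprn_ege1 //; lra.
  have kn : k n <= c2 * n%:R.
    apply: le_trans Tk2 _; apply: ler_wpM2l; first exact: ltW.
    by rewrite ler_pdivrMr ?ler_peMr //; lra.
  have k_ge0 : 0 <= k n.
    apply: le_trans Tk1; apply: mulr_ge0; first exact: ltW.
    by apply: divr_ge0; [exact: ler0n|lra].
  have d0 : 0 <= k0%:R^-1 :> R by rewrite invr_ge0.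
  apply: le_trans (_ : (c2 * n%:R) `^ (k0%:R^-1) <= _).
    by apply: ge0_ler_powR; rewrite ?nnegrE // mulr_ge0 // ltW.
  rewrite powRM ?(ltW c20) ?ler0n // [X in X <= _]mulrC -mulrA ler_wpM2l ?powR_ge0 //.
  have h1 : c2 `^ (k0%:R^-1) <= c2 + 1.
    apply: le_trans (_ : (c2 + 1) `^ (k0%:R^-1) <= _).
      by apply: ge0_ler_powR; rewrite ?nnegrE; lra.
    rewrite -[X in _ <= X]powRr1; last by lra.
    apply: ler_powR; first by lra.
    by rewrite invf_le1 ?ler1n // ltr0n.
  apply: le_trans h1 _; rewrite ler_pdivlMr // mulrC.
  apply: le_trans ME _; apply: le_trans (_ : t <= _).
    by move: lM; rewrite -(ler_nat R) natrD; lra.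
  by rewrite -{1}[t]expr1; apply: ler_weXn2l => //; lra.
apply: filterS near_l => n /and5P [lN1 lN2 lB lA /and3P [lM l6 _]].
rewrite !mul1r /=; apply/andP; split.
  apply: le_trans (log_pow_le R l6 (a + c)) _; rewrite ler_nat leq_pexp2l //; lia.
rewrite (_ : 8 * (a + c)%:R = (2 * (4 * (a + c)))%:R); last by rewrite mulnA natrM.
exact: pow_le_log.
Qed.

Theorem mainTheorem8 (R : realType) :
  exists (Cdepth Cd Cm Cl : R * R) (delta : R),
    [/\ Theta_consts Cdepth, Theta_consts Cd, Theta_consts Cm,
        Theta_consts Cl & 0 < delta] /\
    forall (a c : nat) (k eps e : nat -> R) (gamma : R),
      (0 < a)%N ->
      is_Theta k (fun n => n%:R / log2 n%:R ^+ c) ->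
      is_Theta e (fun n => log2 n%:R ^+ a) ->
      (forall n, eps n = 1 / 2 `^ e n) ->
      0 < gamma < 1 ->
      exists (d m l : nat -> nat) (depth : nat) (Ext : ext_family d m),
        explicit Ext /\
        computable_in_AC0 depth Ext /\
        Theta_with Cdepth depth%:R (a + c)%:R /\
        (\forall n \near \oo, strong_extractor (k n) (eps n) (Ext n)) /\
        (\forall n \near \oo, has_locality (l n) (Ext n)) /\
        polylog_Theta_with Cd a%:R (fun _ => 1) (fun n => (d n)%:R) /\
        polylog_Theta_with Cm a%:R (fun n => n%:R `^ (10800%:R^-1))
          (fun n => (m n)%:R) /\
        (\forall n \near \oo, k n `^ delta <= (m n)%:R) /\
        polylog_Theta_with Cl (a + c)%:R (fun _ => 1) (fun n => (l n)%:R).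
Proof.
(* The root k0 of the construction is a fixed number from 4 on; the exponent in the statement is the
   case k0 = 10800. *)
have [Cdepth [Cd [Cm [Cl [delta [HC H]]]]]] := @extractor_family R 10800%N isT.
exists Cdepth, Cd, Cm, Cl, delta; split=> // a c k eps e gamma a0 Tk Te Ee _.
exact: (H a c k eps e a0 Tk Te Ee).
Qed.
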